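(* Let $T$ be a band operator on $\mathbb{R}^N$ with band parameter $r\in\mathbb{Z}_+$, and let $u,v\ge 0$ with $u,v\in L^1_{\mathrm{loc}}(\mathbb{R}^N)$. Then the operator $M_v^{1/2}TM_u^{1/2}$ extends to a bounded operator in $L^2(\mathbb{R}^N)$ if and only if there is a constant $C<\infty$ such that for all dyadic cubes $Q$ the following two inequalities hold: $$\int_{\mathbb{R}^N}|T(\chi_Q u)|^2\,v\,dx\le C\int_Q u\,dx,\qquad \int_{\mathbb{R}^N}|T^*(\chi_Q v)|^2\,u\,dx\le C\int_Q v\,dx .$$ Moreover, the norm of the operator $M_v^{1/2}TM_u^{1/2}$ can be estimated by a constant depending only on the dimension $N$, the number $r$, and the constant $C$ in the two inequalities.
   Context: Dyadic cubes: $\mathcal{D}$ is the standard dyadic lattice in $\mathbb{R}^N$, i.e. the union over $k\in\mathbb{Z}$ of the families of all translates of $[0,2^k)^N$ by vectors with coordinates of the form $j\cdot 2^k$, $j\in\mathbb{Z}$. Each dyadic cube has $2^N$ children (the dyadic cubes of half its side length contained in it) and a unique parent. $\mathcal{D}$ is viewed as a non-oriented graph in which each cube is joined by an edge to each of its $2^N$ children; $d_{\text{tree}}(Q,R)$ is the graph distance, every edge having length $1$ (it is $\infty$ if $Q$ and $R$ are not connected). Haar functions: a Haar function on a dyadic cube $Q$ is a function $h_Q$ supported on $Q$, constant on each child of $Q$, with $\int_Q h_Q\,dx=0$. Band operator: a bounded operator $T$ on $L^2(\mathbb{R}^N)$ for which there is $r\in\mathbb{Z}_+=\{0,1,2,\dots\}$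 (the band parameter) such that $\langle Th_Q,h_R\rangle=0$ for all Haar functions $h_Q$ on $Q$ and $h_R$ on $R$ whenever $Q,R$ are dyadic cubes with $d_{\text{tree}}(Q,R)>r$. Here $\langle f,g\rangle=\int f\overline{g}\,dx$, and $T^*$ is the adjoint of $T$ in $L^2(\mathbb{R}^N)$. $M_\phi$ is multiplication by $\phi$, $M_v^{1/2}=M_{v^{1/2}}$, and $\chi_Q$ is the indicator function of $Q$. The statement that $M_v^{1/2}TM_u^{1/2}$ extends to a bounded operator in $L^2$ with norm at most $B$ means that $\|v^{1/2}T(u^{1/2}f)\|_{L^2}\le B\|f\|_{L^2}$ for all $f\in L^2(\mathbb{R}^N)$ with $u^{1/2}f\in L^2(\mathbb{R}^N)$. Interpretation of $T(\chi_Qu)$ and $T^*(\chi_Qv)$: if $\chi_Qu\in L^2$ (resp. $\chi_Qv\in L^2$), the first (resp. second) inequality is read literally. Otherwise it is read as a uniform estimate for truncations: with $u_n=\min\{u,n\}$ and $v_n=\min\{v,n\}$, the first inequality means $\int_{\mathbb{R}^N}|T(\chi_Qu_n)|^2v\,dx\le C\int_Qu\,dx$ for all $n\ge1$, and the second means $\int_{\mathbb{R}^N}|T^*(\chi_Qv_n)|^2u\,dx\le C\int_Qv\,dx$ for all $n\ge1$. *)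

(* Defs.v *)
From HB Require Import structures.
From mathcomp Require Import all_boot all_order all_algebra.
From mathcomp Require Import complex.
From mathcomp Require Import all_classical all_reals all_analysis.

Set Implicit Arguments.
Unset Strict Implicit.
Unset Printing Implicit Defensive.
Import Order.TTheory GRing.Theory Num.Theory.
Import numFieldNormedType.Exports.
Import ComplexField.Normc.

Local Open Scope classical_set_scope.
Local Open Scope ring_scope.
Local Open Scope complex_scope.

(* MathComp-Analysis equips tuples with the product sigma-algebra but has no
   product measure on them: it is built here by transporting the binary product
   measure along (x, t) |-> x :: t. *)
Section transported_product.
Context {d1 d2 d3} {T1 : measurableType d1} {T2 : measurableType d2}
  {T3 : measurableType d3} {R : realType}.
Variables (f : T1 * T2 -> T3) (g : T3 -> T1 * T2).
Hypotheses (mf : measurable_fun setT f) (mg : measurable_fun setT g).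
Hypothesis fK : cancel f g.
Variable m1 : {sigma_finite_measure set T1 -> \bar R}.
Variable m2 : {sigma_finite_measure set T2 -> \bar R}.

Definition transported_product of measurable_fun setT f & measurable_fun setT g
    & cancel f g : set T3 -> \bar R :=
  pushforward (m1 \x m2)%E f.

Let nu := transported_product mf mg fK.

Let nu0 : nu set0 = 0%E.
Proof. by rewrite /nu /transported_product /pushforward preimage_set0 measure0. Qed.

Let nu_ge0 A : (0 <= nu A)%E.
Proof. exact: (measure_ge0 (m1 \x m2)%E). Qed.

Let nu_sigma_additive : semi_sigma_additive nu.
Proof.
exact: (@measure_semi_sigma_additive _ _ _
  (measure_function_pushforward__canonical__measure_function_Measure
    (m1 \x m2)%E mf)).
Qed.

HB.instance Definition _ := isMeasure.Build _ _ _
  (transported_product mf mg fK) nu0 nu_ge0 nu_sigma_additive.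

Let nu_sigma_finite : sigma_finite setT nu.
Proof.
have /sigma_finiteP[F [FT ndF Foo]] := sigma_finiteT m1.
have /sigma_finiteP[G [GT ndG Goo]] := sigma_finiteT m2.
exists (fun k => g @^-1` (F k `*` G k)).
  rewrite -preimage_bigcup [X in g @^-1` X](_ : _ = setT) ?preimage_setT//.
  apply/seteqP; split => // -[x y] _.
  have [i _ Fix] : (\bigcup_k F k) x by rewrite -FT.
  have [j _ Gjy] : (\bigcup_k G k) y by rewrite -GT.
  exists (maxn i j) => //; split => /=.
  - by move: x Fix; exact/subsetPset/ndF/leq_maxl.
  - by move: y Gjy; exact/subsetPset/ndG/leq_maxr.
move=> k; have [mF Fk] := Foo k; have [mG Gk] := Goo k; split.
  by rewrite -[X in measurable X]setTI; apply: mg => //; exact: measurableX.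
rewrite /nu /transported_product /pushforward -comp_preimage.
rewrite (_ : g \o f = id) ?preimage_id; last by apply/funext => p /=; rewrite fK.
by rewrite product_measure1E// lte_mul_pinfty// ge0_fin_numE.
Qed.

HB.instance Definition _ := Measure_isSigmaFinite.Build _ _ _
  (transported_product mf mg fK) nu_sigma_finite.

End transported_product.

Section cons_pair.
Context {d} {T : measurableType d} (n : nat).

Definition cons_pair (p : T * n.-tuple T) : n.+1.-tuple T :=
  [the n.+1.-tuple T of p.1 :: p.2].

Definition uncons_pair (t : n.+1.-tuple T) : T * n.-tuple T :=
  (tnth t ord0, [tuple of behead t]).

Lemma measurable_cons_pair : measurable_fun setT cons_pair.
Proof. exact: measurable_cons. Qed.

Lemma measurable_uncons_pair : measurable_fun setT uncons_pair.
Proof.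
apply: measurable_fun_pair; first exact: measurable_tnth.
exact: measurable_behead.
Qed.

Lemma cons_pairK : cancel cons_pair uncons_pair.
Proof. by case=> x t; rewrite /uncons_pair tnth0; congr pair; apply/val_inj. Qed.

End cons_pair.

Notation Rn R N := (N.-tuple (measurableTypeR R)).

Fixpoint lebesgue_measureN (R : realType) (n : nat) :
    {sigma_finite_measure set (Rn R n) -> \bar R} :=
  match n with
  | 0%N => \d_[tuple]
  | n'.+1 => transported_product (@lebesgue_measure R) (lebesgue_measureN R n')
      (@measurable_cons_pair _ _ n') (@measurable_uncons_pair _ _ n')
      (@cons_pairK _ _ n')
  end.

Section lebesgue_measureN_box.
Context {R : realType}.
Local Open Scope ereal_scope.

Definition box N (a b : 'I_N -> R) : set (Rn R N) :=
  [set x | forall i, (a i <= tnth x i < b i)%R].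

Lemma measurable_box N (a b : 'I_N -> R) : measurable (box a b).
Proof.
rewrite (_ : box a b = \bigcap_(i in [set: 'I_N])
    ((fun x : Rn R N => tnth x i) @^-1` `[a i, b i[%classic)); last first.
  apply/seteqP; split => x /=.
    by move=> h i _; rewrite /= in_itv/=; exact: h.
  by move=> h i; have := h i I; rewrite /= in_itv.
apply: fin_bigcap_measurable; first exact: finite_finset.
move=> i _; rewrite -[X in measurable X]setTI.
by apply: measurable_tnth => //; exact: measurable_itv.
Qed.

Lemma lebesgue_measureN_box N (a b : 'I_N -> R) :
  (forall i, (a i <= b i)%R) ->
  lebesgue_measureN R N (box a b) = (\prod_(i < N) (b i - a i))%:E.
Proof.
elim: N a b => [|N IH] a b ab.
  by rewrite big_ord0/= diracE mem_set// => -[].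
rewrite big_ord_recl /= /transported_product /pushforward.
rewrite (_ : _ @^-1` _ = `[a ord0, b ord0[%classic `*`
    box (fun i => a (lift ord0 i)) (fun i => b (lift ord0 i))); last first.
  apply/seteqP; split => -[x t] /=.
    move=> h; split => [|i]; first by have := h ord0; rewrite in_itv /= tnth0.
    by have := h (lift ord0 i); rewrite tnthS.
  move=> [xab h] i; have [j ->|->] := unliftP ord0 i; last first.
    by move: xab; rewrite in_itv /= tnth0.
  by rewrite tnthS; exact: h.
rewrite product_measure1E//; last exact: measurable_box.
rewrite IH// EFinM; congr (_ * _).
apply: etrans (lebesgue_measure_itv `[a ord0, b ord0[) _ => /=.
by rewrite lte_fin; case: ltgtP (ab ord0) => // -> _; rewrite subrr.
Qed.

End lebesgue_measureN_box.

Section L2.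
Context {R : realType} {N : nat}.
Local Notation X := (Rn R N).
Local Notation mu := (lebesgue_measureN R N).
Implicit Types (f g : X -> R[i]) (T S : (X -> R[i]) -> (X -> R[i])).

(* Tuples carry no topology in the library, so compactness is tested on the
   corresponding row vectors. *)
Definition L1loc (w : X -> R) : Prop :=
  measurable_fun setT w /\
  forall K : set X, measurable K ->
    compact ((fun x : X => (\row_i tnth x i : 'rV[R]_N)) @` K) ->
    mu.-integrable K (EFin \o w).

Definition L2norm f : \bar R := 'N[mu]_2%:E[EFin \o @normc R \o f]%E.

(* Elements of L^2 are represented by functions, not by classes modulo a.e.
   equality. *)
Definition L2 : set (X -> R[i]) := [set f |
  [/\ measurable_fun setT (fun x => complex.Re (f x)),
      measurable_fun setT (fun x => complex.Im (f x))
    & (L2norm f < +oo)%E]].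

Definition cintegral (D : set X) f : R[i] :=
  Rintegral mu D (fun x => complex.Re (f x)) +i* Rintegral mu D (fun x => complex.Im (f x)).

Definition L2inner f g : R[i] := cintegral setT (fun x => f x * (g x)^*).

(* Linearity is required a.e. because T acts on representatives; together with
   the norm bound it implies that T respects a.e. equality on L^2. *)
Record L2_bounded T : Prop := {
  L2_bounded_mem : forall f, L2 f -> L2 (T f);
  L2_bounded_linear : forall (a : R[i]) f g, L2 f -> L2 g ->
    {ae mu, forall x, T (fun y => a * f y + g y) x = a * T f x + T g x};
  L2_bounded_norm : exists B : R, forall f, L2 f ->
    (L2norm (T f) <= B%:E * L2norm f)%E }.

Record L2_adjoint T S : Prop := {
  L2_adjoint_mem : forall g, L2 g -> L2 (S g);
  L2_adjoint_inner : forall f g, L2 f -> L2 g ->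
    L2inner (T f) g = L2inner f (S g) }.

End L2.

(* (k, j) encodes the translate of [0, 2^k)^N by 2^k j; for N > 0 distinct codes
   give distinct cubes. *)
Definition dyadic N := (int * N.-tuple int)%type.

Section dyadic.
Context {R : realType} {N : nat}.
Implicit Types Q S : dyadic N.

Definition cube Q : set (Rn R N) :=
  box (fun i => (tnth Q.2 i)%:~R * 2 ^ Q.1)
      (fun i => ((tnth Q.2 i)%:~R + 1) * 2 ^ Q.1).

Definition is_child S Q : Prop := S.1 = Q.1 - 1 /\ cube S `<=` cube Q.

Definition tree_edge : rel (dyadic N) :=
  fun Q S => `[< is_child Q S \/ is_child S Q >].

Definition d_tree Q S : \bar R :=
  ereal_inf [set ((size p)%:R)%:E | p in
    [set p : seq (dyadic N) | path tree_edge Q p /\ last Q p = S]].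

Record is_haar Q (h : Rn R N -> R[i]) : Prop := {
  haar_supp : forall x, ~ cube Q x -> h x = 0;
  haar_child : forall S, is_child S Q ->
    forall x y, cube S x -> cube S y -> h x = h y;
  haar_mean : cintegral (cube Q) h = 0 }.

End dyadic.

Section two_weight.
Context {R : realType} {N : nat}.
Local Notation X := (Rn R N).
Local Notation mu := (lebesgue_measureN R N).
Implicit Types (T : (X -> R[i]) -> (X -> R[i])) (u v : X -> R).

Definition band_operator (r : nat) T : Prop :=
  L2_bounded T /\
  forall (Q S : dyadic N) hQ hS, is_haar Q hQ -> is_haar S hS ->
    (r%:R%:E < d_tree (R := R) Q S)%E -> L2inner (T hQ) hS = 0.

(* M_v^{1/2} T M_u^{1/2}, defined on the f in L^2 with u^{1/2} f in L^2, has norm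
   at most B. *)
Definition weighted_bounded_by T u v (B : R) : Prop :=
  forall f, L2 f -> L2 (fun x => (Num.sqrt (u x))%:C * f x) ->
    (L2norm (fun x => (Num.sqrt (v x))%:C *
                      T (fun y => (Num.sqrt (u y))%:C * f y) x)%R
       <= B%:E * L2norm f)%E.

Definition restr (Q : dyadic N) (w : X -> R) : X -> R[i] :=
  fun x => (\1_(cube Q) x * w x)%:C.

Definition trunc (n : nat) (w : X -> R) : X -> R := fun x => Num.min (w x) n%:R.

(* `testing T u v C Q` is the bound on T(chi_Q u); its dual is obtained by
   passing T^* and exchanging the weights. When chi_Q u is not in L^2,
   T(chi_Q u) is undefined and the bound is required uniformly over the
   truncations min(u, n), with the untruncated u on the right-hand side. *)
Definition testing T u v (C : R) (Q : dyadic N) : Prop :=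
  let bound (w : X -> R) :=
    (\int[mu]_x (normc (T (restr Q w) x) ^+ 2 * v x)%R%:E
       <= C%:E * \int[mu]_(x in cube Q) (u x)%:E)%E in
  (L2 (restr Q u) -> bound u) /\
  (~ L2 (restr Q u) -> forall n, (0 < n)%N -> bound (trunc n u)).

End two_weight.

(* Main.v *)
Require Import Defs.
From mathcomp Require Import all_boot all_order all_algebra.
From mathcomp Require Import complex.
From mathcomp Require Import all_classical all_reals all_analysis measurable_realfun.
From mathcomp Require Import ring lra zify.
Set Implicit Arguments.
Unset Strict Implicit.
Unset Printing Implicit Defensive.
Import Order.TTheory GRing.Theory Num.Theory.
Import numFieldNormedType.Exports.
Import ComplexField.Normc.
Local Open Scope ring_scope.

(** Write T_u f = T (u f); the weighted bound says that T_u is bounded from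
    L^2(u) to L^2(v), and the two testing conditions say that T_u and its dual
    are bounded on indicators of cubes.

    On a finite dyadic tree this is proved by expanding both functions in
    martingale differences of u and of v. A band operator maps a function of
    mean zero on a cube to a function on the r-th ancestor of that cube, so a
    pair of differences falls into one of three regimes: generations at most
    r apart, where testing on the few subcubes of a common ancestor suffices
    ([near_bound]); and the two far regimes, each of which resums to a
    paraproduct whose symbol comes from T_u 1_Q and is a Carleson sequence by
    testing ([paraproduct_bound], [carleson]). The sum of the contributions is
    [well_localized_bound].

    The difficulty is to apply this to the operator. The functions u f are
    merely integrable, so T (u f) has no meaning as it stands. Locality helps
    again: averaging u f over the maximal cubes where the mean of u exceeds
    k+1 gives an L^2 function ([condop_bound]), and changes T only on the
    r-th ancestors of these cubes ([local_off_family]), a set of measure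
    O(1/k). Hence the values stabilise almost everywhere as k grows, and the
    limit [ext] extends T to all u f with f in L^2(u); it keeps the locality
    ([ext_local]) and, where testing bounds it, the duality with T*
    ([ext_duality]). Locality of T itself ([local_off]) is derived from the
    Haar condition, which forces the averages of T h over a far cube and over
    all of its ancestors to agree, hence to vanish.

    For weights cut to a centred box the matrix of [ext] on small cubes
    satisfies the hypotheses of the finite theorem with a bound that does not
    depend on the scale; density of step functions gives [box_theorem], and
    exhausting the space by boxes gives [real_two_weight]. A complex T is
    treated through the real and imaginary parts of its restriction to real
    functions.

    Conversely, a weighted bound for T gives the first testing condition by
    inserting sqrt u 1_Q, truncated if necessary
    ([testing_of_bounded]), and the second because the adjoint satisfies the
    same weighted bound ([bounded_adjoint]). *)

(** * A well localized form on a finite tree *)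

(** A nonnegative quadratic form has nonpositive discriminant. The Cauchy--
    Schwarz inequalities below use this form because the weights may vanish,
    so that dividing by a norm is not possible. *)
Lemma quadratic_CS (R : realFieldType) (a b c : R) :
  (forall s t, 0 <= s ^+ 2 * a + 2 * s * t * b + t ^+ 2 * c) -> b ^+ 2 <= a * c.
Proof.
move=> h.
have a0 : 0 <= a by have := h 1 0; rewrite !expr2; lra.
have c0 : 0 <= c by have := h 0 1; rewrite !expr2; lra.
have h1 : 0 <= a * (a * c - b ^+ 2).
  have -> : a * (a * c - b ^+ 2) =
    (- b) ^+ 2 * a + 2 * (- b) * a * b + a ^+ 2 * c by ring.
  exact: h.
have h2 : 0 <= c * (a * c - b ^+ 2).
  have -> : c * (a * c - b ^+ 2) =
    c ^+ 2 * a + 2 * c * (- b) * b + (- b) ^+ 2 * c by ring.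
  exact: h.
rewrite -subr_ge0.
have [ac|ac] := ltP 0 (a + c).
  by rewrite -(pmulr_rge0 _ ac) mulrDl addr_ge0.
have a00 : a = 0 by apply/eqP; rewrite eq_le a0 andbT; lra.
have c00 : c = 0 by apply/eqP; rewrite eq_le c0 andbT; lra.
have h3 := h 1 1; have h4 := h 1 (-1).
suff -> : b = 0 by rewrite a00 mul0r expr2 mul0r subrr.
rewrite a00 c00 !expr2 in h3 h4.
by apply/eqP; rewrite eq_le; apply/andP; split; lra.
Qed.

Section WeightedSums.
Variables (R : rcfType) (I : finType).
Implicit Types (u f g : I -> R).

Definition wip u f g := \sum_x u x * f x * g x.
Definition wnorm u f := Num.sqrt (wip u f f).

Lemma wip_ge0 u f : (forall x, 0 <= u x) -> 0 <= wip u f f.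
Proof. by move=> u0; apply: sumr_ge0 => x _; rewrite -mulrA mulr_ge0// -expr2 sqr_ge0. Qed.

Lemma sqr_wnorm u f : (forall x, 0 <= u x) -> wnorm u f ^+ 2 = wip u f f.
Proof. by move=> u0; rewrite sqr_sqrtr// wip_ge0. Qed.

Lemma wnorm_ge0 u f : 0 <= wnorm u f.
Proof. exact: sqrtr_ge0. Qed.

Lemma wip_CS u f g : (forall x, 0 <= u x) -> `|wip u f g| <= wnorm u f * wnorm u g.
Proof.
move=> u0; rewrite -(ler_pXn2r (_ : 0 < 2)%N)// ?nnegrE ?mulr_ge0 ?wnorm_ge0//.
rewrite exprMn !sqr_wnorm// -normrX ger0_norm ?sqr_ge0//.
apply: quadratic_CS => s t.
have -> : s ^+ 2 * wip u f f + 2 * s * t * wip u f g + t ^+ 2 * wip u g g =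
    \sum_x u x * (s * f x + t * g x) ^+ 2.
  rewrite /wip !mulr_sumr -!big_split/=; apply: eq_bigr => x _; ring.
by apply: sumr_ge0 => x _; rewrite mulr_ge0 ?sqr_ge0.
Qed.

Lemma sum_CS (p q : I -> R) :
  `|\sum_x p x * q x| <= Num.sqrt (\sum_x p x ^+ 2) * Num.sqrt (\sum_x q x ^+ 2).
Proof.
have := @wip_CS (fun=> 1) p q (fun=> ler01).
rewrite /wnorm /wip.
under eq_bigr do rewrite mul1r.
under [X in Num.sqrt X * _]eq_bigr do rewrite mul1r -expr2.
by under [X in _ * Num.sqrt X]eq_bigr do rewrite mul1r -expr2.
Qed.

End WeightedSums.

(** The tree is given by labellings: a j x is the cell of generation j that
    contains the point x. Generation 0 separates points, cells grow with j, and
    two points lie in the same cell exactly when their labels agree. *)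
Section Tree.
Variables (R : rcfType) (I K : finType) (a : nat -> I -> K).
Hypothesis a_inj : injective (a 0).
Hypothesis a_nest : forall j x y, a j x = a j y -> a j.+1 x = a j.+1 y.

Lemma nest_le i j x y : (i <= j)%N -> a i x = a i y -> a j x = a j y.
Proof.
by move=> /subnK <-; elim: (j - i)%N => [//|k ih] e; rewrite addSn; apply/a_nest/ih.
Qed.

Definition cell (j : nat) (w : K) : I -> R := fun x => (a j x == w)%:R.
Definition level_fun (j : nat) (h : I -> R) := forall x y, a j x = a j y -> h x = h y.

Lemma level_fun_le i j h : (i <= j)%N -> level_fun j h -> level_fun i h.
Proof. by move=> ij hj x y e; apply/hj/(nest_le ij). Qed.

Lemma cell_level i j w : (i <= j)%N -> level_fun i (cell j w).
Proof. by move=> ij x y e; rewrite /cell (nest_le ij e). Qed.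

Definition factor (j : nat) (h : I -> R) (w : K) : R :=
  if [pick x | a j x == w] is Some x then h x else 0.

Lemma factorE j h x : level_fun j h -> factor j h (a j x) = h x.
Proof.
by rewrite /factor; case: pickP => [y /eqP yx hj|/(_ x)]; [exact: hj|rewrite eqxx].
Qed.

Lemma sum_cell (F : I -> R) j : \sum_x F x = \sum_w \sum_(x | a j x == w) F x.
Proof. by rewrite (partition_big (a j) xpredT). Qed.

Lemma cell_decomp j (h : I -> R) x : level_fun j h ->
  h x = \sum_w factor j h w * cell j w x.
Proof.
move=> hj; rewrite (bigD1 (a j x))//= /cell eqxx mulr1 factorE// big1 ?addr0// => w.
by rewrite eq_sym => /negbTE ->; rewrite mulr0.
Qed.

Lemma sum_cellE (F : I -> R) j w : \sum_(x | a j x == w) F x = \sum_x cell j w x * F x.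
Proof.
rewrite big_mkcond; apply: eq_bigr => x _; rewrite /cell.
by case: ifP; rewrite ?mul1r ?mul0r.
Qed.

Section Expectation.
Variable u : I -> R.
Hypothesis u0 : forall x, 0 <= u x.
Implicit Types f g h : I -> R.

Definition mass j w := \sum_(x | a j x == w) u x.
(** Conditional expectation for the weight u. On a cell of mass zero it is 0,
    by x / 0 = 0; this does no harm as u vanishes on such a cell. *)
Definition cexp j f x := (\sum_(y | a j y == a j x) u y * f y) / mass j (a j x).
Definition mdiff j f x := cexp j f x - cexp j.+1 f x.

Lemma mass_ge0 j w : 0 <= mass j w.
Proof. exact: sumr_ge0. Qed.

Lemma cexp_level j f : level_fun j (cexp j f).
Proof. by move=> x y e; rewrite /cexp e. Qed.

Lemma mdiff_level j f : level_fun j (mdiff j f).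
Proof.
move=> x y e; rewrite /mdiff (cexp_level _ e) (@cexp_level j.+1 f x y)//.
exact: a_nest.
Qed.

Lemma mass0 j w x : mass j w = 0 -> a j x = w -> u x = 0.
Proof.
by move=> m0 xw; apply: (psumr_eq0P _ m0) => //; apply/eqP.
Qed.

Lemma massM_cexp j w f x : a j x = w ->
  mass j w * cexp j f x = \sum_(y | a j y == w) u y * f y.
Proof.
move=> <-; have [m0|m0] := eqVneq (mass j (a j x)) 0; last by rewrite mulrC divfK.
by rewrite m0 mul0r big1// => y /eqP /(mass0 m0) ->; rewrite mul0r.
Qed.

Lemma cexp_sum j f w :
  \sum_(x | a j x == w) u x * cexp j f x = \sum_(x | a j x == w) u x * f x.
Proof.
case: (pickP (fun x => a j x == w)) => [x /eqP xw|n0]; last by rewrite !big_pred0.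
rewrite -(massM_cexp f xw) mulr_suml; apply: eq_bigr => y /eqP yw.
by congr (_ * _); apply: cexp_level; rewrite xw.
Qed.

Lemma cexp_adj j f h : level_fun j h -> wip u (cexp j f) h = wip u f h.
Proof.
move=> hj; rewrite /wip (sum_cell _ j) [RHS](sum_cell _ j); apply: eq_bigr => w _.
have hE x : a j x == w -> h x = factor j h w by move=> /eqP <-; rewrite factorE.
under eq_bigr => x xw do rewrite (hE _ xw).
under [RHS]eq_bigr => x xw do rewrite (hE _ xw).
by rewrite -!mulr_suml cexp_sum.
Qed.

Lemma cexp_mul j f h x : level_fun j h ->
  cexp j (fun y => h y * f y) x = h x * cexp j f x.
Proof.
move=> hj; rewrite /cexp mulrA mulr_sumr; congr (_ / _).
by apply: eq_bigr => y /eqP yx; rewrite (hj _ _ yx) mulrCA.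
Qed.

Lemma mdiff_mul j f h x : level_fun j.+1 h ->
  mdiff j (fun y => h y * f y) x = h x * mdiff j f x.
Proof.
move=> hj; rewrite /mdiff mulrBr !cexp_mul//.
exact: level_fun_le hj.
Qed.

Lemma cexpB j f g x : cexp j (fun y => f y - g y) x = cexp j f x - cexp j g x.
Proof.
rewrite /cexp -mulrBl -sumrB; congr (_ / _).
by apply: eq_bigr => y _; rewrite mulrBr.
Qed.

Lemma mdiffB j f g x : mdiff j (fun y => f y - g y) x = mdiff j f x - mdiff j g x.
Proof. by rewrite /mdiff !cexpB; ring. Qed.

(** The conditional expectations are self-adjoint projections onto nested
    spaces, so their differences are orthogonal projections as well. *)
Lemma wip_mdiff j f g : wip u f (mdiff j g) = wip u (mdiff j f) (mdiff j g).
Proof.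
have -> : wip u (mdiff j f) (mdiff j g) =
    wip u (cexp j f) (mdiff j g) - wip u (cexp j.+1 f) (mdiff j g).
  by rewrite /wip -sumrB; apply: eq_bigr => x _; rewrite /mdiff; ring.
rewrite cexp_adj; last exact: mdiff_level.
have -> : wip u (cexp j.+1 f) (mdiff j g) =
    wip u (cexp j g) (cexp j.+1 f) - wip u (cexp j.+1 g) (cexp j.+1 f).
  by rewrite /wip -sumrB; apply: eq_bigr => x _; rewrite /mdiff; ring.
rewrite !cexp_adj ?subrr ?subr0//.
- exact: cexp_level.
- by apply: (@level_fun_le _ j.+1) => //; exact: cexp_level.
Qed.

Lemma wip_mdiff2 j f : wip u (mdiff j f) (mdiff j f) =
  wip u (cexp j f) (cexp j f) - wip u (cexp j.+1 f) (cexp j.+1 f).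
Proof.
have le1 : level_fun j (cexp j.+1 f).
  by apply: (@level_fun_le _ j.+1) => //; exact: cexp_level.
have e1 : wip u (cexp j f) (cexp j.+1 f) = wip u (cexp j.+1 f) (cexp j.+1 f).
  by rewrite cexp_adj// cexp_adj//; exact: cexp_level.
have -> : wip u (mdiff j f) (mdiff j f) = wip u (cexp j f) (cexp j f)
   - 2 * wip u (cexp j f) (cexp j.+1 f) + wip u (cexp j.+1 f) (cexp j.+1 f).
  rewrite /wip mulr_sumr -sumrB -big_split/=; apply: eq_bigr => x _.
  by rewrite /mdiff; ring.
by rewrite e1; ring.
Qed.

Lemma wnorm_cexp j f : wnorm u (cexp j f) <= wnorm u f.
Proof.
have := @wip_CS _ _ u f (cexp j f) u0.
rewrite -(cexp_adj f (@cexp_level j f)) ger0_norm ?wip_ge0// -sqr_wnorm// expr2.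
have [->|n0] := eqVneq (wnorm u (cexp j f)) 0; first by rewrite wnorm_ge0.
by rewrite ler_pM2r// lt_def n0 wnorm_ge0.
Qed.

(** The squared norms of the conditional expectations telescope. *)
Lemma bessel n f : \sum_(j < n) wnorm u (mdiff j f) ^+ 2 <= wnorm u f ^+ 2.
Proof.
have h : \sum_(j < n) wnorm u (mdiff j f) ^+ 2 =
    wnorm u (cexp 0 f) ^+ 2 - wnorm u (cexp n f) ^+ 2.
  elim: n => [|n ih]; first by rewrite big_ord0 subrr.
  by rewrite big_ord_recr/= ih !sqr_wnorm// wip_mdiff2; ring.
rewrite h lerBlDr ler_wpDr ?sqr_ge0// ler_pXn2r ?nnegrE ?wnorm_ge0//.
exact: wnorm_cexp.
Qed.

Lemma mdiff_mean j w f : \sum_x u x * (cell j.+1 w x * mdiff j f x) = 0.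
Proof.
have -> : \sum_x u x * (cell j.+1 w x * mdiff j f x) =
   wip u (cexp j f) (cell j.+1 w) - wip u (cexp j.+1 f) (cell j.+1 w).
  by rewrite /wip -sumrB; apply: eq_bigr => x _; rewrite /mdiff; ring.
by rewrite !cexp_adj ?subrr//; exact: cell_level.
Qed.

(** Joint convexity of F^2 / G, which is what is needed when cells are merged
    into their parent. *)
Lemma titu (J : finType) (F G : J -> R) :
  (forall i, 0 <= G i) -> (forall i, G i = 0 -> F i = 0) ->
  (\sum_i F i) ^+ 2 / \sum_i G i <= \sum_i F i ^+ 2 / G i.
Proof.
move=> G0 FG.
have G0' : 0 <= \sum_i G i by apply: sumr_ge0.
have [->|s0] := eqVneq (\sum_i G i) 0.
  by rewrite invr0 mulr0 sumr_ge0// => i _; rewrite divr_ge0 ?sqr_ge0.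
rewrite ler_pdivrMr ?lt_def ?s0// mulrC.
have -> : \sum_i F i = wip G (fun=> 1) (fun i => F i / G i).
  apply: eq_bigr => i _; rewrite mulr1.
  by have [g0|g0] := eqVneq (G i) 0; [rewrite FG// !mul0r mulr0|rewrite mulrC divfK].
have -> : \sum_i G i = wip G (fun=> 1) (fun=> 1).
  by apply: eq_bigr => i _; rewrite !mulr1.
have -> : \sum_i F i ^+ 2 / G i = wip G (fun i => F i / G i) (fun i => F i / G i).
  apply: eq_bigr => i _.
  have [g0|g0] := eqVneq (G i) 0; first by rewrite FG// expr2 !mul0r mulr0.
  by field.
rewrite -!sqr_wnorm// -exprMn -[X in X <= _]ger0_norm ?sqr_ge0// normrX.
by rewrite ler_pXn2r ?nnegrE ?mulr_ge0 ?wnorm_ge0// wip_CS.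
Qed.

Section Carleson.
Variable g : nat -> I -> R.
Hypothesis g0 : forall i x, 0 <= g i x.
Let tot j w := \sum_(x | a j x == w) \sum_(i < j.+1) g i x.
Variable L : nat.
Hypothesis gu : forall j w, (j < L)%N -> tot j w <= mass j w.
Variable f : I -> R.
Let S j w := \sum_(x | a j x == w) u x * f x.

(** For 0 <= m <= U the function F^2 / (U + m) decreases in m at least at
    the rate (F / U)^2 / 4: this drop pays for the mass m put on a node. *)
Lemma carleson_alg (U F m0 m : R) : 0 <= m0 -> 0 <= m -> m0 + m <= U ->
  (U = 0 -> F = 0) ->
  m * (F / U) ^+ 2 <= 4 * (F ^+ 2 / (U + m0) - F ^+ 2 / (U + (m0 + m))).
Proof.
move=> m00 mm0 mU UF; have [U0|U0] := eqVneq U 0.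
  by rewrite UF// !expr2 !mul0r mulr0 subrr mulr0.
have Up : 0 < U by rewrite lt_def U0/=; lra.
have p1 : 0 < U + m0 by lra.
have p2 : 0 < U + (m0 + m) by lra.
have -> : 4 * (F ^+ 2 / (U + m0) - F ^+ 2 / (U + (m0 + m))) =
  m * F ^+ 2 * (4 / ((U + m0) * (U + (m0 + m)))).
  by field; rewrite !gt_eqF.
have -> : m * (F / U) ^+ 2 = m * F ^+ 2 * (U ^+ 2)^-1 by field.
apply: ler_wpM2l; first by rewrite mulr_ge0 ?sqr_ge0.
rewrite ler_pdivlMr ?mulr_gt0// mulrC ler_pdivrMr ?exprn_gt0//.
have : (U + m0) * (U + (m0 + m)) <= (2 * U) * (2 * U).
  by apply: ler_pM; lra.
by rewrite expr2; lra.
Qed.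

Lemma S0 j w : mass j w = 0 -> S j w = 0.
Proof. by move=> m0; apply: big1 => x /eqP xw; rewrite (mass0 m0)// mul0r. Qed.

Lemma tot_ge0 j w : 0 <= tot j w.
Proof. by apply: sumr_ge0 => x _; apply: sumr_ge0. Qed.

(** Induction on the generation with the Bellman function
    4 (f2 - F^2 / (U + m)), where U is the mass of a cell, F and f2 are the
    integrals of f and f^2 over it, and m is the Carleson mass inside it.
    Passing from the children to the parent uses [titu]; the Carleson mass of
    the parent itself is paid for by [carleson_alg]. *)
Lemma carleson_cell j w : (j < L)%N ->
  \sum_(x | a j x == w) \sum_(i < j.+1) g i x * cexp i f x ^+ 2 <=
  4 * (\sum_(x | a j x == w) u x * f x ^+ 2 - S j w ^+ 2 / (mass j w + tot j w)).
Proof.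
elim: j w => [|j ih] w jL.
  have [/existsP[x /eqP xw]|/existsPn h] := boolP [exists x, a 0 x == w]; last first.
    have z (G : I -> R) : \sum_(x | a 0 x == w) G x = 0.
      by rewrite big_pred0// => x; apply/negbTE.
    by rewrite /S !z expr2 !mul0r subrr mulr0.
  have one (G : I -> R) : \sum_(y | a 0 y == w) G y = G x.
    rewrite (big_pred1 x)// => y /=; apply/eqP/eqP => [|->//].
    by rewrite -xw => /a_inj.
  have gx : g 0 x <= u x by have := gu w jL; rewrite /tot /mass !one big_ord1.
  rewrite /S /tot /mass !one !big_ord1 /cexp xw /mass !one.
  have := @carleson_alg (u x) (u x * f x) 0 (g 0 x).
  rewrite addr0 add0r => /(_ (lexx _) (g0 _ _) gx).
  have -> : (u x * f x) ^+ 2 / u x = u x * f x ^+ 2.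
    by have [->|n0] := eqVneq (u x) 0; [rewrite expr2 !mul0r|field].
  by apply => ->; rewrite mul0r.
have jL' : (j < L)%N by apply: ltn_trans jL.
pose m := \sum_(x | a j.+1 x == w) g j.+1 x.
pose m0 := \sum_(x | a j.+1 x == w) \sum_(i < j.+1) g i x.
have totE : tot j.+1 w = m0 + m.
  by rewrite /tot /m0 /m -big_split; apply: eq_bigr => x _; rewrite big_ord_recr.
under eq_bigr => x _ do rewrite big_ord_recr/=.
rewrite big_split/=.
have lastE : \sum_(x | a j.+1 x == w) g j.+1 x * cexp j.+1 f x ^+ 2 =
    m * (S j.+1 w / mass j.+1 w) ^+ 2.
  by rewrite /m mulr_suml; apply: eq_bigr => x /eqP xw; rewrite /cexp xw.
rewrite lastE.
have m00 : 0 <= m0 by apply: sumr_ge0 => x _; apply: sumr_ge0.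
have mm0 : 0 <= m by apply: sumr_ge0.
have hlast := @carleson_alg (mass j.+1 w) (S j.+1 w) m0 m m00 mm0.
rewrite -totE in hlast.
have {}hlast := hlast (gu w jL) (@S0 _ _).
rewrite totE in hlast *.
have child w' (G : I -> R) : \sum_(x | (a j.+1 x == w) && (a j x == w')) G x =
   (if [exists x, (a j.+1 x == w) && (a j x == w')] then 1 else 0) *
   \sum_(x | a j x == w') G x.
  case: ifPn => [/existsP[x /andP[/eqP xw /eqP xw']]|/existsPn h]; last first.
    by rewrite mul0r big_pred0// => x; apply/negbTE.
  rewrite mul1r; apply: eq_bigl => y /=; rewrite andbC.
  case: eqP => //= yw'; apply/eqP; rewrite -xw; apply: a_nest.
  by rewrite yw' xw'.
set e := (fun w' : K => if [exists x, (a j.+1 x == w) && (a j x == w')] then 1 else 0 : R) in child.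
have split (G : I -> R) : \sum_(x | a j.+1 x == w) G x =
   \sum_w' e w' * \sum_(x | a j x == w') G x.
  by rewrite (partition_big (a j) xpredT)//=; apply: eq_bigr => w' _; rewrite child.
have eM w' : e w' = 0 \/ e w' = 1 by rewrite /e; case: ifP; [right|left].
have e0 w' : 0 <= e w' by case: (eM w') => ->.
have htitu := @titu K (fun w' => e w' * S j w') (fun w' => e w' * (mass j w' + tot j w')).
have hI : \sum_(x | a j.+1 x == w) \sum_(i < j.+1) g i x * cexp i f x ^+ 2 <=
  4 * (\sum_(x | a j.+1 x == w) u x * f x ^+ 2 - S j.+1 w ^+ 2 / (mass j.+1 w + m0)).
  rewrite !split.
  apply: (@le_trans _ _ (\sum_w' e w' * (4 * (\sum_(x | a j x == w') u x * f x ^+ 2 -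
      S j w' ^+ 2 / (mass j w' + tot j w'))))).
    by apply: ler_sum => w' _; apply: ler_wpM2l => //; exact: ih.
  have -> : \sum_w' e w' * (4 * (\sum_(x | a j x == w') u x * f x ^+ 2 -
      S j w' ^+ 2 / (mass j w' + tot j w'))) =
    4 * (\sum_w' e w' * (\sum_(x | a j x == w') u x * f x ^+ 2) -
         \sum_w' (e w' * S j w') ^+ 2 / (e w' * (mass j w' + tot j w'))).
    rewrite -sumrB mulr_sumr; apply: eq_bigr => w' _.
    by case: (eM w') => ->; rewrite ?mul1r ?mul0r ?expr2 ?mul0r ?subrr ?mulr0.
  rewrite ler_pM2l// lerD2l lerN2.
  have -> : S j.+1 w = \sum_w' e w' * S j w' by rewrite /S split.
  have -> : mass j.+1 w + m0 = \sum_w' e w' * (mass j w' + tot j w').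
    rewrite /mass /m0 !split -big_split/=; apply: eq_bigr => w' _.
    by rewrite -mulrDr.
  apply: htitu => [w'|w']; first by rewrite mulr_ge0// addr_ge0 ?mass_ge0 ?tot_ge0.
  case: (eM w') => ->; rewrite ?mul0r// !mul1r => h; apply: S0.
  by apply/eqP; rewrite eq_le mass_ge0// andbT -h lerDl tot_ge0.
move: hI hlast; set A := _ / (_ + m0); set B := _ / (_ + (m0 + m)).
by rewrite !mulrBr; lra.
Qed.

End Carleson.

Lemma carleson (g : nat -> I -> R) L f : (forall i x, 0 <= g i x) ->
  (forall j w, (j < L)%N -> \sum_(x | a j x == w) \sum_(i < j.+1) g i x <= mass j w) ->
  \sum_(i < L) \sum_x g i x * cexp i f x ^+ 2 <= 4 * wip u f f.
Proof.
move=> g0 gu; case: L gu => [|L] gu.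
  by rewrite big_ord0 mulr_ge0// wip_ge0.
rewrite exchange_big/= (sum_cell _ L) /wip (sum_cell _ L) mulr_sumr.
apply: ler_sum => w _.
apply: le_trans (@carleson_cell g g0 L.+1 gu f L w (leqnn _)) _.
rewrite ler_pM2l//.
under [X in _ <= X]eq_bigr do rewrite -mulrA -expr2.
rewrite gerBl divr_ge0 ?sqr_ge0// addr_ge0 ?mass_ge0//.
by apply: sumr_ge0 => x _; apply: sumr_ge0.
Qed.

End Expectation.

Section Form.
Implicit Types (u v f g : I -> R) (M : I -> I -> R).

Definition form M f g := \sum_x \sum_y f x * M x y * g y.

Lemma form_tr M f g : form (fun x y => M y x) g f = form M f g.
Proof.
rewrite /form exchange_big; apply: eq_bigr => x _; apply: eq_bigr => y _; ring.
Qed.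

Lemma eq_form M f f' g g' : f =1 f' -> g =1 g' -> form M f g = form M f' g'.
Proof.
by move=> ff gg; apply: eq_bigr => x _; apply: eq_bigr => y _; rewrite ff gg.
Qed.

Lemma form_suml M (J : finType) (P : pred J) (F : J -> I -> R) g :
  form M (fun x => \sum_(i | P i) F i x) g = \sum_(i | P i) form M (F i) g.
Proof.
rewrite /form [RHS]exchange_big/=; apply: eq_bigr => x _.
rewrite [RHS]exchange_big/=; apply: eq_bigr => y _.
by rewrite !mulr_suml.
Qed.

Lemma form_sumr M (J : finType) (P : pred J) f (G : J -> I -> R) :
  form M f (fun x => \sum_(i | P i) G i x) = \sum_(i | P i) form M f (G i).
Proof.
rewrite -form_tr form_suml; apply: eq_bigr => i _; exact: form_tr.
Qed.

Lemma formBl M f f' g : form M (fun x => f x - f' x) g = form M f g - form M f' g.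
Proof.
rewrite /form -sumrB; apply: eq_bigr => x _; rewrite -sumrB; apply: eq_bigr => y _; ring.
Qed.

Lemma formZl M k f g : form M (fun x => k * f x) g = k * form M f g.
Proof.
rewrite /form mulr_sumr; apply: eq_bigr => x _; rewrite mulr_sumr.
by apply: eq_bigr => y _; ring.
Qed.

Lemma formDl M f f' g : form M (fun x => f x + f' x) g = form M f g + form M f' g.
Proof.
rewrite /form -big_split; apply: eq_bigr => x _; rewrite -big_split/=; apply: eq_bigr => y _; ring.
Qed.

Lemma formDr M f g g' : form M f (fun x => g x + g' x) = form M f g + form M f g'.
Proof. by rewrite -form_tr formDl; congr (_ + _); exact: form_tr. Qed.

(** Pairing with an arbitrary g expresses the norm of T (1_w u) in L^2(v) also
    where v vanishes. *)
Definition testing_form u v M c := forall j w g,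
  `|form M (cell j w) g| <= c * Num.sqrt (mass u j w) * wnorm v g.

(** Locality in the second variable: if g has v-mean zero and lives on one
    cell of generation j+1, then only the values of f on the r-th ancestor of
    this cell matter. *)
Definition local_form v M r := forall j y f g,
  (forall z, a j.+1 z != a j.+1 y -> g z = 0) -> \sum_z v z * g z = 0 ->
  (forall x, a (j.+1 + r) x = a (j.+1 + r) y -> f x = 0) -> form M f g = 0.

Section Bounds.
Variables (u v : I -> R) (M : I -> I -> R) (c : R) (r : nat).
Hypotheses (u0 : forall x, 0 <= u x) (v0 : forall x, 0 <= v x) (c0 : 0 <= c).
Hypothesis test : testing_form u v M c.
Hypothesis loc : local_form v M r.

Lemma wnorm_sum_cells j f : wnorm u f ^+ 2 = \sum_w wnorm u (fun x => cell j w x * f x) ^+ 2.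
Proof.
rewrite sqr_wnorm// /wip (sum_cell _ j); apply: eq_bigr => w _.
rewrite sqr_wnorm// sum_cellE; apply: eq_bigr => x _.
by rewrite /cell; case: eqP => _ /=; ring.
Qed.

(** Such an f is a combination of #|A| indicators of cells. Testing each of
    them and applying Cauchy--Schwarz over the cells loses sqrt #|A|. *)
Lemma step_bound j (A : {set K}) f g : level_fun j f ->
  (forall x, f x != 0 -> a j x \in A) ->
  `|form M f g| <= c * Num.sqrt #|A|%:R * wnorm u f * wnorm v g.
Proof.
move=> fj fA.
have fE x : f x = \sum_(w in A) factor j f w * cell j w x.
  rewrite (cell_decomp x fj) [RHS]big_mkcond/=; apply: eq_bigr => w _.
  case: ifPn => // wA; rewrite /factor; case: pickP => [y /eqP yw|_]; last by rewrite mul0r.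
  suff -> : f y = 0 by rewrite mul0r.
  by apply/eqP; apply: contraNT wA => /fA; rewrite yw.
rewrite (eq_form M fE (fun=> erefl)) form_suml.
apply: le_trans (ler_norm_sum _ _ _) _.
pose t w := `|factor j f w| * Num.sqrt (mass u j w).
apply: (@le_trans _ _ (\sum_(w in A) c * wnorm v g * t w)).
  apply: ler_sum => w _; rewrite formZl normrM.
  apply: le_trans (ler_wpM2l (normr_ge0 _) (test _ _ _)) _.
  by rewrite le_eqVlt; apply/orP; left; apply/eqP; rewrite /t; ring.
rewrite -mulr_sumr [_ * wnorm u f * _]mulrAC [c * _ * wnorm v g]mulrAC -[_ * _ * wnorm u f]mulrA.
apply: ler_wpM2l; first by rewrite mulr_ge0 ?wnorm_ge0.
have -> : \sum_(w in A) t w = \sum_w (w \in A)%:R * t w.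
  rewrite big_mkcond/=; apply: eq_bigr => w _.
  by case: ifP => _; rewrite ?mul1r ?mul0r.
apply: le_trans (ler_norm _) _; apply: le_trans (sum_CS _ _) _.
have -> : \sum_w ((w \in A)%:R : R) ^+ 2 = #|A|%:R.
  rewrite -sum1_card natr_sum [RHS]big_mkcond/=; apply: eq_bigr => w _.
  by case: ifP => _; rewrite ?expr1n ?expr0n.
apply: ler_wpM2l; first exact: sqrtr_ge0.
rewrite /wnorm ler_wsqrtr// /wip (sum_cell _ j); apply: ler_sum => w _.
rewrite exprMn sqr_sqrtr ?mass_ge0// real_normK ?num_real// mulrC /mass mulr_suml.
rewrite le_eqVlt; apply/orP; left; apply/eqP; apply: eq_bigr => x /eqP xw.
by rewrite -xw factorE// -mulrA expr2.
Qed.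

(** The difference mdiff v j g is a sum of pieces of mean zero on cells of
    generation j+1, and generation m contains the r-th ancestors of these; by
    locality f may be cut accordingly. *)
Lemma local_split j m f g : (j.+1 + r <= m)%N ->
  form M f (mdiff v j g) =
  \sum_w form M (fun x => cell m w x * f x) (fun y => cell m w y * mdiff v j g y).
Proof.
move=> jm.
have gE y : mdiff v j g y = \sum_w cell m w y * mdiff v j g y.
  rewrite -mulr_suml (bigD1 (a m y))//= /cell eqxx big1 ?addr0 ?mul1r// => w.
  by rewrite eq_sym => /negbTE ->.
rewrite (eq_form M (fun=> erefl) gE) form_sumr; apply: eq_bigr => w _.
apply/eqP; rewrite -subr_eq0 -formBl; apply/eqP.
have gE' y : cell m w y * mdiff v j g y =
    \sum_w' cell j.+1 w' y * (cell m w y * mdiff v j g y).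
  rewrite -mulr_suml (bigD1 (a j.+1 y))//= {2}/cell eqxx big1 ?addr0 ?mul1r// => w'.
  by rewrite eq_sym /cell => /negbTE ->.
rewrite (eq_form M (fun=> erefl) gE') form_sumr big1// => w' _.
have [/existsP[y /andP[/eqP yw' /eqP yw]]|/existsPn h] :=
    boolP [exists y, (a j.+1 y == w') && (a m y == w)]; last first.
  rewrite /form big1// => x _; rewrite big1// => y _; rewrite /cell.
  by have := h y; case: eqP => //=; case: eqP => //=; rewrite ?(mul0r, mulr0).
apply: (loc (y := y) (j := j)).
- by move=> z; rewrite yw' /cell => /negbTE ->; rewrite mul0r.
- have -> : \sum_z v z * (cell j.+1 w' z * (cell m w z * mdiff v j g z)) =
    \sum_z v z * (cell j.+1 w' z * mdiff v j g z).
    apply: eq_bigr => z _; rewrite /cell; have [zw'|] := eqVneq (a j.+1 z) w'; last by rewrite !mul0r.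
    suff -> : a m z = w by rewrite eqxx !mul1r.
    rewrite -yw; apply: (@nest_le j.+1); last by rewrite yw'.
    by apply: leq_trans jm; rewrite leq_addr.
  exact: mdiff_mean.
- move=> x xy; suff -> : cell m w x = 1 by rewrite mul1r subrr.
  by rewrite /cell -yw (nest_le jm xy) eqxx.
Qed.

(** Inside one cell of generation m the function mdiff u i f is constant on at
    most d cells, so [step_bound] applies there; the cells of generation m are
    put together by [local_split]. *)
Lemma near_bound i j m d f g : (j.+1 + r <= m)%N -> (i <= m)%N ->
  (forall w, (#|[set a i x | x in [set x | a m x == w]]%SET| <= d)%N) ->
  `|form M (mdiff u i f) (mdiff v j g)| <=
  c * Num.sqrt d%:R * wnorm u (mdiff u i f) * wnorm v (mdiff v j g).
Proof.
move=> jm im cd; rewrite (local_split _ _ jm).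
apply: le_trans (ler_norm_sum _ _ _) _.
set F := mdiff u i f; set G := mdiff v j g.
apply: (@le_trans _ _ (\sum_w c * Num.sqrt d%:R * (wnorm u (fun x => cell m w x * F x) *
    wnorm v (fun x => cell m w x * G x)))).
  apply: ler_sum => w _; rewrite mulrA.
  apply: le_trans (@step_bound i [set a i x | x in [set x | a m x == w]]%SET _ _ _ _) _.
  - by move=> x y e; congr (_ * _); [exact: cell_level e|exact: mdiff_level e].
  - move=> x; rewrite /cell; have [xw _|] := eqVneq (a m x) w; last by rewrite mul0r eqxx.
    by apply/imsetP; exists x => //; rewrite finset.inE xw.
  - rewrite -[X in _ <= X]mulrA [X in _ <= X]mulrA; apply: ler_wpM2r; first exact: wnorm_ge0.
    apply: ler_wpM2r; first exact: wnorm_ge0.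
    by apply: ler_wpM2l => //; rewrite ler_wsqrtr// ler_nat.
rewrite -mulr_sumr -[_ * wnorm u F * _]mulrA; apply: ler_wpM2l.
  by rewrite mulr_ge0 ?sqrtr_ge0.
apply: le_trans (ler_norm _) _; apply: le_trans (sum_CS _ _) _.
rewrite -(wnorm_sum_cells m F).
have -> : \sum_w wnorm v (fun x => cell m w x * G x) ^+ 2 = wnorm v G ^+ 2.
  rewrite sqr_wnorm// /wip (sum_cell _ m); apply: eq_bigr => w _.
  rewrite sqr_wnorm// sum_cellE; apply: eq_bigr => x _.
  by rewrite /cell; case: eqP => _ /=; ring.
by rewrite !sqrtr_sqr !ger0_norm ?wnorm_ge0.
Qed.

(** The density with respect to v of the functional g |-> form M 1_w g; it plays
    the part of T (1_w u). *)
Definition riesz j w z := (\sum_(x | a j x == w) M x z) / v z.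

Lemma form_cellE j w g : form M (cell j w) g = \sum_z (\sum_(x | a j x == w) M x z) * g z.
Proof.
rewrite /form exchange_big/=; apply: eq_bigr => z _.
rewrite sum_cellE mulr_suml; apply: eq_bigr => x _; by [].
Qed.

(** At a point where v vanishes the testing bound, applied to the indicator of
    that point, shows that the column sum vanishes too. *)
Lemma form_riesz j w g : form M (cell j w) g = wip v (riesz j w) g.
Proof.
rewrite form_cellE /wip; apply: eq_bigr => z _; congr (_ * _).
rewrite /riesz; have [z0|z0] := eqVneq (v z) 0; last by rewrite mulrC divfK.
rewrite z0 mul0r; apply/eqP; rewrite -normr_le0.
have := test j w (fun y => (y == z)%:R).
rewrite form_cellE (bigD1 z)//= eqxx mulr1 [X in _ + X]big1 ?addr0; last first.
  by move=> y /negbTE yz; rewrite yz mulr0.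
suff -> : wnorm v (fun y => (y == z)%:R) = 0 by rewrite mulr0.
rewrite /wnorm /wip (bigD1 z)//= z0 !mul0r add0r big1 ?sqrtr0//.
by move=> y /negbTE yz; rewrite yz !mulr0.
Qed.

Lemma riesz_norm j w : wnorm v (riesz j w) ^+ 2 <= c ^+ 2 * mass u j w.
Proof.
have := test j w (riesz j w); rewrite form_riesz -sqr_wnorm// ger0_norm ?sqr_ge0//.
set n := wnorm v _; rewrite expr2.
have [->|n0] := eqVneq n 0; first by rewrite mul0r => _; rewrite mulr_ge0 ?sqr_ge0 ?mass_ge0.
rewrite ler_pM2r ?lt_def ?n0 ?wnorm_ge0// => h.
rewrite -expr2 -[mass _ _ _]sqr_sqrtr ?mass_ge0// -exprMn.
by rewrite ler_pXn2r ?nnegrE ?wnorm_ge0 ?mulr_ge0 ?sqrtr_ge0.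
Qed.

(** The difference s of the two densities represents T applied to a function
    that vanishes on the cell of generation j+1+r around z. By locality s is
    orthogonal to functions of mean zero on the cell of generation j+1 around
    z, so its j-th martingale difference vanishes there. Hence the symbol of
    the paraproduct may be computed from any larger cell. *)
Lemma riesz_local j l w z : (j.+1 + r <= l)%N -> a l z = w ->
  v z * mdiff v j (riesz (j.+1 + r) (a (j.+1 + r) z)) z = v z * mdiff v j (riesz l w) z.
Proof.
move=> jl zw; set m := (j.+1 + r)%N; set W := a m z.
pose s y := riesz l w y - riesz m W y.
suff : v z * mdiff v j s z = 0.
  by rewrite mdiffB mulrBr => /eqP; rewrite subr_eq0 => /eqP ->.
pose R0 := a j.+1 z.
pose g y := cell j.+1 R0 y * mdiff v j s y.
have h0 : form M (fun x => cell l w x - cell m W x) g = 0.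
  apply: (loc (y := z) (j := j)).
  - by move=> y; rewrite /g /cell => /negbTE ->; rewrite mul0r.
  - exact: mdiff_mean.
  - move=> x xz; rewrite /cell.
    have -> : a l x == w by rewrite -zw; apply/eqP/(nest_le jl).
    by rewrite -/m in xz; rewrite /W xz eqxx subrr.
have h1 : wip v s g = 0.
  transitivity (wip v (riesz l w) g - wip v (riesz m W) g).
    by rewrite /wip -sumrB; apply: eq_bigr => y _; rewrite /s; ring.
  by rewrite -!form_riesz -formBl.
have gE : g =1 mdiff v j (fun y => cell j.+1 R0 y * s y).
  by move=> y; rewrite mdiff_mul//; exact: cell_level.
have h2 : \sum_y v y * (cell j.+1 R0 y * mdiff v j s y) ^+ 2 = 0.
  rewrite -[RHS]h1; symmetry.
  have -> : wip v s g = wip v s (mdiff v j (fun y => cell j.+1 R0 y * s y)).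
    by apply: eq_bigr => y _; rewrite gE.
  rewrite wip_mdiff//; apply: eq_bigr => y _.
  rewrite -gE /g /cell; case: eqP => _; rewrite ?mul1r ?mul0r ?mulr0 ?expr0n//=; last by rewrite mulr0.
  by rewrite expr2 mulrA.
have := psumr_eq0P (fun y _ => mulr_ge0 (v0 y) (sqr_ge0 _)) h2.
move=> /(_ z isT); rewrite /cell eqxx mul1r => /eqP.
by rewrite mulf_eq0 sqrf_eq0 -mulf_eq0 => /eqP.
Qed.

(** On a cell of generation j+1+r the average of f is a constant, which can be
    taken out of the form once [local_split] has cut f to that cell. *)
Lemma paraE j f g : form M (cexp u (j.+1 + r) f) (mdiff v j g) =
  \sum_z v z * (cexp u (j.+1 + r) f z * mdiff v j (riesz (j.+1 + r) (a (j.+1 + r) z)) z)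
     * mdiff v j g z.
Proof.
set m := (j.+1 + r)%N; set h := cexp u m f.
rewrite (local_split _ _ (leqnn _)) (sum_cell _ m); apply: eq_bigr => w _.
rewrite sum_cellE.
have hw x : cell m w x * h x = factor m h w * cell m w x.
  rewrite /cell; have [<-|] := eqVneq (a m x) w; last by rewrite mul0r mulr0.
  by rewrite factorE ?mulr1 ?mul1r//; exact: cexp_level.
rewrite (eq_form M hw (fun=> erefl)) formZl form_riesz.
have jm : (j.+1 <= m)%N by rewrite leq_addr.
have -> : wip v (riesz m w) (fun y => cell m w y * mdiff v j g y) =
  wip v (mdiff v j (riesz m w)) (fun y => cell m w y * mdiff v j g y).
  have e y : cell m w y * mdiff v j g y = mdiff v j (fun y => cell m w y * g y) y.
    by rewrite mdiff_mul//; exact: cell_level.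
  have wE q : wip v q (fun y => cell m w y * mdiff v j g y) =
      wip v q (mdiff v j (fun y => cell m w y * g y)).
    by apply: eq_bigr => y _; rewrite e.
  by rewrite !wE wip_mdiff.
rewrite /wip mulr_sumr; apply: eq_bigr => z _.
rewrite /cell; have [zw|] := eqVneq (a m z) w; last by rewrite !(mul0r, mulr0).
by rewrite -zw factorE; [ring|exact: cexp_level].
Qed.

(** After [paraE] and Cauchy--Schwarz the factor with g is bounded by [bessel].
    The other factor is a Carleson sum with coefficients beta; on a cell of
    generation l these are, by [riesz_local], parts of the martingale
    decomposition of the density of that single cell, whose norm is controlled
    by testing. *)
Lemma paraproduct_bound n f g :
  `|\sum_(j < n) form M (cexp u (j.+1 + r) f) (mdiff v j g)| <=
  2 * c * wnorm u f * wnorm v g.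
Proof.
pose beta j z := v z * mdiff v j (riesz (j.+1 + r) (a (j.+1 + r) z)) z ^+ 2.
have beta0 j z : 0 <= beta j z by rewrite mulr_ge0 ?sqr_ge0.
under eq_bigr do rewrite paraE.
rewrite pair_big/=.
pose p (q : 'I_n * I) := Num.sqrt (v q.2) * (cexp u (q.1.+1 + r) f q.2 *
   mdiff v q.1 (riesz (q.1.+1 + r) (a (q.1.+1 + r) q.2)) q.2).
pose p' (q : 'I_n * I) := Num.sqrt (v q.2) * mdiff v q.1 g q.2.
have -> : \sum_(q : 'I_n * I) v q.2 * (cexp u (q.1.+1 + r) f q.2 *
   mdiff v q.1 (riesz (q.1.+1 + r) (a (q.1.+1 + r) q.2)) q.2) * mdiff v q.1 g q.2
  = \sum_q p q * p' q.
  apply: eq_bigr => q _; rewrite /p /p' -{1}[v q.2]sqr_sqrtr//; ring.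
apply: le_trans (sum_CS _ _) _.
rewrite -mulrA -[2 * c * _]mulrA.
have -> : 2 * (c * (wnorm u f * wnorm v g)) = 2 * c * wnorm u f * wnorm v g by ring.
apply: ler_pM; rewrite ?sqrtr_ge0//; last first.
  rewrite -[X in _ <= X]ger0_norm ?wnorm_ge0// -sqrtr_sqr ler_wsqrtr//.
  apply: le_trans (bessel v0 n g); rewrite -(pair_big xpredT xpredT (fun i x => p' (i, x) ^+ 2))/=.
  apply: ler_sum => j _; rewrite sqr_wnorm// le_eqVlt; apply/orP; left; apply/eqP.
  by apply: eq_bigr => x _; rewrite exprMn sqr_sqrtr//= expr2 mulrA.
have -> : 2 * c * wnorm u f = Num.sqrt (4 * (c ^+ 2 * wip u f f)).
  rewrite -sqr_wnorm// -exprMn.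
  have -> : 4 * (c * wnorm u f) ^+ 2 = (2 * c * wnorm u f) ^+ 2 by ring.
  by rewrite sqrtr_sqr ger0_norm// !mulr_ge0 ?wnorm_ge0.
rewrite ler_wsqrtr//.
have -> : \sum_q p q ^+ 2 = \sum_(j < n) \sum_z beta j z * cexp u (r.+1 + j) f z ^+ 2.
  rewrite -(pair_big xpredT xpredT (fun i x => p (i, x) ^+ 2))/=.
  apply: eq_bigr => j _; apply: eq_bigr => x _.
  by rewrite /p/= exprMn sqr_sqrtr// /beta -[(_ + j)%N]addnC addnS addSn; ring.
have [c00|cn0] := eqVneq c 0.
  have b0 j z : beta j z = 0.
    have := riesz_norm (j.+1 + r) (a (j.+1 + r) z).
    rewrite c00 [X in X * _]expr0n mul0r => h.
    have {}h : \sum_(i < j.+1) wnorm v (mdiff v i (riesz (j.+1 + r) (a (j.+1 + r) z))) ^+ 2 <= 0.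
      exact: le_trans (bessel v0 _ _) h.
    have : wnorm v (mdiff v j (riesz (j.+1 + r) (a (j.+1 + r) z))) ^+ 2 <= 0.
      apply: le_trans h; rewrite big_ord_recr/= lerDr sumr_ge0// => i _.
      exact: sqr_ge0.
    rewrite sqr_wnorm// => h1.
    have /eqP h2 : wip v (mdiff v j (riesz (j.+1 + r) (a (j.+1 + r) z)))
        (mdiff v j (riesz (j.+1 + r) (a (j.+1 + r) z))) == 0.
      by rewrite eq_le h1 wip_ge0.
    have nn y : true -> 0 <= v y * mdiff v j (riesz (j.+1 + r) (a (j.+1 + r) z)) y *
        mdiff v j (riesz (j.+1 + r) (a (j.+1 + r) z)) y.
      by move=> _; rewrite -mulrA -expr2 mulr_ge0 ?sqr_ge0.
    have := psumr_eq0P nn h2.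
    by rewrite /beta expr2 mulrA; apply.
  rewrite c00 expr0n mul0r mulr0 big1// => j _; apply: big1 => z _.
  by rewrite b0 mul0r.
have cp : 0 < c ^+ 2 by rewrite exprn_gt0// lt_def cn0.
(* The coefficient of index j belongs to averages of generation j+1+r: shift by r+1. *)
pose gam i z := if (r < i < r.+1 + n)%N then (c ^+ 2)^-1 * beta (i - r.+1)%N z else 0.
have gam0 i x : 0 <= gam i x.
  by rewrite /gam; case: ifP => // _; rewrite mulr_ge0 ?invr_ge0// ltW.
have := @carleson u u0 gam (r.+1 + n) f gam0.
rewrite -(ler_pM2l cp) big_split_ord/= [X in X + _]big1 ?add0r; last first.
  move=> i _; apply: big1 => z _; rewrite /gam ltnNge -ltnS ltn_ord/=.
  by rewrite mul0r.
have -> : c ^+ 2 * \sum_(i < n) \sum_x gam (r.+1 + i)%N x * cexp u (r.+1 + i) f x ^+ 2 =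
   \sum_(j < n) \sum_z beta j z * cexp u (r.+1 + j) f z ^+ 2.
  rewrite mulr_sumr; apply: eq_bigr => j _; rewrite mulr_sumr; apply: eq_bigr => z _.
  rewrite /gam ltn_add2l ltn_ord andbT addSn ltnS leq_addr -addSn addKn.
  by rewrite -mulrA mulVKf ?gt_eqF.
move=> h; rewrite mulrCA; apply: h => l w lL.
rewrite -(ler_pM2l cp).
apply: le_trans (riesz_norm l w).
rewrite exchange_big/= mulr_sumr.
have gl i : (i < l.+1)%N -> c ^+ 2 * \sum_(x | a l x == w) gam i x <=
   if (r < i)%N then wnorm v (mdiff v (i - r.+1) (riesz l w)) ^+ 2 else 0.
  move=> il; rewrite /gam; case: (ltnP r i) => ri/=; last by rewrite big1 ?mulr0.
  case: (i < r.+1 + n)%N; last by rewrite big1 ?mulr0 ?sqr_ge0.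
  rewrite -mulr_sumr mulrA divff ?gt_eqF// mul1r sqr_wnorm// /wip.
  rewrite big_mkcond/=; apply: ler_sum => z _.
  case: eqP => [zw|_]; last by rewrite -mulrA -expr2 mulr_ge0 ?sqr_ge0.
  have := @riesz_local (i - r.+1) l w z.
  have -> : ((i - r.+1).+1 + r = i)%N by rewrite addSnnS subnK.
  rewrite -ltnS => /(_ il zw) e.
  rewrite /beta expr2.
  have -> : ((i - r.+1).+1 + r = i)%N by rewrite addSnnS subnK.
  have [z0|z0] := eqVneq (v z) 0; first by rewrite z0 !mul0r.
  by move: e => /(mulfI z0) ->; rewrite mulrA.
apply: (@le_trans _ _ (\sum_(i < l.+1) if (r < i)%N then wnorm v (mdiff v (i - r.+1) (riesz l w)) ^+ 2 else 0)).
  by apply: ler_sum => i _; exact: gl.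
apply: le_trans (bessel v0 l.+1 _).
have [lr|rl] := leqP l.+1 r.+1.
  rewrite big1 ?sumr_ge0// => [i _|i _]; first exact: sqr_ge0.
  by rewrite ltnNge -ltnS (leq_trans (ltn_ord i) lr).
rewrite -[in X in X <= _](subnKC (ltnW rl)) big_split_ord/= big1 ?add0r; last first.
  by move=> i _; rewrite ltnNge -ltnS ltn_ord.
rewrite -[in X in _ <= X](subnK (ltnW rl)) big_split_ord/=.
rewrite ler_wpDr//; first by apply: sumr_ge0 => i _; exact: sqr_ge0.
apply: ler_sum => i _.
by rewrite addSn ltnS leq_addr -addSn addKn.
Qed.

End Bounds.

(** cexp u 0 f differs from f only where u vanishes, and by testing the form
    does not see such points. *)
Lemma form_cexp0l u v M c' f g : (forall x, 0 <= u x) -> testing_form u v M c' ->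
  form M (cexp u 0 f) g = form M f g.
Proof.
move=> u0 test; apply/eqP; rewrite -subr_eq0 -formBl -normr_le0.
have l0 (h : I -> R) : level_fun 0 h by move=> x y /a_inj ->.
set h := fun x => _.
have c'0 : 0 <= `|c'| by [].
have test' : testing_form u v M `|c'|.
  move=> j w k; apply: le_trans (test j w k) _.
  do 2!(apply: ler_wpM2r; first by rewrite ?wnorm_ge0 ?sqrtr_ge0).
  exact: ler_norm.
have := @step_bound u v M `|c'| u0 c'0 test' 0 finset.setT h g (l0 h).
suff -> : wnorm u h = 0 by rewrite mulr0 mul0r; apply => x _; rewrite finset.inE.
rewrite /wnorm /wip big1 ?sqrtr0// => x _.
have -> : u x * h x = 0; last by rewrite mul0r.
have one (G : I -> R) : \sum_(y | a 0 y == a 0 x) G y = G x.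
  by rewrite (big_pred1 x)// => y /=; apply/eqP/eqP => [/a_inj|->].
rewrite /h /cexp /mass !one; have [->|n0] := eqVneq (u x) 0; first by rewrite !mul0r.
by field.
Qed.

Section Main.
Variables (u v : I -> R) (M : I -> I -> R) (c : R) (r n D : nat).
Hypotheses (u0 : forall x, 0 <= u x) (v0 : forall x, 0 <= v x) (c0 : 0 <= c).
Hypotheses (D0 : (0 < D)%N) (topP : forall j x y, (n <= j)%N -> a j x = a j y -> a n x = a n y).
Hypothesis card_desc : forall i d w,
  (#|[set a i x | x in [set x | a (i + d) x == w]]%SET| <= D ^ d)%N.
Hypothesis card_top : (#|[set a n x | x in [set: I]]%SET| <= D)%N.

Lemma cexp_top w j f x : (n <= j)%N -> cexp w j f x = cexp w n f x.
Proof.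
move=> nj; have e y : (a j y == a j x) = (a n y == a n x).
  by apply/eqP/eqP; [exact: topP|exact: nest_le].
by rewrite /cexp /mass; congr (_ / _); apply: eq_bigl => y; rewrite e.
Qed.

Lemma cexp_tele w f m k x : (m <= k)%N ->
  cexp w m f x = cexp w k f x + \sum_(i < k | (m <= i)%N) mdiff w i f x.
Proof.
elim: k => [|k ih].
  by rewrite leqn0 => /eqP ->; rewrite big_ord0 addr0.
rewrite leq_eqVlt => /orP[/eqP ->|].
  by rewrite big1 ?addr0// => i; rewrite leqNgt ltn_ord.
rewrite ltnS => mk; rewrite big_mkcond big_ord_recr/= mk -big_mkcond/= {}ih//.
by rewrite /mdiff; ring.
Qed.

Lemma cexp_tele_top w f m x :
  cexp w m f x = cexp w n f x + \sum_(i < n | (m <= i)%N) mdiff w i f x.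
Proof.
have [mn|nm] := leqP m n; first exact: cexp_tele.
rewrite cexp_top ?big1 ?addr0// 1?ltnW// => i.
by rewrite leqNgt (ltn_trans (ltn_ord i) nm).
Qed.

(** Expand both arguments in martingale differences and sort the pairs (i, j).
    Those with i >= j+1+r, together with the averages of f of generation n, sum
    to cexp u (j+1+r) f against mdiff v j g; those with j >= i+1+r give the
    symmetric expression, and |i - j| <= r remains. *)
Lemma form_decomp f g :
  form M (cexp u 0 f) (cexp v 0 g) =
    form M (cexp u n f) (cexp v n g)
  + \sum_(j < n) form M (cexp u (j.+1 + r) f) (mdiff v j g)
  + \sum_(i < n) form M (mdiff u i f) (cexp v (i.+1 + r) g)
  + \sum_(j < n) \sum_(i < n | (i <= j + r)%N && (j <= i + r)%N)
       form M (mdiff u i f) (mdiff v j g).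
Proof.
have El m G : form M (cexp u m f) G = form M (cexp u n f) G +
    \sum_(i < n | (m <= i)%N) form M (mdiff u i f) G.
  rewrite -form_suml -formDl; apply: eq_form => // x; exact: cexp_tele_top.
have Er m F : form M F (cexp v m g) = form M F (cexp v n g) +
    \sum_(j < n | (m <= j)%N) form M F (mdiff v j g).
  rewrite -form_sumr -formDr; apply: eq_form => // x; exact: cexp_tele_top.
rewrite Er El /=.
under [X in _ + X = _]eq_bigr do rewrite El.
under [X in _ = _ + X + _ + _]eq_bigr do rewrite El.
under [X in _ = _ + X + _]eq_bigr do rewrite Er.
rewrite !big_split/=.
have -> : \sum_(i < n) \sum_(j < n | (i.+1 + r <= j)%N) form M (mdiff u i f) (mdiff v j g) =
  \sum_(j < n) \sum_(i < n | (i.+1 + r <= j)%N) form M (mdiff u i f) (mdiff v j g).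
  by rewrite (exchange_big_dep xpredT).
have sp : \sum_(j < n) \sum_(i < n) form M (mdiff u i f) (mdiff v j g) =
   \sum_(j < n) \sum_(i < n | (j.+1 + r <= i)%N) form M (mdiff u i f) (mdiff v j g) +
   \sum_(j < n) \sum_(i < n | (i.+1 + r <= j)%N) form M (mdiff u i f) (mdiff v j g) +
   \sum_(j < n) \sum_(i < n | (i <= j + r)%N && (j <= i + r)%N)
       form M (mdiff u i f) (mdiff v j g).
  rewrite -!big_split/=; apply: eq_bigr => j _.
  rewrite [X in _ = X + _ + _]big_mkcond [X in _ = _ + X + _]big_mkcond [X in _ = _ + X]big_mkcond.
  rewrite -!big_split/=; apply: eq_bigr => i _.
  rewrite !addSn; case: (leqP i (j + r)) => h1; case: (leqP j (i + r)) => h2/=; rewrite ?addr0 ?add0r//.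
  by exfalso; lia.
rewrite sp; ring.
Qed.

Hypotheses (test : testing_form u v M c) (test' : testing_form v u (fun x y => M y x) c).
Hypotheses (loc : local_form v M r) (loc' : local_form u (fun x y => M y x) r).

Lemma card_near (j : 'I_n) :
  (\sum_(i < n | (i <= j + r)%N && (j <= i + r)%N) 1 <= (2 * r).+1)%N.
Proof.
rewrite sum1_card -(size_iota (j - r) (2 * r).+1).
rewrite cardE -(size_map val); apply: uniq_leq_size.
  by rewrite map_inj_uniq ?enum_uniq//; exact: val_inj.
move=> k /mapP[s]; rewrite mem_enum => hi ->; rewrite mem_iota.
by move: hi; rewrite /in_mem/= => /andP[h1 h2]; lia.
Qed.

(** The terms of the constant: 2 for each of the two paraproducts; 2r+1 values
    of i - j near the diagonal, each with at most D^(2r+1) cells in the common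
    ancestor; and at most D cells of the top generation. *)
Theorem well_localized_bound f g :
  `|form M f g| <= (4 + (2 * r).+1%:R * Num.sqrt (D ^ (2 * r).+1)%:R + Num.sqrt D%:R) * c
    * wnorm u f * wnorm v g.
Proof.
rewrite -(form_cexp0l _ _ u0 test) -form_tr -(form_cexp0l _ _ v0 test') form_tr.
rewrite form_decomp.
have hE : `|form M (cexp u n f) (cexp v n g)| <= Num.sqrt D%:R * c * wnorm u f * wnorm v g.
  apply: le_trans (@step_bound u v M c u0 c0 test n [set a n x | x in [set: I]]%SET _ _ _ _) _.
  - exact: cexp_level.
  - by move=> x _; apply/imsetP; exists x.
  apply: ler_pM; rewrite ?mulr_ge0 ?sqrtr_ge0 ?wnorm_ge0//; last exact: wnorm_cexp.
  apply: ler_pM; rewrite ?mulr_ge0 ?sqrtr_ge0 ?wnorm_ge0//; last exact: wnorm_cexp.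
  by rewrite mulrC; apply: ler_wpM2r => //; rewrite ler_wsqrtr// ler_nat.
have h1 := @paraproduct_bound u v M c r u0 v0 c0 test loc n f g.
have h2 : `|\sum_(i < n) form M (mdiff u i f) (cexp v (i.+1 + r) g)| <=
    2 * c * wnorm u f * wnorm v g.
  have := @paraproduct_bound v u _ c r v0 u0 c0 test' loc' n g f.
  under eq_bigr do rewrite form_tr.
  by rewrite mulrAC.
have h3 : `|\sum_(j < n) \sum_(i < n | (i <= j + r)%N && (j <= i + r)%N)
       form M (mdiff u i f) (mdiff v j g)| <=
   (2 * r).+1%:R * Num.sqrt (D ^ (2 * r).+1)%:R * c * wnorm u f * wnorm v g.
  pose e (q : 'I_n * 'I_n) : R := ((q.2 <= q.1 + r)%N && (q.1 <= q.2 + r)%N)%:R.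
  apply: le_trans (ler_norm_sum _ _ _) _.
  apply: (@le_trans _ _ (c * Num.sqrt (D ^ (2 * r).+1)%:R *
     \sum_(q : 'I_n * 'I_n) (e q * wnorm u (mdiff u q.2 f)) * (e q * wnorm v (mdiff v q.1 g)))).
    rewrite -(pair_big xpredT xpredT (fun j i => (e (j, i) * wnorm u (mdiff u i f)) *
       (e (j, i) * wnorm v (mdiff v j g))))/= mulr_sumr.
    apply: ler_sum => j _; apply: le_trans (ler_norm_sum _ _ _) _.
    rewrite mulr_sumr big_mkcond/=; apply: ler_sum => i _; rewrite /e/=.
    case: ifP => [/andP[ij ji]|_]; last by rewrite !mul0r mulr0.
    rewrite !mul1r mulrA.
    apply: (@near_bound u v M c r u0 v0 c0 test loc i j (j.+1 + r)) => //.
      by rewrite addSn leqW.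
    move=> w; have ijr : (i <= j.+1 + r)%N by rewrite addSn leqW.
    have := card_desc i (j.+1 + r - i) w; rewrite subnKC// => /leq_trans; apply.
    rewrite leq_pexp2l// leq_subLR addSn addnS ltnS mul2n -addnn addnA leq_add2r.
    exact: ji.
  have -> : (2 * r).+1%:R * Num.sqrt (D ^ (2 * r).+1)%:R * c * wnorm u f * wnorm v g =
    c * Num.sqrt (D ^ (2 * r).+1)%:R * ((2 * r).+1%:R * (wnorm u f * wnorm v g)) by ring.
  apply: ler_wpM2l; first by rewrite mulr_ge0 ?sqrtr_ge0.
  apply: le_trans (ler_norm _) _; apply: le_trans (sum_CS _ _) _.
  have -> : (2 * r).+1%:R * (wnorm u f * wnorm v g) =
     Num.sqrt ((2 * r).+1%:R * wnorm u f ^+ 2) * Num.sqrt ((2 * r).+1%:R * wnorm v g ^+ 2).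
    have sE (p k : R) : 0 <= p -> 0 <= k -> Num.sqrt (p * k ^+ 2) = Num.sqrt p * k.
      by move=> p0 k0; rewrite sqrtrM// sqrtr_sqr ger0_norm.
    by rewrite !sE ?wnorm_ge0// mulrACA -expr2 sqr_sqrtr.
  have ee (q : 'I_n * 'I_n) : e q ^+ 2 = e q.
    by rewrite /e; case: (_ && _); rewrite ?expr1n ?expr0n.
  apply: ler_pM; rewrite ?sqrtr_ge0// ler_wsqrtr//.
    apply: le_trans (ler_wpM2l (ler0n _ _) (bessel u0 n f)).
    rewrite -(pair_big xpredT xpredT (fun j i => (e (j, i) * wnorm u (mdiff u i f)) ^+ 2))/=.
    rewrite exchange_big/= mulr_sumr; apply: ler_sum => i _.
    under eq_bigr do rewrite exprMn ee.
    rewrite -mulr_suml; apply: ler_wpM2r; first exact: sqr_ge0.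
    apply: le_trans (_ : (\sum_(j < n | (j <= i + r)%N && (i <= j + r)%N) 1)%:R <= _); last first.
      by rewrite ler_nat card_near.
    rewrite natr_sum [X in _ <= X]big_mkcond/=; apply: ler_sum => j _.
    by rewrite /e/= andbC; case: (_ && _).
  apply: le_trans (ler_wpM2l (ler0n _ _) (bessel v0 n g)).
  rewrite -(pair_big xpredT xpredT (fun j i => (e (j, i) * wnorm v (mdiff v j g)) ^+ 2))/=.
  rewrite mulr_sumr; apply: ler_sum => j _.
  under eq_bigr do rewrite exprMn ee.
  rewrite -mulr_suml; apply: ler_wpM2r; first exact: sqr_ge0.
  apply: le_trans (_ : (\sum_(i < n | (i <= j + r)%N && (j <= i + r)%N) 1)%:R <= _); last first.
    by rewrite ler_nat card_near.
  rewrite natr_sum [X in _ <= X]big_mkcond/=; apply: ler_sum => i _.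
  by rewrite /e/=; case: (_ && _).
apply: le_trans (ler_normD _ _) _.
apply: le_trans (lerD (le_trans (ler_normD _ _) (lerD (le_trans (ler_normD _ _) (lerD hE h1)) h2)) h3) _.
by rewrite le_eqVlt; apply/orP; left; apply/eqP; ring.
Qed.

End Main.
End Form.
End Tree.

Local Open Scope classical_set_scope.
Local Open Scope ring_scope.

(** * Real integrals and weighted L^2 spaces *)

Lemma cvg_bound (R : realType) (u : nat -> R) l K : u n @[n --> \oo] --> l ->
  (forall n, u n <= K) -> l <= K.
Proof.
move=> ul uK; have <- := cvg_lim (@Rhausdorff R) ul.
by apply: limr_le; [apply/cvg_ex; exists l|exact: nearW].
Qed.

Section RealIntegral.
Context {d} {X : measurableType d} {R : realType} (mu : {measure set X -> \bar R}).
Implicit Types (f g h w : X -> R).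

(** Li and J are integrability and the integral over the whole space, for
    real-valued functions. *)
Definition Li f := mu.-integrable setT (EFin \o f).
Definition J f := (\int[mu]_x f x)%R.

Lemma Li_meas f : Li f -> measurable_fun setT f.
Proof. by move=> /integrableP[/measurable_EFinP]. Qed.

Lemma LiD f g : Li f -> Li g -> Li (fun x => f x + g x).
Proof. by move=> hf hg; exact: (integrableD _ hf hg). Qed.

Lemma LiB f g : Li f -> Li g -> Li (fun x => f x - g x).
Proof. by move=> hf hg; exact: (integrableB _ hf hg). Qed.

Lemma LiZ k f : Li f -> Li (fun x => k * f x).
Proof. by move=> hf; exact: (integrableZl _ k hf). Qed.

Lemma Li_le f g : measurable_fun setT f -> (forall x, `|f x| <= g x) -> Li g -> Li f.
Proof.
move=> mf fg; apply: le_integrable => //; first exact/measurable_EFinP.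
by move=> x _ /=; rewrite lee_fin (le_trans (fg x))// ler_norm.
Qed.

Lemma Li_norm f : Li f -> Li (fun x => `|f x|).
Proof. exact: integrable_norm. Qed.

Lemma Li0 : Li (fun=> 0).
Proof. exact: integrable0. Qed.

Lemma JD f g : Li f -> Li g -> J (fun x => f x + g x) = J f + J g.
Proof. by move=> hf hg; rewrite /J RintegralD. Qed.

Lemma JB f g : Li f -> Li g -> J (fun x => f x - g x) = J f - J g.
Proof. by move=> hf hg; rewrite /J RintegralB. Qed.

Lemma JZ k f : Li f -> J (fun x => k * f x) = k * J f.
Proof. by move=> hf; rewrite /J RintegralZl. Qed.

Lemma J_ge0 f : (forall x, 0 <= f x) -> 0 <= J f.
Proof. by move=> f0; apply: Rintegral_ge0. Qed.

Lemma J_le f g : Li f -> Li g -> (forall x, f x <= g x) -> J f <= J g.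
Proof. by move=> hf hg fg; apply: le_Rintegral. Qed.

Lemma J0 : J (fun=> 0) = 0.
Proof. by rewrite /J /Rintegral integral0. Qed.

Lemma eqJ f g : f =1 g -> J f = J g.
Proof. by move=> fg; congr J; apply/funext. Qed.

Lemma Li_sum (I : finType) (F : I -> X -> R) :
  (forall i, Li (F i)) -> Li (fun x => \sum_i F i x).
Proof.
move=> h; suff : forall s : seq I, Li (fun x => \sum_(i <- s) F i x) by apply.
elim=> [|i s ih].
  by under [X in Li X]eq_fun do rewrite big_nil; exact: Li0.
by under [X in Li X]eq_fun do rewrite big_cons; exact: LiD.
Qed.

Lemma J_sum (I : finType) (F : I -> X -> R) : (forall i, Li (F i)) ->
  J (fun x => \sum_i F i x) = \sum_i J (F i).
Proof.
move=> h; suff : forall s : seq I, Li (fun x => \sum_(i <- s) F i x) /\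
    J (fun x => \sum_(i <- s) F i x) = \sum_(i <- s) J (F i).
  by move=> /(_ (index_enum I))[].
elim=> [|i s [ih1 ih2]].
  under [X in Li X]eq_fun do rewrite big_nil; under [X in J X]eq_fun do rewrite big_nil.
  by rewrite big_nil J0; split => //; exact: Li0.
under [X in Li X]eq_fun do rewrite big_cons; under [X in J X]eq_fun do rewrite big_cons.
by rewrite big_cons -ih2 JD//; split => //; exact: LiD.
Qed.

Lemma Li_EFin f : Li f -> (\int[mu]_x (f x)%:E)%E = (J f)%:E.
Proof. by move=> hf; rewrite /J /Rintegral fineK// integrable_fin_num. Qed.

Lemma Li_ge0 f : measurable_fun setT f -> (forall x, 0 <= f x) ->
  (\int[mu]_x (f x)%:E < +oo)%E -> Li f.
Proof.
move=> mf f0 fy; apply/integrableP; split; first exact/measurable_EFinP.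
by under eq_integral do rewrite /= ger0_norm//.
Qed.

Lemma Li_ae f g : measurable_fun setT g -> {ae mu, forall x, f x = g x} -> Li f -> Li g.
Proof.
move=> mg fg hf; apply/integrableP; split; first exact/measurable_EFinP.
have /integrableP[mf] := hf; apply: le_lt_trans.
rewrite le_eqVlt; apply/orP; left; apply/eqP; apply: ae_eq_integral => //.
- by apply: measurableT_comp => //; exact/measurable_EFinP.
- by apply: measurableT_comp.
- by apply: filterS fg => x /= -> _.
Qed.

Lemma J_ae f g : measurable_fun setT f -> measurable_fun setT g ->
  {ae mu, forall x, f x = g x} -> J f = J g.
Proof.
move=> mf mg fg; rewrite /J /Rintegral; congr fine; apply: ae_eq_integral => //.
- exact/measurable_EFinP.
- exact/measurable_EFinP.
- by apply: filterS fg => x /= -> _.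
Qed.

Lemma J0_ae f : Li f -> (forall x, 0 <= f x) -> J f = 0 -> {ae mu, forall x, f x = 0}.
Proof.
move=> hf f0 Jf; have mf := Li_meas hf.
have [h _] := @ae_eq_integral_abs _ _ _ mu setT measurableT (EFin \o f) ((measurable_EFinP _ _).2 mf).
have : (\int[mu]_x `|(EFin \o f) x|)%E = 0%E.
  by under eq_integral do rewrite /= ger0_norm//; rewrite Li_EFin// Jf.
by move=> /h; apply: filterS => x /= /(_ I) [].
Qed.

Lemma J_dct (F : nat -> X -> R) f g : (forall n, measurable_fun setT (F n)) ->
  (forall x, F n x @[n --> \oo] --> f x) -> Li g -> (forall n x, `|F n x| <= g x) ->
  [/\ Li f & J (F n) @[n --> \oo] --> J f].
Proof.
move=> mF Ff hg Fg.
have mf : measurable_fun setT f.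
  by apply: (@measurable_fun_cvg _ _ _ _ F) => // x _; exact: Ff.
have [] := @dominated_convergence _ X R mu setT measurableT (fun n => EFin \o F n) (EFin \o f) (EFin \o g).
- by move=> n; exact/measurable_EFinP.
- exact/measurable_EFinP.
- by apply: aeW => x _; apply/fine_cvgP; split; [exact: nearW|exact: Ff].
- by [].
- by apply: aeW => x n _ /=; rewrite lee_fin.
move=> hf _ h; split => //.
have hF n : Li (F n) by apply: Li_le hg.
have : (EFin \o (J \o F)) n @[n --> \oo] --> (J f)%:E.
  rewrite -(Li_EFin hf); apply: cvg_trans h; apply: near_eq_cvg.
  by apply: nearW => n /=; rewrite -Li_EFin.
by move=> /fine_cvgP[_].
Qed.

Lemma J_fatou (F : nat -> X -> R) f K : (forall n, Li (F n)) -> (forall n x, 0 <= F n x) ->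
  (forall x, F n x @[n --> \oo] --> f x) -> (forall n, J (F n) <= K) ->
  Li f /\ J f <= K.
Proof.
move=> hF F0 Ff FK.
have mf : measurable_fun setT f.
  by apply: (@measurable_fun_cvg _ _ _ _ F) => [n|x _]; [exact: Li_meas|exact: Ff].
have f0 x : 0 <= f x.
  have /cvg_lim <- // := Ff x.
  by apply: limr_ge; [apply/cvg_ex; exists (f x); exact: Ff|exact: nearW].
have h : (\int[mu]_x (f x)%:E <= K%:E)%E.
  have := @fatou _ _ _ mu setT measurableT (fun n => EFin \o F n).
  have -> : (\int[mu]_x limn_einf ((fun n => EFin \o F n) ^~ x) = \int[mu]_x (f x)%:E)%E.
    apply: eq_integral => x _ /=.
    have c : (F n x)%:E @[n --> \oo] --> (f x)%:E.
      by apply/fine_cvgP; split; [exact: nearW|exact: Ff].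
    by case: (cvg_limn_einf_sup c).
  move=> hh; apply: le_trans (hh _ _) _.
  - by move=> n; apply/measurable_EFinP; exact: Li_meas.
  - by move=> n x _; rewrite lee_fin.
  - rewrite limn_einf_lim; apply: lime_le; first exact: is_cvg_einfs.
    apply: nearW => n; apply: le_trans (_ : ((J (F n))%:E <= _)%E); last by rewrite lee_fin.
    by apply: ge_ereal_inf; exists (J (F n))%:E => //; exists n => //=; rewrite -Li_EFin.
have hf : Li f by apply: Li_ge0 => //; exact: le_lt_trans h (ltry _).
by split => //; rewrite -lee_fin -Li_EFin.
Qed.

Lemma Li_ind f (A : set X) : measurable A -> Li f -> Li (fun x => \1_A x * f x).
Proof.
move=> mA hf; apply: (@Li_le _ (fun x => `|f x|)); last exact: Li_norm.
  by apply: measurable_funM => //; exact: Li_meas.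
move=> x; rewrite normrM indicE; case: (_ \in _); rewrite /= ?normr1 ?normr0 ?mul1r ?mul0r//.
Qed.

Definition weight w := measurable_fun setT w /\ forall x, 0 <= w x.

(** Lw w, ipw w and nw w are the space L^2(w dmu), its inner product and its
    norm. The product w f f is written in this way, rather than as w f^2, so
    that Lw and ipw share the same integrand. *)
Definition Lw w f := measurable_fun setT f /\ Li (fun x => w x * f x * f x).
Definition ipw w f g := J (fun x => w x * f x * g x).
Definition nw w f := Num.sqrt (ipw w f f).

Lemma ipwC w f g : ipw w f g = ipw w g f.
Proof. by apply: eqJ => x; rewrite mulrAC. Qed.

Lemma nw_ge0 w f : 0 <= nw w f. Proof. exact: sqrtr_ge0. Qed.

Section OneWeight.
Variable w : X -> R.
Hypothesis hw : weight w.
Let mw := hw.1.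
Let w0 := hw.2.

Lemma w_sqr_ge0 f x : 0 <= w x * f x * f x.
Proof. by rewrite -mulrA mulr_ge0// -expr2 sqr_ge0. Qed.

Lemma ipw_ge0 f : 0 <= ipw w f f.
Proof. by apply: J_ge0 => x; exact: w_sqr_ge0. Qed.

Lemma sqr_nw f : nw w f ^+ 2 = ipw w f f.
Proof. by rewrite sqr_sqrtr// ipw_ge0. Qed.

Lemma Lw_mul f g : Lw w f -> Lw w g -> Li (fun x => w x * f x * g x).
Proof.
move=> [mf hf] [mg hg]; apply: (@Li_le _ (fun x => w x * f x * f x + w x * g x * g x)).
- by do 2?apply: measurable_funM.
- move=> x; rewrite -!mulrA -mulrDr normrM (ger0_norm (w0 x)).
  apply: ler_wpM2l => //; rewrite ler_norml.
  by have := sqr_ge0 (f x + g x); have := sqr_ge0 (f x - g x); rewrite !expr2; nra.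
- exact: LiD.
Qed.

Lemma LwD f g : Lw w f -> Lw w g -> Lw w (fun x => f x + g x).
Proof.
move=> hf hg; have [mf hf'] := hf; have [mg hg'] := hg; split; first exact: measurable_funD.
have -> : (fun x => w x * (f x + g x) * (f x + g x)) = (fun x => w x * f x * f x +
    w x * f x * g x + (w x * g x * f x + w x * g x * g x)) by apply/funext => x; ring.
by apply: LiD; apply: LiD => //; exact: Lw_mul.
Qed.

Lemma LwZ k f : Lw w f -> Lw w (fun x => k * f x).
Proof.
move=> [mf hf]; split; first exact: measurable_funM.
have -> : (fun x => w x * (k * f x) * (k * f x)) = (fun x => (k * k) * (w x * f x * f x)).
  by apply/funext => x; ring.
exact: LiZ.
Qed.

Lemma LwB f g : Lw w f -> Lw w g -> Lw w (fun x => f x - g x).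
Proof.
move=> hf /(LwZ (-1)) /(LwD hf).
by under [X in Lw w X -> _]eq_fun do rewrite mulN1r.
Qed.

Lemma Lw0 : Lw w (fun=> 0).
Proof.
split => //; have -> : (fun x => w x * 0 * 0) = (fun=> 0) by apply/funext => x; rewrite mulr0.
exact: Li0.
Qed.

Lemma Lw_sum (I : finType) (F : I -> X -> R) :
  (forall i, Lw w (F i)) -> Lw w (fun x => \sum_i F i x).
Proof.
move=> h; suff : forall s : seq I, Lw w (fun x => \sum_(i <- s) F i x) by apply.
elim=> [|i s ih].
  by under [X in Lw w X]eq_fun do rewrite big_nil; exact: Lw0.
by under [X in Lw w X]eq_fun do rewrite big_cons; exact: LwD.
Qed.

Lemma Lw_le f g : measurable_fun setT f -> (forall x, `|f x| <= `|g x|) -> Lw w g -> Lw w f.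
Proof.
move=> mf fg [mg hg]; split => //; apply: Li_le hg; first by do 2?apply: measurable_funM.
move=> x; rewrite ger0_norm ?w_sqr_ge0// -!mulrA; apply: ler_wpM2l => //.
by rewrite -!expr2 -(real_normK (num_real (f x))) -(real_normK (num_real (g x))) ler_pXn2r ?nnegrE.
Qed.

Lemma norm_ind_le (A : set X) x (k : R) : `|\1_A x * k| <= `|k|.
Proof. by rewrite normrM indicE; case: (_ \in _); rewrite /= ?normr1 ?normr0 ?mul1r ?mul0r. Qed.

Lemma Lw_ind f (A : set X) : measurable A -> Lw w f -> Lw w (fun x => \1_A x * f x).
Proof.
move=> mA hf; apply: Lw_le (hf); last by move=> x; exact: norm_ind_le.
by apply: measurable_funM => //; case: hf.
Qed.

Lemma ipwDl f g h : Lw w f -> Lw w g -> Lw w h ->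
  ipw w (fun x => f x + g x) h = ipw w f h + ipw w g h.
Proof.
move=> hf hg hh; rewrite /ipw -JD; [|exact: Lw_mul..].
by apply: eqJ => x; ring.
Qed.

Lemma ipwBl f g h : Lw w f -> Lw w g -> Lw w h ->
  ipw w (fun x => f x - g x) h = ipw w f h - ipw w g h.
Proof.
move=> hf hg hh; rewrite /ipw -JB; [|exact: Lw_mul..].
by apply: eqJ => x; ring.
Qed.

Lemma ipwZl k f h : Lw w f -> Lw w h -> ipw w (fun x => k * f x) h = k * ipw w f h.
Proof.
move=> hf hh; rewrite /ipw -JZ; last exact: Lw_mul.
by apply: eqJ => x; ring.
Qed.

Lemma ipw_CS f g : Lw w f -> Lw w g -> `|ipw w f g| <= nw w f * nw w g.
Proof.
move=> hf hg; rewrite -(ler_pXn2r (_ : 0 < 2)%N)// ?nnegrE ?mulr_ge0 ?nw_ge0//.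
rewrite exprMn !sqr_nw// -normrX ger0_norm ?sqr_ge0//.
apply: quadratic_CS => s t.
have hs := LwZ s hf; have ht := LwZ t hg; have hst := LwD hs ht.
have -> : s ^+ 2 * ipw w f f + 2 * s * t * ipw w f g + t ^+ 2 * ipw w g g =
    ipw w (fun x => s * f x + t * g x) (fun x => s * f x + t * g x).
  rewrite ipwDl// ![ipw _ (fun x => _ * _) _]ipwZl// ![ipw _ _ (fun x => _ + _)]ipwC.
  rewrite !ipwDl// ![ipw _ (fun x => _ * _) _]ipwZl// (ipwC _ g f); ring.
exact: ipw_ge0.
Qed.

Lemma nwD f g : Lw w f -> Lw w g -> nw w (fun x => f x + g x) <= nw w f + nw w g.
Proof.
move=> hf hg; rewrite -(ler_pXn2r (_ : 0 < 2)%N)// ?nnegrE ?addr_ge0 ?nw_ge0//.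
have hfg := LwD hf hg.
rewrite sqr_nw ipwDl// ![ipw _ _ (fun x => _ + _)]ipwC !ipwDl// sqrrD !sqr_nw (ipwC _ g f).
have := le_trans (ler_norm _) (ipw_CS hf hg).
by rewrite -mulr_natl; lra.
Qed.

Lemma nwZ k f : Lw w f -> nw w (fun x => k * f x) = `|k| * nw w f.
Proof.
move=> hf; rewrite /nw ipwZl//; last exact: LwZ.
by rewrite ipwC ipwZl// mulrA -expr2 sqrtrM ?sqr_ge0// sqrtr_sqr.
Qed.

Lemma nwB f g : Lw w f -> Lw w g -> nw w (fun x => f x - g x) <= nw w f + nw w g.
Proof.
move=> hf hg; have := nwD hf (LwZ (-1) hg); rewrite nwZ// normrN1 mul1r.
by congr (_ <= _); congr nw; apply/funext => x; ring.
Qed.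

Lemma nw_le f g : Lw w f -> Lw w g -> (forall x, `|f x| <= `|g x|) -> nw w f <= nw w g.
Proof.
move=> hf hg fg; rewrite ler_wsqrtr// J_le//; [exact: hf.2|exact: hg.2|].
move=> x; rewrite -!mulrA; apply: ler_wpM2l => //.
by rewrite -!expr2 -(real_normK (num_real (f x))) -(real_normK (num_real (g x))) ler_pXn2r ?nnegrE.
Qed.

Lemma nw_ae f g : measurable_fun setT f -> measurable_fun setT g ->
  {ae mu, forall x, f x = g x} -> nw w f = nw w g.
Proof.
move=> mf mg fg; congr Num.sqrt; apply: J_ae; do ?by do 2?apply: measurable_funM.
by apply: filterS fg => x ->.
Qed.

Lemma Lw_ae f g : measurable_fun setT g -> {ae mu, forall x, f x = g x} -> Lw w f -> Lw w g.
Proof.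
move=> mg fg [mf hf]; split => //; apply: Li_ae hf; first by do 2?apply: measurable_funM.
by apply: filterS fg => x ->.
Qed.

Lemma ipw_ae f f' g g' : measurable_fun setT f -> measurable_fun setT f' ->
  measurable_fun setT g -> measurable_fun setT g' ->
  {ae mu, forall x, f x = f' x} -> {ae mu, forall x, g x = g' x} -> ipw w f g = ipw w f' g'.
Proof.
move=> mf mf' mg mg' ff gg; apply: J_ae; do ?by do 2?apply: measurable_funM.
by apply: filterS2 ff gg => x -> ->.
Qed.

Lemma ipw_cvg (F : nat -> X -> R) f g : (forall n, Lw w (F n)) -> Lw w f -> Lw w g ->
  nw w (fun x => F n x - f x) @[n --> \oo] --> 0 -> ipw w (F n) g @[n --> \oo] --> ipw w f g.
Proof.
move=> hF hf hg h.
have h0 : nw w (fun x => F n x - f x) * nw w g @[n --> \oo] --> 0.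
  by rewrite -[X in _ --> X](mul0r (nw w g)); apply: cvgMl.
apply/cvgrPdist_le => e e0.
move/cvgr0Pnorm_le : h0 => /(_ _ e0); apply: filterS => n.
rewrite distrC => hn; apply: le_trans hn.
rewrite -ipwBl//; apply: le_trans (ler_norm _).
by apply: ipw_CS => //; exact: LwB.
Qed.

Lemma nw_cvg (F : nat -> X -> R) f : (forall n, Lw w (F n)) -> Lw w f ->
  nw w (fun x => F n x - f x) @[n --> \oo] --> 0 -> nw w (F n) @[n --> \oo] --> nw w f.
Proof.
move=> hF hf h; apply/cvgrPdist_le => e e0.
move/cvgr0Pnorm_le : h => /(_ _ e0); apply: filterS => n hn; apply: le_trans hn.
rewrite [X in _ <= X]ger0_norm ?nw_ge0// ler_norml; apply/andP; split.
- have := nwD (LwB (hF n) hf) hf.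
  rewrite (_ : (fun x => F n x - f x + f x) = F n); first by lra.
  by apply/funext => x; rewrite subrK.
- have := nwB (hF n) (LwB (hF n) hf).
  rewrite (_ : (fun x => F n x - (F n x - f x)) = f); first by lra.
  by apply/funext => x; ring.
Qed.

End OneWeight.

Lemma nw_weight_le w w' k f : weight w -> weight w' -> 0 <= k ->
  (forall x, w x <= k * w' x) -> Lw w' f -> Lw w f /\ nw w f <= Num.sqrt k * nw w' f.
Proof.
move=> [mw w0] hw' k0 ww' [mf hf].
have le x : w x * f x * f x <= k * (w' x * f x * f x).
  rewrite !mulrA -![_ * f x * f x]mulrA; apply: ler_wpM2r => //.
  by rewrite -expr2 sqr_ge0.
have hwf : Li (fun x => w x * f x * f x).
  apply: Li_le (LiZ k hf); first by do 2?apply: measurable_funM.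
  by move=> x; rewrite ger0_norm// -mulrA mulr_ge0// -expr2 sqr_ge0.
split => //; rewrite /nw -sqrtrM//; apply: ler_wsqrtr.
by rewrite -JZ//; apply: J_le => //; exact: LiZ.
Qed.

Lemma weight_ind w (A : set X) : measurable A -> weight w -> weight (fun x => \1_A x * w x).
Proof.
by move=> mA [mw w0]; split; [exact: measurable_funM|move=> x; rewrite mulr_ge0].
Qed.

Lemma weight1 : weight (fun=> 1).
Proof. by split. Qed.

Lemma cut_cvg w g (B : nat -> set X) : weight w -> (forall k, measurable (B k)) ->
  (forall x, \forall k \near \oo, B k x) -> Lw w g ->
  nw w (fun x => g x - \1_(B k) x * g x) @[k --> \oo] --> 0.
Proof.
move=> hw mB Bx hg; have [mg ig] := hg; have [mw w0] := hw.
pose F k x := w x * (g x - \1_(B k) x * g x) * (g x - \1_(B k) x * g x).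
have mF k : measurable_fun setT (F k).
  by do 2?apply: measurable_funM => //; apply: measurable_funB => //; apply: measurable_funM.
have F0 x : F k x @[k --> \oo] --> 0.
  apply: cvg_near_cst; apply: filterS (Bx x) => k Bk.
  by rewrite /F indicE mem_set//= mul1r subrr !mulr0.
have Fle k x : `|F k x| <= w x * g x * g x.
  rewrite ger0_norm; last exact: (w_sqr_ge0 hw (fun x => g x - \1_(B k) x * g x)).
  rewrite /F -!mulrA; apply: ler_wpM2l => //.
  rewrite indicE; case: (_ \in _) => /=; rewrite ?mul1r ?subrr ?mulr0 ?mul0r ?subr0//.
  by rewrite -expr2 sqr_ge0.
have [_] := J_dct mF F0 ig Fle.
rewrite J0 => h.
have := cvg_comp _ _ h (@sqrt_continuous R 0); rewrite sqrtr0; exact.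
Qed.

Section Exhaustion.
Variables (E : nat -> set X) (v : X -> R).
Hypotheses (hv : weight v) (mE : forall k, measurable (E k)).
Hypothesis ndE : forall k l, (k <= l)%N -> E k `<=` E l.
Hypothesis ET : forall x, exists k, E k x.

Let B k := E k `&` [set x | v x <= k%:R].

Lemma mB k : measurable (B k).
Proof.
apply: measurableI => //; rewrite -[X in measurable X]setTI.
have -> : [set x | v x <= k%:R] = v @^-1` `]-oo, k%:R] by apply/seteqP; split => x /=; rewrite in_itv.
by apply: hv.1.
Qed.

Lemma nearB x : \forall k \near \oo, B k x.
Proof.
have [k0 Ex] := ET x.
exists (maxn k0 (Num.truncn (v x)).+1) => // k /=; rewrite geq_max => /andP[h1 h2]; split.
  exact: ndE Ex.
apply: ltW; apply: lt_le_trans (truncnS_gt (v x)) _.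
by rewrite ler_nat.
Qed.

Let vB k x := \1_(B k) x * v x.

Lemma weight_vB k : weight (vB k).
Proof. by apply: weight_ind => //; exact: mB. Qed.

Lemma vB_le k x : vB k x <= k%:R * \1_(E k) x.
Proof.
rewrite /vB !indicE; have [|] := boolP (x \in B k); last by rewrite mul0r mulr_ge0.
rewrite inE => -[Ex vx]; rewrite mem_set//= mul1r mulr1; exact: vx.
Qed.

Lemma vB_le1 k x : vB k x <= 1 * v x.
Proof.
by rewrite /vB; apply: ler_wpM2r; [exact: hv.2|rewrite indicE; case: (_ \in _)].
Qed.

Let wE k : weight (\1_(E k) : X -> R).
Proof. by split => // x; rewrite indicE. Qed.

Variables (F : nat -> X -> R) (f : X -> R) (K : R).
Hypotheses (hF : forall n, Lw v (F n)) (hFE : forall n k, Lw \1_(E k) (F n)).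
Hypothesis hfE : forall k, Lw \1_(E k) f.
Hypothesis cvgE : forall k, nw \1_(E k) (fun x => F n x - f x) @[n --> \oo] --> 0.
Hypothesis FK : forall n, nw v (F n) <= K.

Let hvB k g : Lw \1_(E k) g -> Lw (vB k) g /\ nw (vB k) g <= Num.sqrt k%:R * nw \1_(E k) g.
Proof. by move=> hg; apply: nw_weight_le => //; [exact: weight_vB|exact: vB_le]. Qed.

Let cvgB k : nw (vB k) (fun x => F n x - f x) @[n --> \oo] --> 0.
Proof.
apply: (@squeeze_cvgr _ _ _ _ (fun=> 0)
  (fun n => Num.sqrt k%:R * nw \1_(E k) (fun x => F n x - f x))).
- apply: nearW => n; rewrite nw_ge0/=.
  by apply: (hvB _).2; apply: LwB.
- exact: cvg_cst.
- by rewrite -[X in _ --> X](mulr0 (Num.sqrt k%:R)); apply: cvgMr; exact: cvgE.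
Qed.

(** The convergence F n --> f is known in unweighted L^2 on each E k only. On the
    part of E k where v <= k it implies convergence in L^2(v), hence the bound
    for f there; Fatou's lemma lets k grow. *)
Lemma exhaustion_bound : Lw v f /\ nw v f <= K.
Proof.
have K0 : 0 <= K by apply: le_trans (nw_ge0 _ _) (FK 0).
have h k : nw (vB k) f <= K.
  have c := nw_cvg (weight_vB k) (fun n => (hvB (hFE n k)).1) (hvB (hfE k)).1 (@cvgB k).
  apply: (cvg_bound c) => n; apply: le_trans (FK n).
  have [_] := nw_weight_le (weight_vB k) hv ler01 (@vB_le1 k) (hF n).
  by rewrite sqrtr1 mul1r.
have mf := (hfE 0).1.
have [] := @J_fatou (fun k x => vB k x * f x * f x) (fun x => v x * f x * f x) (K ^+ 2).
- by move=> k; exact: (hvB (hfE k)).1.2.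
- by move=> k x; apply: w_sqr_ge0; exact: weight_vB.
- move=> x; apply: cvg_near_cst; apply: filterS (nearB x) => k Bk.
  by rewrite /vB indicE mem_set//= mul1r.
- move=> k; rewrite -/(ipw _ _ _) -sqr_nw ?ler_pXn2r ?nnegrE ?nw_ge0//; exact: weight_vB.
move=> hf; rewrite -/(ipw _ _ _) -sqr_nw// ler_pXn2r ?nnegrE ?nw_ge0//.
Qed.

(** A sequence bounded in L^2(v) that converges on the pieces of the exhaustion
    converges weakly: outside a large piece the norm of g is small, and inside
    the convergence is strong. *)
Lemma exhaustion_weak g : Lw v g -> ipw v (F n) g @[n --> \oo] --> ipw v f g.
Proof.
move=> hg; have [hf fK] := exhaustion_bound.
have K0 : 0 <= K by apply: le_trans (nw_ge0 _ _) (FK 0).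
apply/cvgrPdist_le => e e0.
pose gk k x := \1_(B k) x * g x.
have hgk k : Lw v (gk k) by apply: Lw_ind => //; exact: mB.
have c1 := cut_cvg hv mB nearB hg.
have [k hk] : exists k, nw v (fun x => g x - gk k x) * (2 * K) <= e / 2.
  have : nw v (fun x => g x - \1_(B k) x * g x) * (2 * K) @[k --> \oo] --> 0.
    by rewrite -[X in _ --> X](mul0r (2 * K)); apply: cvgMl.
  move=> /cvgr0Pnorm_le /(_ (e / 2)); rewrite divr_gt0// => /(_ isT) [k _ /(_ k (leqnn k))] h.
  by exists k; apply: le_trans h; exact: ler_norm.
have : nw (vB k) (fun x => F n x - f x) * nw (vB k) g @[n --> \oo] --> 0.
  by rewrite -[X in _ --> X](mul0r (nw (vB k) g)); apply: cvgMl; exact: cvgB.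
move=> /cvgr0Pnorm_le /(_ (e / 2)); rewrite divr_gt0// => /(_ isT); apply: filterS => n.
rewrite ger0_norm ?mulr_ge0 ?nw_ge0// => hn.
rewrite distrC -ipwBl//.
have hB : Lw v (fun x => F n x - f x) by exact: LwB.
have hgB : Lw (vB k) g.
  by have [] := nw_weight_le (weight_vB k) hv ler01 (@vB_le1 k) hg.
have hB' : Lw (vB k) (fun x => F n x - f x).
  by have [] := nw_weight_le (weight_vB k) hv ler01 (@vB_le1 k) hB.
have -> : ipw v (fun x => F n x - f x) g =
   ipw v (fun x => F n x - f x) (fun x => g x - gk k x) + ipw (vB k) (fun x => F n x - f x) g.
  rewrite /ipw -JD; last 2 first.
  - by apply: Lw_mul => //; exact: LwB.
  - by apply: Lw_mul => //; exact: weight_vB.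
  by apply: eqJ => x; rewrite /gk /vB; ring.
apply: le_trans (ler_normD _ _) _; rewrite [X in _ <= X](splitr e).
apply: lerD; last first.
  by apply: le_trans hn; apply: ipw_CS => //; exact: weight_vB.
apply: le_trans hk; apply: le_trans (ipw_CS _ _ _) _ => //; first exact: LwB.
rewrite mulrC; apply: ler_wpM2l; first exact: nw_ge0.
apply: le_trans (nwB _ _ _) _ => //.
by rewrite mulr2n mulrDl mul1r; apply: lerD.
Qed.

End Exhaustion.

End RealIntegral.

(** * Dyadic cubes and the tree distance *)

Lemma floor_div_nat (R : realType) (y : R) (m : nat) : (0 < m)%N ->
  Num.floor (y / m%:R) = (Num.floor y %/ m%:Z)%Z.
Proof.
move=> m0; have m0R : 0 < (m%:R : R) by rewrite ltr0n.
have m0Z : (m%:Z : int) != 0 by rewrite gt_eqF.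
apply: floor_def; rewrite ler_pdivlMr// ltr_pdivrMr//.
have e : m%:R = (m%:Z)%:~R :> R by [].
rewrite e -!intrM -floor_ge_int -floor_lt_int.
have h := divz_eq (Num.floor y) m%:Z.
have h1 := modz_ge0 (Num.floor y) m0Z.
have h2 : (Num.floor y %% m%:Z)%Z < m%:Z by rewrite ltz_pmod.
move: h h1 h2; set q := (_ %/ _)%Z; set s := (_ %% _)%Z => -> h1 h2.
by rewrite lerDl h1 mulrDl mul1r ltrD2l.
Qed.

Section Dyadic.
Context {R : realType} {N : nat}.
Local Notation X := (Rn R N).
Local Notation cube := (@Defs.cube R N).
Implicit Types (Q S : dyadic N) (x y : X).

Definition cell_of (k : int) x : N.-tuple int :=
  [tuple Num.floor (tnth x i / 2 ^ k) | i < N].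

Lemma pow2_gt0 (k : int) : 0 < (2 ^ k : R).
Proof. by rewrite exprz_gt0. Qed.

Lemma cubeP Q x : cube Q x <-> cell_of Q.1 x = Q.2.
Proof.
rewrite /cube /box /=; split => [h|h i].
  apply: eq_from_tnth => i; rewrite tnth_mktuple; apply/eqP.
  by rewrite floor_eq intrD ler_pdivlMr ?pow2_gt0// ltr_pdivrMr ?pow2_gt0// h.
have := congr1 (fun t => tnth t i) h; rewrite tnth_mktuple => /eqP.
by rewrite floor_eq intrD ler_pdivlMr ?pow2_gt0// ltr_pdivrMr ?pow2_gt0.
Qed.

Lemma cube_cell k x : cube (k, cell_of k x) x.
Proof. exact/cubeP. Qed.

Lemma cube_eq Q S x : Q.1 = S.1 -> cube Q x -> cube S x -> Q = S.
Proof.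
case: Q => k j; case: S => k' j' /= <- /cubeP /= <- /cubeP /= <-; by [].
Qed.

Definition corner Q : X := [tuple (tnth Q.2 i)%:~R * 2 ^ Q.1 | i < N].

Lemma cube_corner Q : cube Q (corner Q).
Proof.
apply/cubeP; apply: eq_from_tnth => i; rewrite !tnth_mktuple.
by rewrite mulfK ?gt_eqF ?pow2_gt0// intrKfloor.
Qed.

(** The n-th ancestor. Integer division rounds towards minus infinity, which
    makes this correct for cubes with negative indices. *)
Definition anc (n : nat) Q : dyadic N :=
  (Q.1 + n%:Z, [tuple (tnth Q.2 i %/ (2 ^ n)%N%:Z)%Z | i < N]).

Lemma cell_anc (n : nat) (k : int) x :
  cell_of (k + n%:Z) x = (anc n (k, cell_of k x)).2.
Proof.
apply: eq_from_tnth => i; rewrite !tnth_mktuple/= -floor_div_nat ?expn_gt0//.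
by rewrite expfzDr ?pnatr_eq0// invfM mulrA natrX.
Qed.

Lemma cube_anc n Q x : cube Q x -> cube (anc n Q) x.
Proof.
by case: Q => k j /cubeP /= <-; apply/cubeP; rewrite /= cell_anc.
Qed.

Lemma anc0 Q : anc 0 Q = Q.
Proof.
case: Q => k j; rewrite /anc /= addr0; congr pair.
by apply: eq_from_tnth => i; rewrite tnth_mktuple expn0 divz1.
Qed.

Lemma anc_unique Q S x : cube Q x -> cube S x -> Q.1 <= S.1 -> S = anc `|S.1 - Q.1|%N Q.
Proof.
move=> Qx Sx QS; apply: (@cube_eq _ _ x) => //; last exact: cube_anc.
by rewrite /=; lia.
Qed.

Lemma ancD m n Q : anc (m + n) Q = anc m (anc n Q).
Proof.
rewrite /anc /=; congr pair; first by lia.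
apply: eq_from_tnth => i; rewrite !tnth_mktuple -divzMA_ge0//.
by rewrite expnD mulnC PoszM.
Qed.

Lemma cube_sub_anc n Q : cube Q `<=` cube (anc n Q).
Proof. by move=> x; exact: cube_anc. Qed.

Lemma cube_nested Q S x : cube Q x -> cube S x -> Q.1 <= S.1 -> cube Q `<=` cube S.
Proof. by move=> Qx Sx h; rewrite (anc_unique Qx Sx h); exact: cube_sub_anc. Qed.

Lemma sub_anc Q S : cube Q `<=` cube S -> Q.1 <= S.1 -> S = anc `|S.1 - Q.1|%N Q.
Proof. by move=> h; apply: (anc_unique (cube_corner Q)) (h _ (cube_corner Q)). Qed.

Lemma is_childP S Q : is_child (R := R) S Q -> anc 1 S = Q.
Proof.
move=> [h1 h2]; have := sub_anc h2.
have -> : `|(Q.1 - S.1)%R|%N = 1%N by rewrite h1; lia.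
by move=> ->//; rewrite h1; lia.
Qed.

(** A step along an edge goes to the parent or to a child; either way the two
    ends of a path of length s keep a common ancestor that is s generations
    above the last cube, and one that is s generations above the first. *)
Lemma path_anc Q (p : seq (dyadic N)) : path (tree_edge (R := R)) Q p ->
  (exists m, anc m Q = anc (size p) (last Q p)) /\
  (exists m, anc m (last Q p) = anc (size p) Q).
Proof.
elim: p Q => [|S p ih] Q /=; first by split; exists 0%N.
move=> /andP[/asboolP e /ih [[m hm] [m' hm']]]; split.
- case: e => /is_childP e.
    exists m.+2; rewrite -(add1n (size p)) ancD -hm -e -!ancD; congr anc; lia.
  exists m; rewrite -e -(add1n (size p)) ancD -hm -!ancD; congr anc; lia.
- case: e => /is_childP e.
    exists m'; rewrite hm' -e -ancD; congr anc; lia.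
  exists m'.+2; rewrite -(add2n m') ancD hm' -e -!ancD; congr anc; lia.
Qed.

(** A path of length at most r would place each of the two cubes inside the r-th
    ancestor of the other, by [path_anc]. *)
Lemma d_tree_far r Q S : ~ (cube Q `<=` cube (anc r S)) \/
    ~ (cube S `<=` cube (anc r Q)) ->
  (r%:R%:E < d_tree (R := R) Q S)%E.
Proof.
move=> h; apply: (@lt_le_trans _ _ (r.+1%:R)%:E); first by rewrite lte_fin ltr_nat.
apply: le_ereal_inf_tmp => _ [p [pp pl] <-]; rewrite lee_fin ler_nat ltnNge.
apply/negP => pr; have [[m hm] [m' hm']] := path_anc pp; rewrite pl in hm hm'.
have e (Q' : dyadic N) : anc r Q' = anc (r - size p) (anc (size p) Q').
  by rewrite -ancD subnK.
case: h; apply; rewrite e.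
- by rewrite -hm => x Qx; do 2!apply: cube_anc.
- by rewrite -hm' => x Qx; do 2!apply: cube_anc.
Qed.

Definition grid (k : int) (o : N.-tuple int) (m : nat) (i : {ffun 'I_N -> 'I_m}) : dyadic N :=
  (k, [tuple tnth o t + (i t)%:Z | t < N]).

Lemma grid_inj k o m : injective (@grid k o m).
Proof.
move=> i i' e; apply/ffunP => t; apply: val_inj.
have := congr1 (fun S : dyadic N => tnth S.2 t) e; rewrite !tnth_mktuple /=; lia.
Qed.

Lemma gridP k o m x : (forall t, tnth o t <= tnth (cell_of k x) t < tnth o t + m%:Z) ->
  exists i, cube (@grid k o m i) x.
Proof.
move=> h; have hi t : (`|tnth (cell_of k x) t - tnth o t| < m)%N by have := h t; lia.
exists [ffun t => Ordinal (hi t)]; apply/cubeP => /=.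
apply: eq_from_tnth => t; rewrite [RHS]tnth_mktuple ffunE.
have /andP[h1 _] := h t.
by rewrite [nat_of_ord _]/= gez0_abs ?subr_ge0//; ring.
Qed.

Definition desc_origin n Q : N.-tuple int := [tuple tnth Q.2 t * (2 ^ n)%N%:Z | t < N].
Definition desc n Q := grid (Q.1 - n%:Z) (desc_origin n Q) (m := (2 ^ n)%N).

Arguments desc n Q i : clear implicits.

Lemma anc_desc n Q i : anc n (desc n Q i) = Q.
Proof.
case: Q i => k j i; rewrite /anc /=; congr pair; first by lia.
apply: eq_from_tnth => t; rewrite !tnth_mktuple divzMDl; last by rewrite -lt0n expn_gt0.
by rewrite divz_small ?addr0//; have := ltn_ord (i t); lia.
Qed.

Lemma desc_sub n Q i : cube (desc n Q i) `<=` cube Q.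
Proof. by rewrite -{2}(@anc_desc n Q i); exact: cube_sub_anc. Qed.

Lemma desc_cover n Q x : cube Q x -> exists i, cube (desc n Q i) x.
Proof.
move=> Qx; apply: gridP => t.
have : Q = anc n (Q.1 - n%:Z, cell_of (Q.1 - n%:Z) x).
  apply: (@cube_eq _ _ x) => //; first by rewrite /=; lia.
  by apply: cube_anc; exact: cube_cell.
move=> /(congr1 (fun S : dyadic N => tnth S.2 t)); rewrite /anc [RHS]tnth_mktuple => e.
rewrite /desc_origin tnth_mktuple e /=.
set z := tnth _ t.
have p0 : (0 < 2 ^ n)%N by rewrite expn_gt0.
have pZ : ((2 ^ n)%N%:Z : int) != 0 by rewrite gt_eqF.
have h := divz_eq z (2 ^ n)%N%:Z; have h1 := modz_ge0 z pZ.
have h2 : (z %% (2 ^ n)%N%:Z)%Z < (2 ^ n)%N%:Z by rewrite ltz_pmod.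
move: h h1 h2; set q := (_ %/ _)%Z; set s := (_ %% _)%Z => -> h1 h2.
by rewrite lerDl h1 ltrD2l.
Qed.

Lemma desc_level n Q S : cube S `<=` cube Q -> S.1 = Q.1 - n%:Z -> exists i, S = desc n Q i.
Proof.
move=> SQ S1; have [i hi] := desc_cover n (SQ _ (cube_corner S)).
by exists i; apply: (cube_eq _ (cube_corner S) hi).
Qed.

Definition vol Q : R := (2 ^ Q.1) ^+ N.

Lemma vol_gt0 Q : 0 < vol Q.
Proof. by rewrite exprn_gt0// pow2_gt0. Qed.

Lemma mu_cube Q : Defs.lebesgue_measureN R N (Defs.cube Q) = (vol Q)%:E.
Proof.
rewrite /Defs.cube lebesgue_measureN_box; last first.
  by move=> i; rewrite ler_pM2r ?pow2_gt0// lerDl.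
congr (_%:E); rewrite (eq_bigr (fun=> 2 ^ Q.1)); last first.
  by move=> i _; rewrite -mulrBl addrAC subrr add0r mul1r.
by rewrite prodr_const card_ord.
Qed.

Lemma measurable_cube Q : measurable (cube Q).
Proof. exact: measurable_box. Qed.

Lemma vol_anc n Q : vol (anc n Q) = (2 ^+ N) ^+ n * vol Q.
Proof.
rewrite /vol /= expfzDr ?pnatr_eq0// exprMn mulrC; congr (_ * _).
by rewrite -exprnP -!exprM mulnC.
Qed.

End Dyadic.
Arguments desc {N} n Q i.

(** * Density of step functions and differentiation *)

Section Density.
Context {R : realType} {N : nat}.
Local Notation X := (Rn R N).
Local Notation mu := (Defs.lebesgue_measureN R N).
Local Notation cube := (@Defs.cube R N).
Local Notation Li := (Li mu).
Local Notation J := (J mu).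
Local Notation Lw := (Lw mu).
Local Notation nw := (nw mu).
Local Notation ipw := (ipw mu).
Implicit Types (Q S : dyadic N) (x y : X) (w f : X -> R) (A : set X).

(** Coordinate half-spaces generate the product sigma-algebra on tuples. *)
Lemma tuple_measurable_ind (F : set (set X)) : sigma_algebra setT F ->
  (forall i c, F [set x | tnth x i < c]) -> forall A, measurable A -> F A.
Proof.
move=> sF Fray A mA.
have : forall B, @measurable _ X B -> F B; last exact.
apply: smallest_sub => //.
apply: (big_ind (fun G : set (set X) => G `<=` F)) => //.
  by move=> G G' GF GF' B [/GF|/GF'].
move=> i _ B [C mC <-]; rewrite setTI.
have [F0 FC FU] := sF.
have : <<s @RGenInftyO.G R >> C.
  have : (@RGenInftyO.G R).-sigma.-measurable C by rewrite -RGenInftyO.measurableE; exact: mC.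
  by [].
move: C {mC}; have : forall C, <<s @RGenInftyO.G R >> C ->
    F ((fun t : X => tnth t i) @^-1` C); last by [].
apply: smallest_sub.
- split; first by rewrite preimage_set0.
  + by move=> C hC; rewrite setTD preimage_setC -setTD; exact: FC.
  + by move=> C hC; rewrite preimage_bigcup; exact: FU.
- move=> C [c ->].
  have -> : (fun t : X => tnth t i) @^-1` `]-oo, c[ = [set x | tnth x i < c].
    by apply/seteqP; split => x /=; rewrite in_itv.
  exact: Fray.
Qed.

Definition step (k : nat) (G : X -> R) :=
  forall x y, cell_of (- k%:Z) x = cell_of (- k%:Z) y -> G x = G y.

Lemma step_refine k l G : (k <= l)%N -> step k G -> step l G.
Proof.
move=> kl hG x y e; apply: hG.
have -> : - k%:Z = - l%:Z + (l - k)%N%:Z by lia.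
by rewrite !cell_anc e.
Qed.

Lemma step_measurable k G : step k G -> measurable_fun setT G.
Proof.
move=> hG _ B mB; rewrite setTI.
have -> : G @^-1` B = \bigcup_(j : N.-tuple int)
    (if G (corner (- k%:Z, j)) \in B then cube (- k%:Z, j) else set0).
  apply/seteqP; split => [x Bx|x [j _]].
    exists (cell_of (- k%:Z) x) => //; rewrite mem_set; first exact: cube_cell.
    by rewrite (hG _ x)//; have /cubeP := cube_corner (R := R) (- k%:Z, cell_of (- k%:Z) x).
  case: ifPn => //; rewrite inE => Bj /cubeP /= xj.
  by rewrite /= (hG x (corner (- k%:Z, j)))// xj; have /cubeP := cube_corner (R := R) (- k%:Z, j).
apply: countable_bigcupT_measurable => // j.
by case: ifP => _ //; exact: measurable_cube.
Qed.

Section Approx.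
Variable w : X -> R.
Hypotheses (hw : weight w) (iw : Li w).

Lemma Lw_bounded f (K : R) : measurable_fun setT f -> (forall x, `|f x| <= K) -> Lw w f.
Proof.
move=> mf fK; have K0 : 0 <= K by apply: le_trans (normr_ge0 _) (fK (corner (0, [tuple 0 | _ < N]))).
split => //; apply: Li_le (LiZ (K ^+ 2) iw).
  by do 2?apply: measurable_funM => //; exact: hw.1.
move=> x; rewrite ger0_norm; last exact: (w_sqr_ge0 hw f).
rewrite mulrC mulrCA [X in _ <= X]mulrC; apply: ler_wpM2l; first exact: hw.2.
by rewrite -expr2 -(real_normK (num_real (f x))) ler_pXn2r ?nnegrE.
Qed.

Lemma Lw_indic A : measurable A -> Lw w \1_A.
Proof.
move=> mA; apply: (@Lw_bounded _ 1) => // x.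
by rewrite indicE; case: (_ \in _); rewrite /= ?normr1 ?normr0.
Qed.

Lemma nw_subrr f : nw w (fun x => f x - f x) = 0.
Proof.
rewrite /nw /nw /ipw (_ : J _ = 0) ?sqrtr0// -[RHS](J0 mu).
by apply: eqJ => x; rewrite subrr mulr0.
Qed.

Definition step_approx f := forall e, 0 < e -> exists k G,
  [/\ step k G, Lw w G & nw w (fun x => f x - G x) <= e].

Lemma step_approx_lim (F : nat -> X -> R) f : Lw w f -> (forall n, Lw w (F n)) ->
  nw w (fun x => f x - F n x) @[n --> \oo] --> 0 -> (forall n, step_approx (F n)) ->
  step_approx f.
Proof.
move=> hf hF cF aF e e0.
move/cvgr0Pnorm_le : cF => /(_ (e / 2)); rewrite divr_gt0// => /(_ isT) [n _ /(_ n (leqnn n))/= hn].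
have [k [G [sG hG GF]]] := aF n (e / 2) (divr_gt0 e0 (@ltr0Sn R 1)).
exists k, G; split => //.
have -> : (fun x => f x - G x) = (fun x => (f x - F n x) + (F n x - G x)).
  by apply/funext => x; ring.
apply: le_trans (nwD hw (LwB hw hf (hF n)) (LwB hw (hF n) hG)) _.
rewrite [X in _ <= X](splitr e); apply: lerD => //.
exact: le_trans (ler_norm _) hn.
Qed.

Lemma step_approxD f g : Lw w f -> Lw w g -> step_approx f -> step_approx g ->
  step_approx (fun x => f x + g x).
Proof.
move=> hf hg af ag e e0.
have [k [G [sG hG Ge]]] := af _ (divr_gt0 e0 (@ltr0Sn R 1)).
have [l [H [sH hH He]]] := ag _ (divr_gt0 e0 (@ltr0Sn R 1)).
exists (maxn k l), (fun x => G x + H x); split.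
- by move=> x y e1; rewrite (step_refine (leq_maxl k l) sG e1) (step_refine (leq_maxr k l) sH e1).
- exact: LwD.
- have -> : (fun x => f x + g x - (G x + H x)) = (fun x => (f x - G x) + (g x - H x)).
    by apply/funext => x; ring.
  apply: le_trans (nwD hw (LwB hw hf hG) (LwB hw hg hH)) _.
  by rewrite [X in _ <= X](splitr e); apply: lerD.
Qed.

Lemma step_approxZ c f : Lw w f -> step_approx f -> step_approx (fun x => c * f x).
Proof.
move=> hf af e e0; have c0 : 0 < `|c| + 1 by rewrite ltr_wpDl.
have [k [G [sG hG Ge]]] := af _ (divr_gt0 e0 c0).
exists k, (fun x => c * G x); split.
- by move=> x y e1; rewrite (sG x y).
- exact: LwZ.
- have -> : (fun x => c * f x - c * G x) = (fun x => c * (f x - G x)).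
    by apply/funext => x; ring.
  rewrite nwZ//; last exact: LwB.
  apply: le_trans (ler_wpM2l (normr_ge0 c) Ge) _.
  by rewrite mulrCA ger_pMr// ler_pdivrMr// mul1r lerDl.
Qed.

Definition approx_set A := measurable A /\ forall e, 0 < e -> exists k B,
  [/\ measurable B, step k \1_B & nw w (fun x => \1_A x - \1_B x) <= e].

Lemma approx_setC A : approx_set A -> approx_set (~` A).
Proof.
move=> [mA hA]; split; first exact: measurableC.
move=> e /hA [k [B [mB sB AB]]]; exists k, (~` B); split => //.
- exact: measurableC.
- by move=> x y /sB; rewrite !indicE !in_setC; do 2!case: (_ \in _) => //= /eqP; rewrite ?oner_eq0 // eq_sym oner_eq0.
- apply: le_trans AB; apply: nw_le => //.
  + by apply: LwB => //; apply: Lw_indic => //; exact: measurableC.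
  + by apply: LwB => //; exact: Lw_indic.
  + move=> x; rewrite !indicE !in_setC; do 2!case: (_ \in _) => //=; rewrite ?subrr ?subr0 ?sub0r ?normrN//.
Qed.

Lemma approx_setU A B : approx_set A -> approx_set B -> approx_set (A `|` B).
Proof.
move=> [mA hA] [mB hB]; split; first exact: measurableU.
move=> e e0.
have [k [A' [mA' sA' AA]]] := hA _ (divr_gt0 e0 (@ltr0Sn R 1)).
have [l [B' [mB' sB' BB]]] := hB _ (divr_gt0 e0 (@ltr0Sn R 1)).
have mU := measurableU _ _ mA mB; have mU' := measurableU _ _ mA' mB'.
exists (maxn k l), (A' `|` B'); split => //.
- move=> x y e1; have := step_refine (leq_maxl k l) sA' e1; have := step_refine (leq_maxr k l) sB' e1.
  rewrite !indicE !in_setU; do 4!case: (_ \in _) => //=; move=> /eqP; rewrite ?oner_eq0// ?[0 == 1]eq_sym ?oner_eq0// => _ /eqP;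
   by rewrite ?oner_eq0// ?[0 == 1]eq_sym ?oner_eq0.
- pose a x : R := `|\1_A x - \1_A' x|; pose b x : R := `|\1_B x - \1_B' x|.
  have la : Lw w (fun x => \1_A x - \1_A' x) by apply: LwB => //; exact: Lw_indic.
  have lb : Lw w (fun x => \1_B x - \1_B' x) by apply: LwB => //; exact: Lw_indic.
  have ha : Lw w a.
    apply: Lw_le (la) => // [|x]; last by rewrite normr_id.
    by apply: measurableT_comp => //; case: la.
  have hb : Lw w b.
    apply: Lw_le (lb) => // [|x]; last by rewrite normr_id.
    by apply: measurableT_comp => //; case: lb.
  apply: (@le_trans _ _ (nw w (fun x => a x + b x))).
    apply: nw_le => //; [by apply: LwB => //; exact: Lw_indic|exact: LwD|].
    move=> x; rewrite [X in _ <= X]ger0_norm; last by rewrite /a /b addr_ge0.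
    rewrite /a /b !indicE !in_setU.
    by do 4!case: (_ \in _) => //=; rewrite ?subrr ?subr0 ?sub0r ?normrN ?normr1 ?normr0 ?addr0 ?add0r ?lerDl ?ler0n.
  apply: le_trans (nwD hw ha hb) _; rewrite [X in _ <= X](splitr e); apply: lerD.
    by apply: le_trans AA; apply: nw_le => // x; rewrite normr_id.
  by apply: le_trans BB; apply: nw_le => // x; rewrite normr_id.
Qed.

Lemma approx_set0 : approx_set set0.
Proof.
split=> // e e0; exists 0%N, set0; split => //.
by rewrite nw_subrr ltW.
Qed.

Lemma approx_setlim (F : nat -> set X) A : (forall n, approx_set (F n)) ->
  (forall n m, (n <= m)%N -> F n `<=` F m) -> A = \bigcup_n F n -> approx_set A.
Proof.
move=> hF nF AE.
have mF n : measurable (F n) by case: (hF n).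
have mA : measurable A by rewrite AE; exact: bigcupT_measurable.
split => // e e0.
pose B n := F n `|` ~` A.
have mB n : measurable (B n) by apply: measurableU => //; exact: measurableC.
have nB x : \forall n \near \oo, B n x.
  have [|nA] := pselect (A x).
    rewrite {1}AE => -[n _ Fx]; exists n => // m /= nm; left; exact: nF Fx.
  by apply: nearW => n; right.
have := cut_cvg hw mB nB (Lw_indic mA).
move=> /cvgr0Pnorm_le /(_ (e / 2)); rewrite divr_gt0// => /(_ isT) [n _ /(_ n (leqnn n))/= hn].
have [k [S [mS sS FS]]] := (hF n).2 _ (divr_gt0 e0 (@ltr0Sn R 1)).
exists k, S; split => //.
have -> : (fun x => \1_A x - \1_S x) = (fun x => (\1_A x - \1_(B n) x * \1_A x) + (\1_(F n) x - \1_S x)) :> (X -> R).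
  apply/funext => x; suff -> : \1_(B n) x * \1_A x = \1_(F n) x :> R by ring.
  have BE : (x \in B n) = (x \in F n) || (x \notin A) by rewrite in_setU in_setC.
  rewrite !indicE BE; have [Ax|nAx] := boolP (x \in A).
    by rewrite orbF mulr1.
  rewrite mulr0 memNset// => Fx; move/negP: nAx; apply; apply/mem_set.
  by rewrite AE; exists n.
apply: le_trans (nwD hw _ _) _.
- by apply: LwB => //; [exact: Lw_indic|apply: Lw_ind => //; exact: Lw_indic].
- by apply: LwB => //; exact: Lw_indic.
rewrite [X in _ <= X](splitr e); apply: lerD => //.
exact: le_trans (ler_norm _) hn.
Qed.

Lemma approx_bigcup (F : nat -> set X) : (forall n, approx_set (F n)) ->
  approx_set (\bigcup_n F n).
Proof.
move=> hF; apply: (@approx_setlim (fun n => \big[setU/set0]_(i < n.+1) F i)).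
- by move=> n; apply: big_ind => //; [exact: approx_set0|exact: approx_setU].
- by move=> n m nm; apply: subset_bigsetU; rewrite ltnS.
- by rewrite bigcup_bigsetU_bigcup.
Qed.

(** The approximable sets form a sigma-algebra, and an open half-space is the
    increasing union of the unions of dyadic cubes inside it. *)
Lemma approx_set_measurable A : measurable A -> approx_set A.
Proof.
apply: tuple_measurable_ind.
  split; first exact: approx_set0.
  - by move=> B hB; rewrite setTD; exact: approx_setC.
  - exact: approx_bigcup.
move=> i c.
pose F k : set X := [set x | (tnth (cell_of (- k%:Z) x) i + 1)%:~R * 2 ^ (- k%:Z) < c].
have sF k : step k \1_(F k).
  by move=> x y e; rewrite !indicE; congr (_%:R); congr nat_of_bool; apply/idP/idP;
    rewrite !inE /F /= e.
have mF k : measurable (F k).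
  have -> : F k = \1_(F k) @^-1` [set (1 : R)].
    apply/seteqP; split => x /=; rewrite indicE.
      by move=> Fx; rewrite mem_set.
    by case: (boolP (x \in F k)) => [/set_mem//|_ /eqP]; rewrite eq_sym oner_eq0.
  by rewrite -[X in measurable X]setTI; apply: (step_measurable (sF k)).
have -> : [set x : X | tnth x i < c] = \bigcup_k F k.
  apply/seteqP; split => x /=; last first.
    move=> [k _]; apply: lt_trans.
    by rewrite tnth_mktuple -ltr_pdivrMr ?pow2_gt0// floorD1_gt.
  move=> xc; pose k := (Num.truncn ((c - tnth x i)^-1)).+1.
  have cx : 0 < c - tnth x i by rewrite subr_gt0.
  exists k => //; rewrite /F /= tnth_mktuple.
  have h : (2 : R) ^ (- k%:Z) < c - tnth x i.
    rewrite -invr_expz invf_plt ?posrE ?exprz_gt0//.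
    apply: lt_le_trans (truncnS_gt _) _; rewrite -exprnP -natrX ler_nat.
    by apply: ltnW; apply: ltn_expl.
  rewrite intrD mulrDl mul1r.
  have := floor_le (tnth x i / 2 ^ (- k%:Z)); rewrite ler_pdivlMr ?pow2_gt0//.
  lra.
apply: approx_bigcup => k; split => // e e0; exists k, (F k); split => //.
by rewrite nw_subrr ltW.
Qed.

Lemma step_approx_indic A : measurable A -> step_approx \1_A.
Proof.
move=> mA e e0; have [_ /(_ e e0)[k [B [mB sB AB]]]] := approx_set_measurable mA.
by exists k, \1_B; split => //; exact: Lw_indic.
Qed.

Lemma step_approx_sum (I : finType) (F : I -> X -> R) : (forall i, Lw w (F i)) ->
  (forall i, step_approx (F i)) -> step_approx (fun x => \sum_i F i x).
Proof.
move=> hF aF; suff : forall s : seq I, step_approx (fun x => \sum_(i <- s) F i x) /\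
   Lw w (fun x => \sum_(i <- s) F i x) by move=> /(_ (index_enum I))[].
elim=> [|i s [ih1 ih2]].
  have -> : (fun x => \sum_(i <- [::]) F i x) = (fun=> 0).
    by apply/funext => x; rewrite big_nil.
  split; last exact: Lw0.
  move=> e e0; exists 0%N, (fun=> 0); split => //; first exact: Lw0.
  by rewrite (nw_subrr (fun=> 0)) ltW.
have -> : (fun x => \sum_(j <- i :: s) F j x) = (fun x => F i x + \sum_(j <- s) F j x).
  by apply/funext => x; rewrite big_cons.
by split; [exact: step_approxD|exact: LwD].
Qed.

(** Rounding the values down to multiples of 1/(m+1) leaves finitely many
    values and a uniformly small error. *)
Lemma step_approx_bounded f (M : nat) : measurable_fun setT f -> (forall x, `|f x| <= M%:R) ->
  step_approx f.
Proof.
move=> mf fM.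
have hf : Lw w f by exact: Lw_bounded fM.
pose F (m : nat) x : R := (Num.floor (m.+1%:R * f x))%:~R / m.+1%:R.
have Ff m x : `|f x - F m x| <= m.+1%:R^-1.
  have m0 : 0 < (m.+1%:R : R) by rewrite ltr0n.
  have := floor_itv (m.+1%:R * f x); rewrite -/(F m x) => /andP[h1 h2].
  rewrite ler_norml /F; apply/andP; split; last first.
    rewrite -(ler_pM2l m0) mulrBr mulrCA divff ?gt_eqF// mulr1.
    by move: h2; rewrite intrD; lra.
  rewrite -(ler_pM2l m0) mulrBr mulrN mulrCA !divff ?gt_eqF// mulr1.
  by move: h1; lra.
pose A (m : nat) (j : 'I_(2 * M * m.+1).+1) : set X :=
  [set x | Num.floor (m.+1%:R * f x) = j%:Z - (M * m.+1)%N%:Z].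
have mA m j : measurable (A m j).
  have -> : A m j = (fun x => m.+1%:R * f x) @^-1` `[(j%:Z - (M * m.+1)%N%:Z)%:~R, (j%:Z - (M * m.+1)%N%:Z + 1)%:~R[.
    apply/seteqP; split => x /=; rewrite in_itv/=.
      by move=> <-; exact: floor_itv.
    exact: floor_def.
  have mg : measurable_fun setT (fun x => m.+1%:R * f x) by exact: measurable_funM.
  by rewrite -[X in measurable X]setTI; apply: mg => //; exact: measurable_itv.
have FE m : F m = (fun x => \sum_(j < (2 * M * m.+1).+1) ((j%:Z - (M * m.+1)%N%:Z)%:~R / m.+1%:R) * \1_(A m j) x).
  apply/funext => x.
  have m0 : 0 < (m.+1%:R : R) by rewrite ltr0n.
  have /andP[h1 h2] : - (M * m.+1)%N%:Z <= Num.floor (m.+1%:R * f x) <= (M * m.+1)%N%:Z.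
    have := fM x; rewrite ler_norml => /andP[h1 h2].
    have e : ((M * m.+1)%N%:Z)%:~R = m.+1%:R * M%:R :> R by rewrite -pmulrn natrM mulrC.
    rewrite floor_ge_int -ltzD1 floor_lt_int intrD intrN e; apply/andP; split.
      by rewrite -mulrN ler_pM2l.
    by apply: le_lt_trans (_ : m.+1%:R * M%:R < _); [rewrite ler_pM2l|rewrite ltrDl].
  have hj : (`|(Num.floor (m.+1%:R * f x) + (M * m.+1)%N%:Z)%R| < (2 * M * m.+1).+1)%N.
    by move: h1 h2; rewrite -mulnA mul2n -addnn; set a := (M * m.+1)%N; lia.
  rewrite (bigD1 (Ordinal hj))//= indicE mem_set; last by rewrite /A /=; lia.
  rewrite mulr1 big1 ?addr0 => [|j /eqP jn]; last first.
    rewrite indicE memNset ?mulr0// => Aj; apply: jn; apply: val_inj => /=.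
    by move: Aj; rewrite /A /= => ->; lia.
  by rewrite /F; congr (_%:~R / _); lia.
have hF m : Lw w (F m).
  by rewrite FE; apply: Lw_sum => // j; apply: LwZ => //; exact: Lw_indic.
apply: (@step_approx_lim F) => //.
- have n1 : Lw w (fun=> 1) by apply: (@Lw_bounded _ 1) => // x; rewrite normr1.
  apply: (@squeeze_cvgr _ _ _ _ (fun=> 0) (fun m => m.+1%:R^-1 * nw w (fun=> 1))).
  + apply: nearW => m; rewrite nw_ge0/=.
    have m0 : 0 <= (m.+1%:R^-1 : R) by rewrite invr_ge0.
    rewrite -[X in X * _]ger0_norm// -nwZ//; apply: nw_le => //; [exact: LwB|exact: LwZ|].
    by move=> x; rewrite mulr1 [X in _ <= X]ger0_norm.
  + exact: cvg_cst.
  + rewrite -[X in _ --> X](mul0r (nw w (fun=> 1))); apply: cvgMl.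
    exact: cvg_harmonic.
- by move=> m; rewrite FE; apply: step_approx_sum => j;
    [apply: LwZ => //; exact: Lw_indic|apply: step_approxZ; [exact: Lw_indic|exact: step_approx_indic]].
Qed.

(** Truncation reduces the claim to bounded functions. *)
Theorem steps_dense f : Lw w f -> step_approx f.
Proof.
move=> hf; have [mf _] := hf.
pose B k := [set x | `|f x| <= k%:R].
have mB k : measurable (B k).
  have -> : B k = (fun x => `|f x|) @^-1` `]-oo, k%:R].
    by apply/seteqP; split => x /=; rewrite in_itv.
  rewrite -[X in measurable X]setTI; apply: measurableT_comp => //.
have nB x : \forall k \near \oo, B k x.
  exists (Num.truncn `|f x|).+1 => // k /= h.
  by apply: ltW; apply: lt_le_trans (truncnS_gt _) _; rewrite ler_nat.
have hk k : Lw w (fun x => \1_(B k) x * f x) by exact: Lw_ind.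
apply: (step_approx_lim hf hk (cut_cvg hw mB nB hf)) => k.
apply: (@step_approx_bounded _ k); first by case: (hk k).
move=> x; rewrite indicE; case: (boolP (x \in B k)) => [/set_mem h|_]; last by rewrite mul0r normr0.
by rewrite mul1r.
Qed.

End Approx.

Lemma ae_countable (T : countType) (F : T -> X -> Prop) :
  (forall j, {ae mu, forall x, F j x}) -> {ae mu, forall x j, F j x}.
Proof.
move=> h.
have : {ae mu, forall x n, if (unpickle n : option T) is Some j then F j x else True}.
  apply: ae_foralln => n; case: (unpickle n) => [j|]; first exact: h.
  exact: aeW.
by apply: filterS => x hx j; have := hx (pickle j); rewrite pickleK.
Qed.

(** A one-sided differentiation theorem without maximal functions. The set
    A' of points of A where phi > 0 is approximated in L^2(|phi|) by a union S
    of small cubes. The cubes of S that meet A carry a nonpositive integral of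
    phi, so the integral of phi over A' is at most the error of approximation,
    and is therefore zero. *)
Lemma differentiation_le (phi : X -> R) A (l0 : int) : measurable_fun setT phi -> measurable A ->
  (forall P, Li (fun x => \1_(cube P) x * phi x)) ->
  (forall P, P.1 <= l0 -> (exists x, A x /\ cube P x) -> J (fun x => \1_(cube P) x * phi x) <= 0) ->
  {ae mu, forall x, A x -> phi x <= 0}.
Proof.
move=> mphi mA iphi hphi.
suff h : forall j : N.-tuple int, {ae mu, forall x, cube (l0, j) x -> A x -> phi x <= 0}.
  have := ae_countable h; apply: filterS => x hx Ax; apply: (hx (cell_of l0 x)) => //.
  exact: cube_cell.
move=> j; set B := (l0, j) : dyadic N.
have mB : measurable (cube B) by exact: measurable_cube.
pose W x := \1_(cube B) x * `|phi x|.
have hW : weight W.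
  apply: weight_ind => //; split => //; exact: measurableT_comp.
have iW : Li W.
  have -> : W = (fun x => `|\1_(cube B) x * phi x|).
    apply/funext => x; rewrite /W normrM; congr (_ * _).
    by rewrite ger0_norm// indicE ler0n.
  exact: Li_norm.
pose A' := A `&` cube B `&` [set x | 0 < phi x].
have mA' : measurable A'.
  apply: measurableI; first exact: measurableI.
  have -> : [set x | 0 < phi x] = phi @^-1` `]0, +oo[.
    by apply/seteqP; split => x /=; rewrite in_itv/= andbT.
  by rewrite -[X in measurable X]setTI; apply: mphi.
have iA' : Li (fun x => \1_A' x * phi x).
  apply: Li_le iW; first exact: measurable_funM.
  move=> x; rewrite normrM /W ger0_norm//; apply: ler_wpM2r => //.
  rewrite !indicE ler_nat /A' !in_setI; case: (x \in A) => //=.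
  by case: (x \in cube B) => //=; case: (_ \in _).
have key e : 0 < e -> J (fun x => \1_A' x * phi x) <= e ^+ 2.
  move=> e0; have [_ /(_ e e0)[k [S [mS sS AS]]]] := approx_set_measurable hW iW mA'.
  pose k' := maxn k `|l0|%N.
  have {}sS := step_refine (leq_maxl k `|l0|%N) sS.
  pose n := `|(l0 + k'%:Z)%R|%N.
  have nE : - k'%:Z = l0 - n%:Z by rewrite /n /k'; lia.
  pose c i : R := (`[< exists y, A y /\ cube (desc n B i) y >] && (corner (desc n B i) \in S))%:R.
  pose g x := \sum_i c i * \1_(cube (desc n B i)) x.
  have gphi : (fun x => g x * phi x) = (fun x => \sum_i c i * (\1_(cube (desc n B i)) x * phi x)).
    by apply/funext => x; rewrite /g mulr_suml; apply: eq_bigr => i _; rewrite mulrA.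
  have igi i : Li (fun x => c i * (\1_(cube (desc n B i)) x * phi x)) by exact: LiZ.
  have ig : Li (fun x => g x * phi x) by rewrite gphi; exact: Li_sum.
  have g0 : J (fun x => g x * phi x) <= 0.
    rewrite gphi J_sum//; apply: sumr_le0 => i _; rewrite JZ// /c.
    case: asboolP => [h|_]; last by rewrite mul0r.
    apply: mulr_ge0_le0 => //; apply: hphi => //.
    by rewrite /= /B /=; lia.
  have LS : Lw W (fun x => \1_A' x - \1_S x) by apply: LwB => //; exact: Lw_indic.
  apply: le_trans (_ : J (fun x => g x * phi x) + ipw W (fun x => \1_A' x - \1_S x) (fun x => \1_A' x - \1_S x) <= _).
    rewrite -JD//; last exact: LS.2.
    apply: J_le => //; first by apply: LiD => //; exact: LS.2.
    move=> x; have [Bx|nBx] := pselect (cube B x); last first.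
      have -> : \1_A' x = 0 :> R by rewrite indicE memNset// => -[[]].
      rewrite mul0r /W indicE memNset// !mul0r addr0.
      rewrite /g big1 ?mul0r// => i _; rewrite indicE memNset ?mulr0// => xi.
      by apply: nBx; apply: desc_sub xi.
    have [i xi] := desc_cover n Bx.
    have -> : g x = c i.
      rewrite /g (bigD1 i)//= indicE mem_set// mulr1 big1 ?addr0// => i' i'i.
      rewrite indicE memNset ?mulr0// => xi'; move/eqP: i'i; apply.
      by apply: (@grid_inj N); apply: (cube_eq _ xi' xi).
    have Sx : \1_S x = (corner (desc n B i) \in S)%:R :> R.
      rewrite -indicE; apply: sS; rewrite nE.
      have /cubeP /= -> := xi; by have /cubeP /= -> := cube_corner (R := R) (desc n B i).
    rewrite Sx /W [\1_(cube B) x]indicE mem_set// mul1r /c.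
    have phix := ler_norm (phi x); have phix' := ler_norm (- phi x).
    rewrite normrN in phix'.
    rewrite indicE; have [/set_mem [[Ax _] _]|_] := boolP (x \in A').
      have -> : `[< exists y, A y /\ cube (desc n B i) y >] by apply/asboolP; exists x.
      by case: (_ \in S) => /=; rewrite ?mulr1n ?mulr0n; lra.
    by case: `[< _ >] => /=; case: (_ \in S) => /=; rewrite ?mulr1n ?mulr0n; lra.
  rewrite -[X in _ <= X]add0r; apply: lerD => //.
  rewrite -(sqr_nw mu hW) ler_pXn2r// nnegrE; [exact: nw_ge0|exact: ltW].
have A'0 x : 0 <= \1_A' x * phi x.
  rewrite indicE; case: (boolP (x \in A')) => [/set_mem[_ /ltW]|_]; last by rewrite mul0r.
  by rewrite mul1r.
have J0' : J (fun x => \1_A' x * phi x) = 0.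
  apply/eqP; rewrite eq_le; apply/andP; split.
    apply/ler_addgt0Pl => e e0; rewrite addr0.
    have := key (Num.sqrt e); rewrite sqrtr_gt0 => /(_ e0).
    by rewrite sqr_sqrtr; [|exact: ltW].
  exact: J_ge0.
have := J0_ae iA' A'0 J0'; apply: filterS => x + Bx Ax; have [//|phix] := leP (phi x) 0.
by rewrite indicE mem_set//= mul1r => h; rewrite h ltxx in phix.
Qed.

End Density.

(** * Disjoint families and pairs of adjoint local operators *)

Section Family.
Context {d} {X : measurableType d} {R : realType} (mu : {measure set X -> \bar R}).
Variable C : nat -> set X.
Hypotheses (mC : forall i, measurable (C i)) (tC : forall i j x, C i x -> C j x -> i = j).
Local Notation U := (\bigcup_i C i).
Implicit Types (f g : X -> R).

Let part n x : R := \sum_(i < n) \1_(C i) x.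

Let part_in n x i : C i x -> part n x = (i < n)%N%:R.
Proof.
move=> Cx; case: ltnP => h.
  rewrite /part (bigD1 (Ordinal h))//= indicE mem_set// big1 ?addr0// => j /eqP ji.
  by rewrite indicE memNset// => Cjx; apply: ji; apply: val_inj; apply: tC Cjx Cx.
rewrite /part big1// => j _; rewrite indicE memNset// => Cjx.
by have := ltn_ord j; rewrite (tC Cjx Cx) ltnNge h.
Qed.

Let part_out n x : ~ U x -> part n x = 0.
Proof.
by move=> Ux; rewrite /part big1// => i _; rewrite indicE memNset// => Cx; apply: Ux; exists i.
Qed.

Let part01 n x : part n x = 0 \/ part n x = 1.
Proof.
have [[i _ Cx]|Ux] := pselect (U x); last by left; exact: part_out.
by rewrite (part_in _ Cx); case: (i < n)%N; [right|left].
Qed.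

Let part_cvg f x : part n x * f x @[n --> \oo] --> \1_U x * f x.
Proof.
apply: cvg_near_cst; have [[i _ Cx]|Ux] := pselect (U x); last first.
  by apply: nearW => n; rewrite part_out// indicE memNset.
exists i.+1 => // n /= h; rewrite (part_in _ Cx) h indicE mem_set//; by exists i.
Qed.

Let part_sum f n : (fun x => part n x * f x) = (fun x => \sum_(i < n) \1_(C i) x * f x).
Proof. by apply/funext => x; rewrite /part mulr_suml. Qed.

(** Dominated convergence along the partial unions of the family. *)
Lemma J_family_eq0 f : Li mu f -> (forall x, ~ U x -> f x = 0) ->
  (forall i, J mu (fun x => \1_(C i) x * f x) = 0) -> J mu f = 0.
Proof.
move=> hf f0 fC.
have part_Li n : Li mu (fun x => part n x * f x).
  by rewrite part_sum; apply: Li_sum => i; exact: Li_ind.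
have [] := @J_dct _ _ _ mu (fun n x => part n x * f x) (fun x => \1_U x * f x) (fun x => `|f x|).
- by move=> n; exact: Li_meas.
- exact: part_cvg.
- exact: Li_norm.
- by move=> n x; rewrite normrM; case: (part01 n x) => ->; rewrite ?normr0 ?normr1 ?mul0r ?mul1r.
have -> : (fun x => \1_U x * f x) = f.
  apply/funext => x; have [Ux|Ux] := pselect (U x); last by rewrite f0// mulr0.
  by rewrite indicE mem_set// mul1r.
move=> _; have -> : (fun n => J mu (fun x => part n x * f x)) = (fun=> 0).
  by apply/funext => n; rewrite part_sum J_sum ?big1// => i; exact: Li_ind.
move=> h; have := cvg_lim (@Rhausdorff R) h; by rewrite lim_cst// => <-.
Qed.

Lemma J_family_sum_le f n : Li mu f -> (forall x, 0 <= f x) ->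
  \sum_(i < n) J mu (fun x => \1_(C i) x * f x) <= J mu f.
Proof.
move=> hf f0; rewrite -J_sum; last by move=> i; exact: Li_ind.
rewrite -part_sum; apply: J_le => //.
  by rewrite part_sum; apply: Li_sum => i; exact: Li_ind.
by move=> x; case: (part01 n x) => ->; rewrite ?mul0r ?mul1r.
Qed.

(** Fatou's lemma along the partial unions; this also yields the integrability
    of f, which is only given on each member of the family. *)
Lemma J_family_le f g : measurable_fun setT f -> (forall x, 0 <= f x) -> (forall x, 0 <= g x) ->
  Li mu g ->
  (forall i, Li mu (fun x => \1_(C i) x * f x)) ->
  (forall i, J mu (fun x => \1_(C i) x * f x) <= J mu (fun x => \1_(C i) x * g x)) ->
  {ae mu, forall x, ~ U x -> f x <= g x} -> Li mu f /\ J mu f <= J mu g.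
Proof.
move=> mf f0 g0 hg fC fgC fgU.
have mU : measurable U by exact: bigcupT_measurable.
pose f' x := \1_(~` U) x * Num.min (f x) (g x).
have mg := Li_meas hg.
have mf' : measurable_fun setT f'.
  apply: measurable_funM; last exact: measurable_minr.
  by apply: measurable_indic; exact: measurableC.
have f'0 x : 0 <= f' x by rewrite mulr_ge0 ?indicE// le_min f0 g0.
have hf' : Li mu f'.
  apply: Li_le hg => // x; rewrite ger0_norm// /f' indicE.
  by case: (_ \in _); rewrite ?mul0r// mul1r ge_min lexx orbT.
pose F n x := part n x * f x + f' x.
have part0 n x : 0 <= part n x by case: (part01 n x) => ->.
have hF n : Li mu (F n) by apply: LiD => //; rewrite part_sum; exact: Li_sum.
have hFg n : J mu (F n) <= J mu g.
  apply: (@le_trans _ _ (J mu (fun x => part n x * g x) + J mu (fun x => \1_(~` U) x * g x))).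
    rewrite /F JD//; last by rewrite part_sum; exact: Li_sum.
    apply: lerD.
      rewrite !part_sum !J_sum//; first by apply: ler_sum.
      by move=> i; exact: Li_ind.
    apply: J_le => //; first by apply: Li_ind => //; exact: measurableC.
    by move=> x; apply: ler_wpM2l; rewrite ?indicE// ge_min lexx orbT.
  rewrite -JD; last 2 first.
  - by rewrite part_sum; apply: Li_sum => i; exact: Li_ind.
  - by apply: Li_ind => //; exact: measurableC.
  apply: J_le => //.
    apply: LiD; first by rewrite part_sum; apply: Li_sum => i; exact: Li_ind.
    by apply: Li_ind => //; exact: measurableC.
  move=> x; have [Ux|Ux] := pselect (U x).
    have -> : \1_(~` U) x = 0 :> R by rewrite indicE memNset.
    rewrite mul0r addr0; case: (part01 n x) => ->; by rewrite ?mul0r ?mul1r ?g0.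
  by rewrite part_out// mul0r add0r indicE mem_set// mul1r.
have cF x : F n x @[n --> \oo] --> \1_U x * f x + f' x.
  by apply: cvgD; [exact: part_cvg|exact: cvg_cst].
have [hl hJ] := @J_fatou _ _ _ mu F (fun x => \1_U x * f x + f' x) (J mu g) hF
   (fun n x => addr_ge0 (mulr_ge0 (part0 n x) (f0 x)) (f'0 x))
   cF hFg.
have e : {ae mu, forall x, \1_U x * f x + f' x = f x}.
  move: fgU; apply: filterS => x h; have [Ux|Ux] := pselect (U x).
    rewrite /f' !indicE mem_set// memNset ?mul0r ?addr0 ?mul1r//; by move=> k; exact: k.
  rewrite /f' !indicE memNset// mem_set// mul0r add0r mul1r.
  by apply/min_idPl; exact: h.
split; first exact: Li_ae hl.
by rewrite -(J_ae (Li_meas hl) mf e).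
Qed.

End Family.

Section LocalPair.
Context {R : realType} {N : nat}.
Local Notation X := (Rn R N).
Local Notation mu := (Defs.lebesgue_measureN R N).
Local Notation cube := (@Defs.cube R N).
Local Notation Li := (Li mu).
Local Notation J := (J mu).
Local Notation L2r := (Lw mu (fun=> 1)).
Local Notation nr := (nw mu (fun=> 1)).
Local Notation ip := (ipw mu (fun=> 1)).
Implicit Types (P Q : dyadic N) (x y : X) (f g h : X -> R).

Let w1 : weight (fun _ : X => 1 : R) := weight1.

Lemma ipE f g : ip f g = J (fun x => f x * g x).
Proof. by apply: eqJ => x; rewrite mul1r. Qed.

Lemma L2_Li_mul f g : L2r f -> L2r g -> Li (fun x => f x * g x).
Proof.
move=> hf hg; have := Lw_mul w1 hf hg.
by have -> : (fun x => 1 * f x * g x) = (fun x => f x * g x) by apply/funext => x; rewrite mul1r.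
Qed.

Lemma Li_cube P : Li \1_(cube P).
Proof.
have mP := @measurable_cube R N P.
apply: Li_ge0; [exact: measurable_indic|by move=> x; rewrite indicE|].
by rewrite integral_indic// setIT [X in (X < _)%E](mu_cube P) ltry.
Qed.

Lemma L2_ind P : L2r \1_(cube P).
Proof.
split; first by apply: measurable_indic; exact: measurable_cube.
have -> : (fun x => 1 * \1_(cube P) x * \1_(cube P) x) = \1_(cube P) :> (X -> R).
  by apply/funext => x; rewrite mul1r indicE; case: (_ \in _); rewrite ?mulr1 ?mulr0.
exact: Li_cube.
Qed.

Lemma J_ind P : J \1_(cube P) = vol P.
Proof.
have mP := @measurable_cube R N P.
by rewrite /J /Rintegral integral_indic// setIT [X in fine X](mu_cube P).
Qed.

Lemma ip_ind f P : ip f \1_(cube P) = J (fun x => \1_(cube P) x * f x).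
Proof. by rewrite ipE; apply: eqJ => x; rewrite mulrC. Qed.

Lemma ind_idem P x : \1_(cube P) x * \1_(cube P) x = \1_(cube P) x :> R.
Proof. by rewrite indicE; case: (_ \in _); rewrite ?mulr1 ?mulr0. Qed.

Lemma nr_ind P : nr \1_(cube P) = Num.sqrt (vol P).
Proof. by rewrite /nw /nw ip_ind; congr Num.sqrt; rewrite -J_ind; apply: eqJ => x; rewrite ind_idem. Qed.

Lemma L2_ind_mul f (A : set X) : measurable A -> L2r f -> L2r (fun x => \1_A x * f x).
Proof. exact: Lw_ind. Qed.

Lemma L2_Li_cube f P : L2r f -> Li (fun x => \1_(cube P) x * f x).
Proof. by move=> hf; exact: L2_Li_mul (L2_ind P) hf. Qed.

Lemma ae0_of_ip f : L2r f -> ip f f = 0 -> {ae mu, forall x, f x = 0}.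
Proof.
move=> hf; rewrite ipE => h; have := J0_ae (L2_Li_mul hf hf) _ h.
move=> /(_ (fun x => sqr_ge0 (f x))); apply: filterS => x /eqP.
by rewrite mulf_eq0 orbb => /eqP.
Qed.

(** The children of Q are the cubes with first ancestor Q, which agrees with
    [is_child] by [is_childP] and is easier to compute with. *)
Record real_haar Q h : Prop := {
  rhaar_supp : forall x, ~ cube Q x -> h x = 0;
  rhaar_child : forall P, anc 1 P = Q -> forall x y, cube P x -> cube P y -> h x = h y;
  rhaar_mean : J h = 0 }.

(** What is used of a band operator and its adjoint on real functions.
    Linearity, almost everywhere, follows from the adjoint relation
    ([lp_add], [lp_scale]). In [lp_haar] one of the cubes is not inside the r-th
    ancestor of the other, so that their tree distance exceeds r. *)
Record local_pair (r : nat) (B : R) (S S' : (X -> R) -> X -> R) : Prop := {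
  lp_B : 0 <= B;
  lp_mem : forall f, L2r f -> L2r (S f);
  lp_mem' : forall f, L2r f -> L2r (S' f);
  lp_adj : forall f g, L2r f -> L2r g -> ip (S f) g = ip f (S' g);
  lp_bd : forall f, L2r f -> nr (S f) <= B * nr f;
  lp_haar : forall P Q h k, real_haar P h -> real_haar Q k ->
    ~ (cube P `<=` cube (anc r Q)) \/ ~ (cube Q `<=` cube (anc r P)) -> ip (S h) k = 0 }.

Lemma haar_desc Q h : real_haar Q h ->
  h = (fun x => \sum_i h (corner (desc 1 Q i)) * \1_(cube (desc 1 Q i)) x).
Proof.
move=> hh; apply/funext => x; have [Qx|nQx] := pselect (cube Q x); last first.
  rewrite (rhaar_supp hh nQx) big1// => i _; rewrite indicE memNset ?mulr0// => xi.
  by apply: nQx; exact: desc_sub xi.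
have [i xi] := desc_cover 1 Qx.
have e : h x = h (corner (desc 1 Q i)).
  exact: (rhaar_child hh (@anc_desc N 1 Q i) xi (cube_corner (desc 1 Q i))).
rewrite (bigD1 i)//= indicE mem_set// mulr1 big1 ?addr0//.
move=> i' i'i; rewrite indicE memNset ?mulr0// => xi'; move/eqP: i'i; apply.
by apply: (@grid_inj N); apply: (cube_eq _ xi' xi).
Qed.

Lemma L2_haar Q h : real_haar Q h -> L2r h.
Proof.
by move=> hh; rewrite (haar_desc hh); apply: Lw_sum => // i; apply: LwZ => //; exact: L2_ind.
Qed.

Lemma local_pair_sym r B S S' : local_pair r B S S' -> local_pair r B S' S.
Proof.
move=> [B0 mS mS' adj bd hr]; split => //.
- by move=> f g hf hg; rewrite ipwC -adj// ipwC.
- move=> f hf; have n0 := nw_ge0 mu (fun=> 1) (S' f).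
  have [->|n0'] := eqVneq (nr (S' f)) 0; first by rewrite mulr_ge0// nw_ge0.
  have hS := mS' _ hf.
  have : nr (S' f) * nr (S' f) <= B * nr f * nr (S' f).
    rewrite -expr2 (sqr_nw mu w1) -adj//; apply: le_trans (ler_norm _) _.
    apply: le_trans (ipw_CS w1 (mS _ hS) hf) _; rewrite [X in _ <= X]mulrAC.
    by apply: ler_wpM2r; [exact: nw_ge0|exact: bd].
  by rewrite ler_pM2r// lt_def n0'.
- move=> P Q h k hP hQ far; have hh := L2_haar hP; have hk := L2_haar hQ.
  rewrite ipwC -adj//; apply: (hr Q P) => //; by case: far; [right|left].
Qed.

Lemma parent_vol Q : vol (R := R) (anc 1 Q) = 2 ^+ N * vol Q.
Proof. by rewrite vol_anc expr1. Qed.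

(** These Haar functions compare the average over a cube with that over its
    parent; these comparisons are the only use made of the Haar system. *)
Lemma haar_parent Q : real_haar (anc 1 Q)
  (fun x => \1_(cube Q) x - (2 ^+ N)^-1 * \1_(cube (anc 1 Q)) x).
Proof.
split.
- move=> x nx; rewrite !indicE !memNset ?mulr0 ?subrr// => Qx; apply: nx; exact: cube_anc.
- move=> P PQ x y Px Py; have Pa z : cube P z -> cube (anc 1 Q) z by rewrite -PQ; exact: cube_anc.
  rewrite !indicE (mem_set (Pa _ Px)) (mem_set (Pa _ Py)); congr (_%:R - _).
  have P1 : P.1 = Q.1 by move: (congr1 fst PQ) => /=; lia.
  congr nat_of_bool; apply/idP/idP => /set_mem h; apply/mem_set.
    by rewrite -(cube_eq P1 Px h).
  by rewrite -(cube_eq P1 Py h).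
- rewrite JB; last 2 first.
  + exact: Li_cube.
  + by apply: LiZ; exact: Li_cube.
  rewrite JZ; last exact: Li_cube.
  by rewrite !J_ind parent_vol mulKf ?subrr// gt_eqF// exprn_gt0.
Qed.

Section OnePair.
Variables (r : nat) (B : R) (S S' : (X -> R) -> X -> R).
Hypothesis lp : local_pair r B S S'.
Hypothesis N0 : (0 < N)%N.

(** The difference of the two sides is orthogonal to every function, in
    particular to itself. *)
Lemma lp_ae_eq f g h : L2r f -> L2r g -> L2r h -> (forall k, L2r k -> ip h k = ip f (S' k) + ip g (S' k)) ->
  {ae mu, forall x, h x = S f x + S g x}.
Proof.
move=> hf hg hh e; have mf := lp_mem lp hf; have mg := lp_mem lp hg.
have mfg := LwD w1 mf mg.
have hD : L2r (fun x => h x - (S f x + S g x)) by exact: LwB.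
have : ip (fun x => h x - (S f x + S g x)) (fun x => h x - (S f x + S g x)) = 0.
  by rewrite {1}ipwBl// ipwDl// e// !(lp_adj lp)// subrr.
move=> /(ae0_of_ip hD); apply: filterS => x /eqP; by rewrite subr_eq0 => /eqP.
Qed.

Lemma lp_add f g : L2r f -> L2r g -> {ae mu, forall x, S (fun y => f y + g y) x = S f x + S g x}.
Proof.
move=> hf hg; have hfg := LwD w1 hf hg; apply: lp_ae_eq => //; first exact: (lp_mem lp).
move=> k hk; rewrite (lp_adj lp)// ipwDl//; exact: (lp_mem' lp).
Qed.

Lemma lp_scale c f : L2r f -> {ae mu, forall x, S (fun y => c * f y) x = c * S f x}.
Proof.
move=> hf; have hcf := LwZ c hf; have mf := lp_mem lp hf; have mcf := lp_mem lp hcf.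
have mf' := LwZ c mf.
have hD : L2r (fun x => S (fun y => c * f y) x - c * S f x) by exact: LwB.
have : ip (fun x => S (fun y => c * f y) x - c * S f x) (fun x => S (fun y => c * f y) x - c * S f x) = 0.
  have mD := lp_mem' lp hD.
  by rewrite {1}ipwBl// ipwZl// !(lp_adj lp)// ipwZl// subrr.
move=> /(ae0_of_ip hD); apply: filterS => x /eqP; by rewrite subr_eq0 => /eqP.
Qed.

Lemma lp_sub f g : L2r f -> L2r g -> {ae mu, forall x, S (fun y => f y - g y) x = S f x - S g x}.
Proof.
move=> hf hg.
have := lp_add hf (LwZ (-1) hg); have := lp_scale (-1) hg; apply: filterS2 => x e1 e2.
rewrite -mulN1r -e1 -e2; congr (S _ x); apply/funext => y; by rewrite mulN1r.
Qed.

End OnePair.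
End LocalPair.

(** * Images of functions of mean zero *)

Section Off.
Context {R : realType} {N : nat}.
Local Notation X := (Rn R N).
Local Notation mu := (Defs.lebesgue_measureN R N).
Local Notation cube := (@Defs.cube R N).
Local Notation Li := (Li mu).
Local Notation J := (J mu).
Local Notation L2r := (Lw mu (fun=> 1)).
Local Notation nr := (nw mu (fun=> 1)).
Local Notation ip := (ipw mu (fun=> 1)).
Implicit Types (P Q : dyadic N) (x y : X) (f g h : X -> R).
Let w1 : weight (fun _ : X => 1 : R) := weight1.

Lemma measurable_opp f : measurable_fun setT f -> measurable_fun setT (fun x => - f x).
Proof.
move=> mf; have -> : (fun x => - f x) = (fun x => -1 * f x) by apply/funext => x; rewrite mulN1r.
exact: measurable_funM.
Qed.

Variables (r : nat) (B : R) (S S' : (X -> R) -> X -> R).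
Hypothesis N0 : (0 < N)%N.

Lemma not_sub_anc P Q T : ~ (exists x, cube T x /\ cube (anc r P) x) ->
  cube Q `<=` cube P -> Q.1 <= P.1 -> ~ (cube (anc 1 T) `<=` cube (anc r Q)).
Proof.
move=> TP QP QP1 h; apply: TP; exists (corner T); split; first exact: cube_corner.
have /h : cube (anc 1 T) (corner T) by apply: cube_anc; exact: cube_corner.
have -> : anc r P = anc (`|(P.1 - Q.1)%R|%N) (anc r Q).
  by rewrite [in LHS](sub_anc QP QP1) -!ancD addnC.
exact: cube_anc.
Qed.

(** As T is disjoint from the r-th ancestor of P, none of its ancestors is inside
    the r-th ancestor of Q. Thus S h is orthogonal to the Haar functions on
    these ancestors, and its averages over T and over the M-th
    ancestor of T agree. The latter tend to zero by Cauchy--Schwarz because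
    the volumes tend to infinity. *)
Lemma haar_orth_ind (lp : local_pair r B S S') P Q T h :
  ~ (exists x, cube T x /\ cube (anc r P) x) -> cube Q `<=` cube P -> Q.1 <= P.1 ->
  real_haar Q h -> ip (S h) \1_(cube T) = 0.
Proof.
move=> TP QP QP1 hh; have L2h := L2_haar hh; have L2Sh := lp_mem lp L2h.
have st M : ip (S h) \1_(cube T) = ((2 ^+ N)^-1) ^+ M * ip (S h) \1_(cube (anc M T)).
  elim: M => [|M ->]; first by rewrite anc0 expr0 mul1r.
  rewrite exprSr -mulrA; congr (_ * _).
  have far : ~ (cube (anc 1 (anc M T)) `<=` cube (anc r Q)).
    rewrite -ancD => h1; apply: (not_sub_anc TP QP QP1).
    apply: subset_trans h1; rewrite addnC ancD; exact: cube_sub_anc.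
  have := lp_haar lp hh (haar_parent (R := R) (anc M T)) (or_intror far).
  rewrite ipwC ipwBl//; [|exact: L2_ind|by apply: LwZ; exact: L2_ind].
  rewrite ipwZl//; last exact: L2_ind.
  rewrite !(ipwC _ _ (S h)) -ancD add1n => /eqP; rewrite subr_eq0 => /eqP.
  by [].
set y := ip (S h) _.
have yM M : y ^+ 2 <= (nr (S h) ^+ 2 * vol T) * (2^-1) ^+ M.
  rewrite /y (st M).
  have := ipw_CS w1 L2Sh (L2_ind (R := R) (anc M T)); rewrite nr_ind.
  set z := ip _ _ => hz.
  have : z ^+ 2 <= nr (S h) ^+ 2 * vol (anc M T).
    rewrite -[vol _]sqr_sqrtr; last exact/ltW/vol_gt0.
    rewrite -exprMn -[z ^+ 2](real_normK (num_real _)).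
    by rewrite ler_pXn2r ?nnegrE ?mulr_ge0 ?nw_ge0 ?sqrtr_ge0.
  rewrite vol_anc => {}hz.
  rewrite exprMn -exprM.
  have p0 : 0 < (2 ^+ N : R) by rewrite exprn_gt0.
  have q0 : 0 <= ((2 ^+ N)^-1 : R) by rewrite invr_ge0 ltW.
  apply: le_trans (ler_wpM2l (exprn_ge0 _ q0) hz) _.
  have -> : ((2 ^+ N)^-1) ^+ (M * 2) * (nr (S h) ^+ 2 * ((2 ^+ N) ^+ M * vol T)) =
     (nr (S h) ^+ 2 * vol T) * ((2 ^+ N)^-1) ^+ M :> R.
    rewrite muln2 -addnn exprD.
    have e : ((2 ^+ N)^-1) ^+ M * (2 ^+ N) ^+ M = 1 :> R.
      by rewrite -exprMn mulVf ?expr1n// gt_eqF.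
    by rewrite -[RHS]mulr1 -[X in _ = _ * X]e; ring.
  apply: ler_wpM2l; first by rewrite mulr_ge0 ?sqr_ge0// ltW// vol_gt0.
  rewrite lerXn2r// ?nnegrE// ?invr_ge0// lef_pV2 ?posrE//.
  by case: N N0 => // n _; rewrite exprS ler_peMr// exprn_ege1// ler1n.
suff /eqP : y ^+ 2 = 0 by rewrite sqrf_eq0 => /eqP.
apply/eqP; rewrite eq_le sqr_ge0 andbT.
set K := nr (S h) ^+ 2 * vol T in yM.
have : K * (2^-1) ^+ M @[M --> \oo] --> 0.
  rewrite -[X in _ --> X](mulr0 K); apply: cvgMr; apply: cvg_expr.
  by rewrite ger0_norm ?invr_ge0// invf_lt1// ltr1n.
move=> c; have := cvg_lim (@Rhausdorff R) c => <-.
by apply: limr_ge; [apply/cvg_ex; exists 0|exact: nearW].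
Qed.

(** The averages of f over all subcubes of P agree, and differentiation turns
    this into a statement about values. *)
Lemma const_on P f : L2r f ->
  (forall Q h, cube Q `<=` cube P -> Q.1 <= P.1 -> real_haar Q h -> ip f h = 0) ->
  {ae mu, forall x, cube P x -> f x = J (fun y => \1_(cube P) y * f y) / vol P}.
Proof.
move=> hf orth; set a := _ / _.
have avg n : forall Q, anc n Q = P -> J (fun y => \1_(cube Q) y * f y) = a * vol Q.
  elim: n => [|n ih] Q; first by rewrite anc0 => ->; rewrite /a divfK// gt_eqF// vol_gt0.
  rewrite -addn1 ancD => e1; have h1 := ih _ e1.
  have /(congr1 fst) /= lP1 := e1.
  have sP : cube (anc 1 Q) `<=` cube P by rewrite -e1; exact: cube_sub_anc.
  have lP : (anc 1 Q).1 <= P.1 by rewrite /= -lP1; lia.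
  have := orth _ _ sP lP (haar_parent (R := R) Q).
  rewrite ipwC ipwBl//; [|exact: L2_ind|by apply: LwZ; exact: L2_ind].
  rewrite ipwZl//; last exact: L2_ind.
  rewrite !(ipwC _ _ _ f) !ip_ind h1 parent_vol => /eqP; rewrite subr_eq0 => /eqP ->.
  by field; rewrite gt_eqF// exprn_gt0.
have mf : measurable_fun setT f by case: hf.
have iP Q : Li (fun x => \1_(cube Q) x * f x) by exact: L2_Li_cube.
pose phi x := \1_(cube P) x * (f x - a).
have phiE Q : (fun x => \1_(cube Q) x * phi x) =
   (fun x => \1_(cube Q) x * (\1_(cube P) x * f x) - a * (\1_(cube Q) x * \1_(cube P) x)).
  by apply/funext => x; rewrite /phi; ring.
have iQ Q : Li (fun x => \1_(cube Q) x * (\1_(cube P) x * f x)).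
  by apply: Li_ind => //; exact: measurable_cube.
have iQ' Q : Li (fun x => \1_(cube Q) x * \1_(cube P) x).
  by apply: Li_ind; [exact: measurable_cube|exact: Li_cube].
have iphi Q : Li (fun x => \1_(cube Q) x * phi x).
  by rewrite phiE; apply: LiB => //; exact: LiZ.
have Jphi Q : Q.1 <= P.1 -> J (fun x => \1_(cube Q) x * phi x) = 0.
  move=> QP1; have [QP|QP] := pselect (exists x, cube Q x /\ cube P x); last first.
    rewrite -[RHS](J0 mu); apply: eqJ => x; rewrite /phi !indicE.
    case: (boolP (x \in cube Q)) => [/set_mem Qx|_]; last by rewrite mul0r.
    rewrite memNset ?mul0r ?mulr0// => Px; apply: QP; by exists x.
  have [x [Qx Px]] := QP.
  have sQP := cube_nested Qx Px QP1.
  have e : P = anc `|(P.1 - Q.1)%R|%N Q by exact: anc_unique Qx Px QP1.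
  have ii z : \1_(cube Q) z * \1_(cube P) z = \1_(cube Q) z :> R.
    rewrite !indicE; case: (boolP (z \in cube Q)) => [/set_mem Qz|_]; last by rewrite mul0r.
    by rewrite mem_set ?mulr1//; exact: sQP.
  rewrite phiE JB//; last exact: LiZ.
  rewrite JZ// (eqJ _ ii) J_ind -(avg _ _ (esym e)).
  have -> : J (fun x => \1_(cube Q) x * (\1_(cube P) x * f x)) = J (fun y => \1_(cube Q) y * f y).
    by apply: eqJ => z; rewrite mulrA ii.
  by rewrite subrr.
have mphi : measurable_fun setT phi.
  apply: measurable_funM; first by apply: measurable_indic; exact: measurable_cube.
  exact: measurable_funB.
have h1 : {ae mu, forall x, [set: X] x -> phi x <= 0}.
  by apply: (@differentiation_le R N phi setT P.1) => // Q QP _; rewrite Jphi.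
have h2 : {ae mu, forall x, [set: X] x -> - phi x <= 0}.
  have e Q : (fun x => \1_(cube Q) x * - phi x) = (fun x => -1 * (\1_(cube Q) x * phi x)).
    by apply/funext => x; rewrite mulN1r mulrN.
  apply: (@differentiation_le R N (fun x => - phi x) setT P.1) => //.
  - exact: measurable_opp.
  - by move=> Q; rewrite e; exact: LiZ.
  - by move=> Q QP _; rewrite e JZ// Jphi// mulr0.
apply: filterS2 h1 h2 => x /(_ I) p1 /(_ I) p2 Px.
have : phi x = 0 by apply/eqP; rewrite eq_le p1 -oppr_le0.
by rewrite /phi indicE mem_set// mul1r => /eqP; rewrite subr_eq0 => /eqP.
Qed.

(** For a cube T outside the r-th ancestor of P, the function S' 1_T is constant
    on P by [haar_orth_ind] and [const_on], hence orthogonal to b. So S b has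
    mean zero on all such T and vanishes by differentiation. *)
Lemma local_off (lp : local_pair r B S S') P b : L2r b -> (forall x, ~ cube P x -> b x = 0) -> J b = 0 ->
  {ae mu, forall x, ~ cube (anc r P) x -> S b x = 0}.
Proof.
move=> hb bP b0; have lp' := local_pair_sym lp; have hSb := lp_mem lp hb.
have mSb : measurable_fun setT (S b) by case: hSb.
pose A : set X := ~` cube (anc r P).
have mA : measurable A by apply: measurableC; exact: measurable_cube.
have z T : ~ (exists x, cube T x /\ cube (anc r P) x) -> J (fun x => \1_(cube T) x * S b x) = 0.
  move=> TP; rewrite -ip_ind (lp_adj lp)//; last exact: L2_ind.
  have hS' : L2r (S' \1_(cube T)) by apply: (lp_mem' lp); exact: L2_ind.
  have orth Q h : cube Q `<=` cube P -> Q.1 <= P.1 -> real_haar Q h -> ip (S' \1_(cube T)) h = 0.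
    move=> QP QP1 hh; rewrite ipwC -(lp_adj lp); [|exact: L2_haar hh|exact: L2_ind].
    exact: (haar_orth_ind lp TP QP QP1 hh).
  have := const_on hS' orth; set c := _ / _ => hc.
  have e : {ae mu, forall x, b x * S' \1_(cube T) x = c * b x}.
    apply: filterS hc => x hx; have [Px|Px] := pselect (cube P x); last by rewrite bP// mul0r mulr0.
    by rewrite hx// mulrC.
  have ib : Li b.
    have := L2_Li_cube P hb; congr Li; apply/funext => x.
    by rewrite indicE; case: (boolP (x \in cube P)) => [_|/negP h]; rewrite ?mul1r// bP ?mulr0// => Px; apply: h; exact: mem_set.
  rewrite ipE (J_ae _ _ e); last 2 first.
  - by case: hb => mb _; case: hS' => mS' _; exact: measurable_funM.
  - by apply: measurable_funM => //; case: hb.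
  by rewrite JZ// b0 mulr0.
have zA T : T.1 <= (anc r P).1 -> (exists x, A x /\ cube T x) -> J (fun x => \1_(cube T) x * S b x) = 0.
  move=> TP1 [x [Ax Tx]]; apply: z => -[y [Ty Py]]; apply: Ax.
  exact: (cube_nested Ty Py TP1).
have iS T : Li (fun x => \1_(cube T) x * S b x) by exact: L2_Li_cube.
have h1 : {ae mu, forall x, A x -> S b x <= 0}.
  by apply: (@differentiation_le R N (S b) A (anc r P).1) => // T TP hT; rewrite zA.
have h2 : {ae mu, forall x, A x -> - S b x <= 0}.
  have e Q : (fun x => \1_(cube Q) x * - S b x) = (fun x => -1 * (\1_(cube Q) x * S b x)).
    by apply/funext => x; rewrite mulN1r mulrN.
  apply: (@differentiation_le R N (fun x => - S b x) A (anc r P).1) => //.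
  - exact: measurable_opp.
  - by move=> Q; rewrite e; exact: LiZ.
  - by move=> Q QP hQ; rewrite e JZ// zA// mulr0.
apply: filterS2 h1 h2 => x p1 p2 Ax; apply/eqP; rewrite eq_le p1//= -oppr_le0; exact: p2.
Qed.

End Off.

(** * Stopping cubes of a weight *)

Section Stopping.
Context {R : realType} {N : nat}.
Local Notation X := (Rn R N).
Local Notation mu := (Defs.lebesgue_measureN R N).
Local Notation cube := (@Defs.cube R N).
Local Notation Li := (Li mu).
Local Notation J := (J mu).
Local Notation L2r := (Lw mu (fun=> 1)).
Local Notation nr := (nw mu (fun=> 1)).
Local Notation ip := (ipw mu (fun=> 1)).
Implicit Types (P Q : dyadic N) (x y : X) (f g h : X -> R) (F : dyadic N -> Prop).
Let w1 : weight (fun _ : X => 1 : R) := weight1.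

(** An enumeration of the cubes of F by their codes, in which unused codes give
    the empty set. *)
Definition enum_cubes F (i : nat) : set X :=
  if (pickle_inv i : option (dyadic N)) is Some Q then if `[< F Q >] then cube Q else set0 else set0.

Lemma enum_cubesP F i : enum_cubes F i = set0 \/ exists Q, F Q /\ enum_cubes F i = cube Q.
Proof.
rewrite /enum_cubes; case: (pickle_inv i : option (dyadic N)) => [Q|]; last by left.
by case: asboolP => h; [right; exists Q|left].
Qed.

Lemma bigcup_enum_cubes F : \bigcup_i enum_cubes F i = [set x | exists Q, F Q /\ cube Q x].
Proof.
apply/seteqP; split => [x [i _]|x [Q [FQ Qx]]].
  by case: (enum_cubesP F i) => [->//|[Q [FQ ->]] Qx]; exists Q.
exists (pickle Q); [by []|rewrite /enum_cubes pickleK_inv].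
by case: asboolP.
Qed.

Lemma measurable_enum F i : measurable (enum_cubes F i).
Proof. by case: (enum_cubesP F i) => [->//|[Q [_ ->]]]; exact: measurable_cube. Qed.

Definition disjoint_cubes F := forall P Q x, F P -> F Q -> cube P x -> cube Q x -> P = Q.

Lemma enum_disjoint F : disjoint_cubes F ->
  forall i j x, enum_cubes F i x -> enum_cubes F j x -> i = j.
Proof.
move=> dF i j x; rewrite /enum_cubes.
have := @pickle_invK (dyadic N) i; case: (pickle_inv i) => [P /= <-|//]; case: asboolP => // FP Px.
have := @pickle_invK (dyadic N) j; case: (pickle_inv j) => [Q /= <-|//]; case: asboolP => // FQ Qx.
by rewrite (dF _ _ _ FP FQ Px Qx).
Qed.

Lemma measurable_union F : measurable [set x | exists Q, F Q /\ cube Q x].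
Proof. by rewrite -bigcup_enum_cubes; apply: bigcupT_measurable => i; exact: measurable_enum. Qed.

Section FamilyOff.
Variables (r : nat) (B : R) (S S' : (X -> R) -> X -> R).
Hypotheses (N0 : (0 < N)%N) (lp : local_pair r B S S').
Variable F : dyadic N -> Prop.
Hypothesis dF : disjoint_cubes F.

Definition off_set : set X := [set x | forall Q, F Q -> ~ cube (anc r Q) x].

Lemma measurable_off : measurable off_set.
Proof.
have -> : off_set = ~` [set x | exists P, (exists Q, F Q /\ P = anc r Q) /\ cube P x].
  apply/seteqP; split => x /=.
    by move=> h [P [[Q [FQ ->]] Px]]; exact: h Px.
  by move=> h Q FQ Qx; apply: h; exists (anc r Q); split => //; exists Q.
by apply: measurableC; exact: measurable_union.
Qed.

(** Each cube of the family is handled by [local_off]. The sum over the family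
    is taken after moving S to the other side, where it becomes a sum of
    integrals over disjoint sets. *)
Lemma local_off_family b : L2r b -> (forall x, ~ (exists Q, F Q /\ cube Q x) -> b x = 0) ->
  (forall Q, F Q -> J (fun x => \1_(cube Q) x * b x) = 0) ->
  {ae mu, forall x, off_set x -> S b x = 0}.
Proof.
move=> hb bF b0; have hSb := lp_mem lp hb; have mO := measurable_off.
pose g x := \1_off_set x * S b x.
have hg : L2r g by exact: L2_ind_mul.
have hS'g := lp_mem' lp hg.
have gg : ip g g = ip (S b) g.
  rewrite !ipE; apply: eqJ => x; rewrite /g indicE; case: (_ \in _); by rewrite ?mul0r ?mul1r ?mulr0.
suff e0 : ip g g = 0.
  have := ae0_of_ip hg e0; apply: filterS => x + Ox.
  by rewrite /g indicE mem_set// mul1r.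
rewrite gg (lp_adj lp)// ipE.
apply: (J_family_eq0 (measurable_enum F) (enum_disjoint dF)) => //.
- exact: L2_Li_mul.
- by move=> x; rewrite bigcup_enum_cubes => nx; rewrite bF ?mul0r.
- move=> i; case: (enum_cubesP F i) => [->|[Q [FQ ->]]].
    by rewrite -[RHS](J0 mu); apply: eqJ => x; rewrite indic0 mul0r.
  have mQ := @measurable_cube R N Q.
  have hbQ : L2r (fun x => \1_(cube Q) x * b x) by exact: L2_ind_mul.
  have -> : J (fun x => \1_(cube Q) x * (b x * S' g x)) = ip (fun x => \1_(cube Q) x * b x) (S' g).
    by rewrite ipE; apply: eqJ => x; rewrite mulrA.
  rewrite -(lp_adj lp)// ipE.
  have hSQ := lp_mem lp hbQ.
  rewrite -[RHS](J0 mu); apply: J_ae => //.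
    by case: hSQ => mS _; case: hg => mg _; exact: measurable_funM.
  have supp x : ~ cube Q x -> \1_(cube Q) x * b x = 0.
    by move=> nQ; rewrite indicE memNset// mul0r.
  have off := local_off N0 lp hbQ supp (b0 _ FQ).
  apply: filterS off => x hx; have [Ox|Ox] := pselect (off_set x); last first.
    by rewrite /g indicE memNset// mul0r mulr0.
  by rewrite hx ?mul0r//; exact: Ox.
Qed.

End FamilyOff.

Section StoppingCubes.
Variable w : X -> R.
Hypotheses (hw : weight w) (iw : Li w) (N0 : (0 < N)%N).

Definition stop (k : nat) Q := k.+1%:R * vol Q < J (fun x => \1_(cube Q) x * w x).
Definition top (k : nat) Q := stop k Q /\ forall i, (0 < i)%N -> ~ stop k (anc i Q).

Let iQ Q : Li (fun x => \1_(cube Q) x * w x).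
Proof. by apply: Li_ind => //; exact: measurable_cube. Qed.

Lemma J_cube_le Q : J (fun x => \1_(cube Q) x * w x) <= J w.
Proof.
apply: J_le => // x; rewrite indicE; case: (_ \in _); rewrite ?mul1r ?mul0r//; exact: hw.2.
Qed.

Lemma J_cube_sub P Q : cube P `<=` cube Q ->
  J (fun x => \1_(cube P) x * w x) <= J (fun x => \1_(cube Q) x * w x).
Proof.
move=> PQ; apply: J_le => // x; apply: ler_wpM2r; first exact: hw.2.
rewrite !indicE; case: (boolP (x \in cube P)) => [/set_mem Px|_]; last by rewrite ler0n.
by rewrite mem_set//; exact: PQ.
Qed.

(** The average of w over the i-th ancestor tends to zero with i, because w is
    integrable. *)
Lemma stop_bounded k Q : exists i0, forall i, stop k (anc i Q) -> (i <= i0)%N.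
Proof.
exists (Num.truncn (J w / vol Q)).+1 => i hi.
have v0 := vol_gt0 (R := R) Q.
have h1 : vol (anc i Q) < J w.
  apply: lt_le_trans (J_cube_le (anc i Q)); apply: le_lt_trans hi.
  by rewrite ler_peMl ?ler1n// ltW// vol_gt0.
rewrite vol_anc in h1.
have h2 : (i%:R : R) <= (2 ^+ N) ^+ i.
  rewrite -exprM -natrX ler_nat; apply: leq_trans (ltnW (ltn_expl i (isT : (1 < 2)%N))) _.
  by rewrite leq_exp2l// leq_pmull.
have h3 : i%:R < J w / vol Q.
  by rewrite ltr_pdivlMr//; apply: le_lt_trans h1; rewrite ler_wpM2r// ltW.
have := lt_trans h3 (truncnS_gt (J w / vol Q)); rewrite ltr_nat; exact: ltnW.
Qed.

Lemma stop_top k Q : stop k Q -> exists i, top k (anc i Q).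
Proof.
move=> sQ; have [i0 hi0] := stop_bounded k Q.
pose p i := `[< stop k (anc i Q) >].
have ex : exists i, p i by exists 0%N; apply/asboolP; rewrite anc0.
have ub i : p i -> (i <= i0)%N by move=> /asboolP; exact: hi0.
case: (ex_maxnP ex ub) => i /asboolP si mi; exists i; split => // j j0 sj.
have : p (j + i)%N by apply/asboolP; rewrite ancD.
by move=> /mi; rewrite leqNgt -{1}(add0n i) ltn_add2r j0.
Qed.

Lemma top_disjoint k : disjoint_cubes (top k).
Proof.
have key P Q x : top k P -> top k Q -> cube P x -> cube Q x -> P.1 <= Q.1 -> P = Q.
  move=> [sP tP] [sQ tQ] Px Qx PQ; have e := anc_unique Px Qx PQ.
  have [m0|m0] := posnP `|(Q.1 - P.1)%R|%N; first by rewrite e m0 anc0.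
  by case: (tP _ m0); rewrite -e.
move=> P Q x tP tQ Px Qx; have [PQ|PQ] := leP P.1 Q.1; first exact: key PQ.
by symmetry; apply: (key Q P x) => //; exact: ltW.
Qed.

(** The parent of a maximal cube is no longer a stopping cube. *)
Lemma top_avg k Q : top k Q -> J (fun x => \1_(cube Q) x * w x) <= (2 ^+ N * k.+1%:R) * vol Q.
Proof.
move=> [_ /(_ 1%N isT)]; rewrite /stop parent_vol => /negP; rewrite -leNgt => h.
apply: le_trans (J_cube_sub (@cube_anc R N 1 Q)) _; apply: le_trans h _.
by rewrite le_eqVlt; apply/orP; left; apply/eqP; ring.
Qed.

Definition stopped k : set X := [set x | exists Q, top k Q /\ cube Q x].

Lemma stop_stopped k Q x : stop k Q -> cube Q x -> stopped k x.
Proof.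
by move=> /stop_top[i ti] Qx; exists (anc i Q); split => //; exact: cube_anc.
Qed.

Lemma w_le_off k : {ae mu, forall x, ~ stopped k x -> w x <= k.+1%:R}.
Proof.
have mw : measurable_fun setT w by case: hw.
have e Q : (fun x => \1_(cube Q) x * (w x - k.+1%:R)) =
   (fun x => \1_(cube Q) x * w x - k.+1%:R * \1_(cube Q) x) by apply/funext => x; ring.
have iC Q : Li (fun x => k.+1%:R * \1_(cube Q) x) by apply: LiZ; exact: Li_cube.
have : {ae mu, forall x, (~` stopped k) x -> w x - k.+1%:R <= 0}.
  apply: (@differentiation_le R N _ _ 0).
  - exact: measurable_funB.
  - by apply: measurableC; exact: measurable_union.
  - by move=> P; rewrite e; exact: LiB.
  - move=> P _ [x [Ax Px]]; rewrite e JB// JZ; last exact: Li_cube.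
    rewrite J_ind subr_le0 leNgt; apply/negP => sP; apply: Ax.
    exact: (@stop_stopped k P).
by apply: filterS => x h /h; rewrite subr_le0.
Qed.

Lemma top_coarser k l Q : (k <= l)%N -> top l Q ->
  exists P, [/\ top k P, cube Q `<=` cube P & Q.1 <= P.1].
Proof.
move=> kl [sQ _]; have : stop k Q.
  apply: le_lt_trans sQ; rewrite ler_wpM2r ?ler_nat//; exact/ltW/vol_gt0.
move=> /stop_top[i ti]; exists (anc i Q); split => //; first exact: cube_sub_anc.
by rewrite /=; lia.
Qed.

Lemma stopped_nonincr k l x : (k <= l)%N -> stopped l x -> stopped k x.
Proof.
by move=> kl [Q [tQ Qx]]; have [P [tP QP _]] := top_coarser kl tQ; exists P; split => //; exact: QP.
Qed.

(** The good part of the Calderon--Zygmund decomposition of f along the maximal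
    cubes where the average of w exceeds k+1. The cubes depend on w and not on
    f, which makes the operation linear in f. *)
Definition condop k f x : R :=
  if pselect (stopped k x) is left h then
    let Q := projT1 (cid h) in J (fun y => \1_(cube Q) y * f y) / vol Q
  else f x.

Lemma condop_in k f Q x : top k Q -> cube Q x ->
  condop k f x = J (fun y => \1_(cube Q) y * f y) / vol Q.
Proof.
move=> tQ Qx; rewrite /condop; case: pselect => [h|]; last by case; exists Q.
case: cid => P [tP Px] /=; by rewrite (top_disjoint tP tQ Px Qx).
Qed.

Lemma condop_out k f x : ~ stopped k x -> condop k f x = f x.
Proof. by rewrite /condop; case: pselect. Qed.

Lemma measurable_condop k f : measurable_fun setT f -> measurable_fun setT (condop k f).
Proof.
move=> mf _ A mA; rewrite setTI.
have -> : condop k f @^-1` A = \bigcup_(Q : dyadic N)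
   (if `[< top k Q /\ A (J (fun y => \1_(cube Q) y * f y) / vol Q) >] then cube Q else set0) `|`
   (~` stopped k `&` f @^-1` A).
  apply/seteqP; split => x /=.
    have [[Q [tQ Qx]]|nx] := pselect (stopped k x).
      by rewrite (condop_in _ tQ Qx) => hA; left; exists Q => //; case: asboolP => // -[].
    by rewrite condop_out// => hA; right; split.
  move=> [[Q _]|[nx hA]]; last by rewrite condop_out.
  by case: asboolP => // -[tQ hA] Qx; rewrite (condop_in _ tQ Qx).
apply: measurableU.
  apply: countable_bigcupT_measurable => [|Q]; first exact: countableP.
  by case: ifP => _ //; exact: measurable_cube.
apply: measurableI; first by apply: measurableC; exact: measurable_union.
by rewrite -[X in measurable X]setTI; exact: mf.
Qed.

Section Density.
Variable p : X -> R.
Hypothesis hp : Lw mu w p.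
Let f x := w x * p x.

Lemma Lw_one : Lw mu w (fun=> 1).
Proof.
by split => //; have := iw; congr Li; apply/funext => x; rewrite !mulr1.
Qed.

Lemma Li_wp : Li f.
Proof.
have := Lw_mul hw hp Lw_one; congr Li; apply/funext => x; by rewrite mulr1.
Qed.

Lemma cube_CS Q : J (fun x => \1_(cube Q) x * f x) ^+ 2 <=
  J (fun x => \1_(cube Q) x * w x) * J (fun x => \1_(cube Q) x * (w x * p x * p x)).
Proof.
have mQ := @measurable_cube R N Q.
have h1 : Lw mu w \1_(cube Q).
  have := Lw_ind hw mQ Lw_one; by under [X in Lw _ _ X -> _]eq_fun do rewrite mulr1.
have h2 := Lw_ind hw mQ hp.
have := ipw_CS hw h1 h2.
have e1 : ipw mu w \1_(cube Q) (fun x => \1_(cube Q) x * p x) = J (fun x => \1_(cube Q) x * f x).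
  by apply: eqJ => x; rewrite -{3}ind_idem /f; ring.
have e2 : ipw mu w \1_(cube Q) \1_(cube Q) = J (fun x => \1_(cube Q) x * w x).
  by apply: eqJ => x; rewrite -[in RHS]ind_idem; ring.
have e3 : ipw mu w (fun x => \1_(cube Q) x * p x) (fun x => \1_(cube Q) x * p x) =
   J (fun x => \1_(cube Q) x * (w x * p x * p x)).
  by apply: eqJ => x; rewrite -[in RHS]ind_idem; ring.
rewrite e1 => h; rewrite -e2 -e3 -!(sqr_nw mu hw) -exprMn -[_ ^+ 2](real_normK (num_real _)).
by rewrite ler_pXn2r// nnegrE mulr_ge0// nw_ge0.
Qed.

End Density.
End StoppingCubes.
End Stopping.

(** * The good part of the decomposition at a given height *)

Section Extension.
Context {R : realType} {N : nat}.
Local Notation X := (Rn R N).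
Local Notation mu := (Defs.lebesgue_measureN R N).
Local Notation cube := (@Defs.cube R N).
Local Notation Li := (Li mu).
Local Notation J := (J mu).
Local Notation L2r := (Lw mu (fun=> 1)).
Local Notation nr := (nw mu (fun=> 1)).
Local Notation ip := (ipw mu (fun=> 1)).
Implicit Types (P Q : dyadic N) (x y : X) (f g h p : X -> R).
Let w1 : weight (fun _ : X => 1 : R) := weight1.

Variable w : X -> R.
Hypotheses (hw : weight w) (iw : Li w) (N0 : (0 < N)%N).
Local Notation top := (top w).
Local Notation condop := (condop w).
Local Notation stopped := (stopped w).
Local Notation wp p := (fun x => w x * p x).

Lemma condop_lin k a f g x : Li f -> Li g ->
  condop k (fun y => a * f y + g y) x = a * condop k f x + condop k g x.
Proof.
move=> hf hg; have [[Q [tQ Qx]]|nx] := pselect (stopped k x); last by rewrite !condop_out.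
have mQ := @measurable_cube R N Q.
rewrite !(condop_in _ tQ Qx).
have -> : J (fun y => \1_(cube Q) y * (a * f y + g y)) =
   a * J (fun y => \1_(cube Q) y * f y) + J (fun y => \1_(cube Q) y * g y).
  rewrite -JZ; last exact: Li_ind.
  rewrite -JD; [|by apply: LiZ; exact: Li_ind|exact: Li_ind].
  by apply: eqJ => y; ring.
by rewrite mulrDl mulrA.
Qed.

(** On a maximal cube the squared average of w p is at most the average of w,
    which is at most 2^N (k+1) there, times the average of w p^2. Off the
    cubes w is at most k+1. So the good part is in L^2 even if w p is not. *)
Lemma condop_bound k p : Lw mu w p -> L2r (condop k (wp p)) /\
  nr (condop k (wp p)) <= Num.sqrt (2 ^+ N * k.+1%:R) * nw mu w p.
Proof.
move=> hp; have [mp ip'] := hp; have [mw w0] := hw.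
set f := wp p; set G := condop k f; set K := 2 ^+ N * k.+1%:R.
have K0 : 0 <= K by rewrite mulr_ge0.
have mf : measurable_fun setT f by exact: measurable_funM.
have mG : measurable_fun setT G by exact: measurable_condop.
have GQ Q : top k Q -> (fun x => \1_(cube Q) x * (G x * G x)) =
   (fun x => (J (fun y => \1_(cube Q) y * f y) / vol Q) ^+ 2 * \1_(cube Q) x).
  move=> tQ; apply/funext => x; rewrite [in LHS]indicE [in RHS]indicE.
  case: (boolP (x \in cube Q)) => [/set_mem Qx|_]; last by rewrite mul0r mulr0.
  by rewrite /G (condop_in _ tQ Qx) mul1r mulr1 expr2.
have pp0 x : 0 <= w x * p x * p x by exact: (w_sqr_ge0 hw p).
have [hG JG] : Li (fun x => G x * G x) /\ J (fun x => G x * G x) <= J (fun x => K * (w x * p x * p x)).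
  apply: (@J_family_le _ _ _ mu (enum_cubes (top k)) (measurable_enum (top k))
   (enum_disjoint (@top_disjoint R N w k))).
  - exact: measurable_funM.
  - by move=> x; rewrite -expr2 sqr_ge0.
  - by move=> x; rewrite mulr_ge0.
  - exact: LiZ.
  - move=> i; case: (@enum_cubesP R N (top k) i) => [->|[Q [tQ ->]]].
      have -> : (fun x => \1_set0 x * (G x * G x)) = (fun=> 0).
        by apply/funext => x; rewrite indic0 mul0r.
      exact: Li0.
    by rewrite GQ//; apply: LiZ; exact: Li_cube.
  - move=> i; case: (@enum_cubesP R N (top k) i) => [->|[Q [tQ ->]]].
      have e h : J (fun x => \1_set0 x * h x) = 0.
        by rewrite -[RHS](J0 mu); apply: eqJ => x; rewrite indic0 mul0r.
      by rewrite !e.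
    have v0 := vol_gt0 (R := R) Q.
    rewrite GQ// JZ; last exact: Li_cube.
    have -> : J (fun x => \1_(cube Q) x * (K * (w x * p x * p x))) =
       K * J (fun x => \1_(cube Q) x * (w x * p x * p x)).
      rewrite -JZ; last by apply: Li_ind => //; exact: measurable_cube.
      by apply: eqJ => x; ring.
    set j := J (fun y => \1_(cube Q) y * f y).
    rewrite J_ind; have -> : (j / vol Q) ^+ 2 * vol Q = j ^+ 2 / vol Q by field; rewrite gt_eqF.
    rewrite ler_pdivrMr//; apply: le_trans (cube_CS hw iw hp Q) _.
    rewrite mulrAC; apply: ler_wpM2r; last exact: top_avg.
    by apply: J_ge0 => x; rewrite mulr_ge0// indicE.
  - rewrite bigcup_enum_cubes; have := w_le_off hw iw N0 k; apply: filterS => x h nx.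
    rewrite /G condop_out// /f.
    have wk : w x <= K.
      apply: le_trans (h nx) _; rewrite /K ler_peMl// exprn_ege1// ler1n//.
    have -> : w x * p x * (w x * p x) = w x * (w x * p x * p x) by ring.
    exact: ler_wpM2r.
have hG' : L2r G by split => //; have := hG; congr Li; apply/funext => x; rewrite mul1r.
split => //.
rewrite -(ger0_norm (nw_ge0 _ _ G)) -(sqrtr_sqr (nw _ _ G)).
have -> : Num.sqrt K * nw mu w p = Num.sqrt (K * nw mu w p ^+ 2).
  by rewrite sqrtrM// sqrtr_sqr ger0_norm// nw_ge0.
apply: ler_wsqrtr; rewrite !sqr_nw// ipE; apply: le_trans JG _.
by rewrite JZ.
Qed.

Lemma condop_mean k Q f : Li f -> Li (fun x => \1_(cube Q) x * condop k f x) ->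
  (forall P, top k P -> (exists x, cube P x /\ cube Q x) -> cube P `<=` cube Q) ->
  J (fun x => \1_(cube Q) x * condop k f x) = J (fun x => \1_(cube Q) x * f x).
Proof.
move=> hf hG PQ; have mQ := @measurable_cube R N Q.
have iQ : Li (fun x => \1_(cube Q) x * f x) by exact: Li_ind.
apply/eqP; rewrite -subr_eq0 -JB//; apply/eqP.
apply: (@J_family_eq0 _ _ _ mu (enum_cubes (top k)) (measurable_enum (top k))
   (enum_disjoint (@top_disjoint R N w k))).
- exact: LiB.
- by move=> x; rewrite bigcup_enum_cubes => nx; rewrite condop_out// subrr.
- move=> i; case: (@enum_cubesP R N (top k) i) => [->|[P [tP ->]]].
    by rewrite -[RHS](J0 mu); apply: eqJ => x; rewrite indic0 mul0r.
  have mP := @measurable_cube R N P.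
  have [ex|nex] := pselect (exists x, cube P x /\ cube Q x); last first.
    rewrite -[RHS](J0 mu); apply: eqJ => x; rewrite !indicE.
    case: (boolP (x \in cube P)) => [/set_mem Px|_]; last by rewrite mul0r.
    rewrite memNset; last by move=> Qx; apply: nex; exists x.
    by rewrite !mul0r subrr mulr0.
  have sPQ := PQ _ tP ex.
  have v0 := vol_gt0 (R := R) P.
  have -> : J (fun x => \1_(cube P) x * (\1_(cube Q) x * condop k f x - \1_(cube Q) x * f x)) =
     J (fun x => (J (fun y => \1_(cube P) y * f y) / vol P) * \1_(cube P) x - \1_(cube P) x * f x).
    apply: eqJ => x; rewrite !indicE.
    case: (boolP (x \in cube P)) => [/set_mem Px|_]; last by rewrite !mul0r mulr0 subrr.
    by rewrite mem_set ?(condop_in _ tP Px) ?mul1r ?mulr1//; exact: sPQ.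
  rewrite JB; [|by apply: LiZ; exact: Li_cube|exact: Li_ind].
  by rewrite JZ ?J_ind ?divfK ?subrr ?gt_eqF//; exact: Li_cube.
Qed.

End Extension.

(** * Extension of a local operator to weighted functions *)

Section Extension.
Context {R : realType} {N : nat}.
Local Notation X := (Rn R N).
Local Notation mu := (Defs.lebesgue_measureN R N).
Local Notation cube := (@Defs.cube R N).
Local Notation Li := (Li mu).
Local Notation J := (J mu).
Local Notation L2r := (Lw mu (fun=> 1)).
Local Notation nr := (nw mu (fun=> 1)).
Local Notation ip := (ipw mu (fun=> 1)).
Implicit Types (P Q : dyadic N) (x y : X) (f g h p : X -> R).
Let w1 : weight (fun _ : X => 1 : R) := weight1.

Variables (r : nat) (w : X -> R).
Hypotheses (hw : weight w) (iw : Li w) (N0 : (0 < N)%N).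
Local Notation top := (top w).
Local Notation condop := (condop w).
Local Notation stopped := (stopped w).
Local Notation wp p := (fun x => w x * p x).

Definition off k : set X := off_set r (top k).
Definition bad : set X := [set x | forall k, ~ off k x].
(** On off k the values at height k are final. Adding the null set bad, of the
    points that are covered at every height, makes the sets exhaust the whole
    space and not just almost all of it. *)
Definition good k : set X := off k `|` bad.

Lemma off_nd k l : (k <= l)%N -> off k `<=` off l.
Proof.
move=> kl x ox Q tQ Qx.
have [P [tP QP QP1]] := top_coarser hw iw N0 kl tQ.
apply: (ox P tP).
have -> : anc r P = anc `|(P.1 - Q.1)%R|%N (anc r Q).
  by rewrite [in LHS](sub_anc QP QP1) -!ancD addnC.
exact: cube_anc.
Qed.

Lemma measurable_offk k : measurable (off k).
Proof. exact: measurable_off. Qed.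

Lemma measurable_bad : measurable bad.
Proof.
have -> : bad = \bigcap_k (~` off k).
  by apply/seteqP; split => x /= h k; [move=> _; exact: h|exact: h].
by apply: bigcapT_measurable => k; apply: measurableC; exact: measurable_offk.
Qed.

Lemma measurable_good k : measurable (good k).
Proof. by apply: measurableU; [exact: measurable_offk|exact: measurable_bad]. Qed.

Lemma good_nd k l : (k <= l)%N -> good k `<=` good l.
Proof. by move=> kl x [ox|]; [left; exact: off_nd ox|right]. Qed.

Lemma good_total x : exists k, good k x.
Proof.
have [[k ok]|h] := pselect (exists k, off k x); first by exists k; left.
by exists 0%N; right => k ok; apply: h; exists k.
Qed.

(** The weak type estimate: the volume of a stopping cube is at most its w-mass
    divided by k+1, and ancestors cost a factor (2^N)^r. *)
Lemma mu_off_compl k : (mu (~` off k) <= ((2 ^+ N) ^+ r / k.+1%:R * J w)%:E)%E.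
Proof.
pose D i : set X := if (pickle_inv i : option (dyadic N)) is Some Q then
   if `[< top k Q >] then cube (anc r Q) else set0 else set0.
have mD i : measurable (D i).
  rewrite /D; case: (pickle_inv i : option (dyadic N)) => [Q|//].
  by case: ifP => _ //; exact: measurable_cube.
have cov : ~` off k `<=` \bigcup_i D i.
  move=> x nx; have [Q [tQ Qx]] : exists Q, top k Q /\ cube (anc r Q) x.
    by apply: contrapT => h; apply: nx => Q tQ Qx; apply: h; exists Q.
  exists (pickle Q); [by []|by rewrite /D pickleK_inv; case: asboolP].
have mO : measurable (~` off k) by apply: measurableC; exact: measurable_offk.
have sub := @measure_sigma_subadditive _ _ _ mu _ _ mD mO cov.
apply: le_trans sub _.
apply: lime_le; first by apply: is_cvg_nneseries => i _ _; exact: measure_ge0.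
apply: nearW => n; set c := (2 ^+ N) ^+ r / k.+1%:R.
have c0 : 0 <= c by rewrite divr_ge0// !exprn_ge0.
have hD i : (mu (D i) <= (c * J (fun x => \1_(enum_cubes (top k) i) x * w x))%:E)%E.
  rewrite /D /enum_cubes; case: (pickle_inv i : option (dyadic N)) => [Q|]; last first.
    by rewrite measure0 lee_fin mulr_ge0// J_ge0// => x; rewrite indic0 mul0r.
  case: asboolP => [tQ|_]; last by rewrite measure0 lee_fin mulr_ge0// J_ge0// => x; rewrite indic0 mul0r.
  rewrite mu_cube lee_fin vol_anc /c -mulrA ler_wpM2l ?exprn_ge0 ?exprn_ge0//.
  by rewrite mulrC ler_pdivlMr// mulrC ltW//; case: tQ.
rewrite big_mkord; apply: le_trans (lee_sum _ (fun (i : 'I_n) _ => hD i)) _.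
rewrite sumEFin lee_fin -mulr_sumr ler_wpM2l//.
apply: J_family_sum_le => //.
- exact: measurable_enum.
- by apply: enum_disjoint; exact: top_disjoint.
- exact: hw.2.
Qed.

Lemma bad_null : {ae mu, forall x, ~ bad x}.
Proof.
exists bad; split; [exact: measurable_bad| |by move=> x /= /contrapT].
apply/eqP; rewrite eq_le measure_ge0 andbT.
apply/lee_addgt0Pr => e e0; rewrite add0e.
set K := (2 ^+ N) ^+ r * J w.
have K0 : 0 <= K by rewrite mulr_ge0 ?exprn_ge0// J_ge0//; exact: hw.2.
pose k := Num.truncn (K / e).
apply: (@le_trans _ _ (mu (~` off k))).
  apply: le_measure; rewrite ?inE; [exact: measurable_bad|by apply: measurableC; exact: measurable_offk|].
  by move=> x h; exact: h.
apply: le_trans (mu_off_compl k) _; rewrite lee_fin mulrAC -/K ler_pdivrMr//.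
by rewrite mulrC -ler_pdivrMr// ltW// /k truncnS_gt.
Qed.

Section Operator.
Variables (B : R) (S S' : (X -> R) -> X -> R).
Hypothesis lp : local_pair r B S S'.

Lemma good_exb x : exists k, `[< good k x >].
Proof. by have [k h] := good_total x; exists k; apply/asboolP. Qed.

Definition level x : nat := ex_minn (good_exb x).

Lemma level_good x : good (level x) x.
Proof. by rewrite /level; case: ex_minnP => k /asboolP. Qed.

Lemma level_le x k : good k x -> (level x <= k)%N.
Proof. by move=> gk; rewrite /level; case: ex_minnP => l _; apply; apply/asboolP. Qed.

(** S cannot be applied to w p, which is merely integrable. Its value at x is
    taken from the good part at the first height for which x is good; the
    choice of height is immaterial almost everywhere, by [ext_good]. *)
Definition ext p x : R := S (condop (level x) (wp p)) x.

Lemma S_condop_mem k p : Lw mu w p -> L2r (S (condop k (wp p))).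
Proof. by move=> hp; apply: (lp_mem lp); case: (condop_bound hw iw N0 k hp). Qed.

Lemma measurable_level k : measurable [set x | level x = k].
Proof.
have -> : [set x | level x = k] = good k `\` (if k is j.+1 then good j else set0).
  apply/seteqP; split => x /=.
    move=> <-; split; first exact: level_good.
    case e : (level x) => [|j] gj; first by [].
    by have := level_le gj; rewrite e ltnn.
  move=> [gk nk]; apply/eqP; rewrite eqn_leq level_le//=.
  case: k gk nk => // j gk nk; rewrite ltnNge; apply/negP => h; apply: nk.
  by apply: good_nd h _ _; exact: level_good.
by case: k => [|j]; apply: measurableD => //; exact: measurable_good.
Qed.

Lemma measurable_ext p : Lw mu w p -> measurable_fun setT (ext p).
Proof.
move=> hp _ A mA; rewrite setTI.
have -> : ext p @^-1` A = \bigcup_k ([set x | level x = k] `&` S (condop k (wp p)) @^-1` A).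
  apply/seteqP; split => x /=; first by move=> h; exists (level x).
  by move=> [k _ [<-]].
apply: bigcupT_measurable => k; apply: measurableI; first exact: measurable_level.
have [mS _] := S_condop_mem k hp.
by rewrite -[X in measurable X]setTI; exact: mS.
Qed.

(** The good parts at heights k <= l differ by a function that has mean zero on
    each maximal cube at height k, because the maximal cubes at height l are
    contained in these. *)
Lemma condop_diff k l p : (k <= l)%N -> Lw mu w p ->
  {ae mu, forall x, off k x -> S (condop l (wp p)) x = S (condop k (wp p)) x}.
Proof.
move=> kl hp; have [hk _] := condop_bound hw iw N0 k hp; have [hl _] := condop_bound hw iw N0 l hp.
have hf := Li_wp hw iw hp.
have off0 := @local_off_family R N r B S S' N0 lp (top k) (@top_disjoint R N w k)
   (fun x => condop l (wp p) x - condop k (wp p) x) (LwB w1 hl hk).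
have /off0 : forall x, ~ (exists Q, top k Q /\ cube Q x) ->
    condop l (wp p) x - condop k (wp p) x = 0.
  move=> x nx; rewrite !condop_out ?subrr// => h; apply: nx.
  exact: (stopped_nonincr hw iw N0 kl h).
have iQ Q m : Li (fun x => \1_(cube Q) x * condop m (wp p) x).
  by apply: L2_Li_cube; case: (condop_bound hw iw N0 m hp).
have /[swap]/[apply] : forall Q, top k Q -> J (fun x => \1_(cube Q) x *
   (condop l (wp p) x - condop k (wp p) x)) = 0.
  move=> Q tQ.
  have -> : J (fun x => \1_(cube Q) x * (condop l (wp p) x - condop k (wp p) x)) =
     J (fun x => \1_(cube Q) x * condop l (wp p) x) - J (fun x => \1_(cube Q) x * condop k (wp p) x).
    by rewrite -JB//; apply: eqJ => x; ring.
  rewrite !condop_mean ?subrr//.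
    by move=> P tP [x [Px Qx]]; rewrite (top_disjoint tP tQ Px Qx).
  move=> P tP [x [Px Qx]]; have [P' [tP' PP' _]] := top_coarser hw iw N0 kl tP.
  by rewrite (top_disjoint tQ tP' Qx (PP' _ Px)).
have := lp_sub lp hl hk; apply: filterS2 => x e1 e2 ox.
by have := e2 ox; rewrite e1 => /eqP; rewrite subr_eq0 => /eqP.
Qed.

Lemma ext_good p : Lw mu w p ->
  {ae mu, forall x k, good k x -> ext p x = S (condop k (wp p)) x}.
Proof.
move=> hp.
have h : {ae mu, forall x k l, (k <= l)%N -> off k x -> S (condop l (wp p)) x = S (condop k (wp p)) x}.
  apply: ae_foralln => k; apply: ae_foralln => l.
  case: (leqP k l) => kl; last by apply: aeW.
  by have := condop_diff kl hp; apply: filterS => x h _.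
apply: filterS2 h bad_null => x hx nb k gk; rewrite /ext; symmetry.
apply: hx; first exact: level_le.
by have [] := level_good x.
Qed.

Lemma ext_bound p k : Lw mu w p -> Lw mu \1_(good k) (ext p) /\
  nw mu \1_(good k) (ext p) <= B * Num.sqrt (2 ^+ N * k.+1%:R) * nw mu w p.
Proof.
move=> hp; have mg := measurable_good k.
have wg : weight (\1_(good k) : X -> R) by split => // x; rewrite indicE.
have hS := S_condop_mem k hp.
have le1 x : \1_(good k) x <= 1 * 1 :> R by rewrite mulr1 indicE; case: (_ \in _).
have [h1 h2] := nw_weight_le wg w1 ler01 le1 hS.
have e : {ae mu, forall x, \1_(good k) x * S (condop k (wp p)) x * S (condop k (wp p)) x =
    \1_(good k) x * ext p x * ext p x}.
  have := ext_good hp; apply: filterS => x hx; rewrite indicE.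
  by case: (boolP (x \in good k)) => [/set_mem gk|_]; [rewrite (hx k)|rewrite !mul0r].
have me := measurable_ext hp; have [mS _] := hS.
have m2 : measurable_fun setT (fun x => \1_(good k) x * ext p x * ext p x).
  by apply: measurable_funM => //; apply: measurable_funM.
split; first by split => //; apply: Li_ae e h1.2.
have -> : nw mu \1_(good k) (ext p) = nw mu \1_(good k) (S (condop k (wp p))).
  congr Num.sqrt; apply: J_ae => //; first by apply: measurable_funM => //; apply: measurable_funM.
  by apply: filterS e => x ->.
rewrite sqrtr1 mul1r in h2; apply: le_trans h2 _.
have [hc bc] := condop_bound hw iw N0 k hp.
apply: le_trans (lp_bd lp hc) _; rewrite -mulrA; apply: ler_wpM2l => //; exact: lp_B lp.
Qed.

Lemma ext_lin a p q : Lw mu w p -> Lw mu w q ->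
  {ae mu, forall x, ext (fun y => a * p y + q y) x = a * ext p x + ext q x}.
Proof.
move=> hp hq; have hap := LwZ a hp; have hpq := LwD hw hap hq.
have hk k : {ae mu, forall x, S (condop k (wp (fun y => a * p y + q y))) x =
   a * S (condop k (wp p)) x + S (condop k (wp q)) x}.
  have [h1 _] := condop_bound hw iw N0 k hp; have [h2 _] := condop_bound hw iw N0 k hq.
  have -> : condop k (wp (fun y => a * p y + q y)) =
    (fun x => a * condop k (wp p) x + condop k (wp q) x).
    apply/funext => x; rewrite -(condop_lin w k a x (Li_wp hw iw hp) (Li_wp hw iw hq)).
    by congr (condop k _ x); apply/funext => y; ring.
  have := lp_add lp (LwZ a h1) h2; have := lp_scale lp a h1.
  by apply: filterS2 => x -> ->.
have h4 := ext_good hpq; have := ext_good hp; have := ext_good hq; have := ae_foralln hk.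
apply: filter_app3; apply: filterS h4 => x e4 e1 e2 e3; have gx := level_good x.
by rewrite (e4 _ gx) (e3 _ gx) (e2 _ gx) e1.
Qed.

(** The function w p and its good part have the same mean on each maximal cube. *)
Lemma ext_L2 p : Lw mu w p -> L2r (wp p) -> {ae mu, forall x, ext p x = S (wp p) x}.
Proof.
move=> hp hwp; have hf := Li_wp hw iw hp.
have hk k : {ae mu, forall x, off k x -> S (condop k (wp p)) x = S (wp p) x}.
  have [hc _] := condop_bound hw iw N0 k hp.
  have off0 := @local_off_family R N r B S S' N0 lp (top k) (@top_disjoint R N w k)
   (fun x => condop k (wp p) x - wp p x) (LwB w1 hc hwp).
  have /off0 : forall x, ~ (exists Q, top k Q /\ cube Q x) -> condop k (wp p) x - wp p x = 0.
    by move=> x nx; rewrite condop_out// subrr.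
  have iQ Q : Li (fun x => \1_(cube Q) x * condop k (wp p) x) by exact: L2_Li_cube.
  have iQ' Q : Li (fun x => \1_(cube Q) x * wp p x) by exact: L2_Li_cube.
  have /[swap]/[apply] : forall Q, top k Q -> J (fun x => \1_(cube Q) x * (condop k (wp p) x - wp p x)) = 0.
    move=> Q tQ.
    have -> : J (fun x => \1_(cube Q) x * (condop k (wp p) x - wp p x)) =
      J (fun x => \1_(cube Q) x * condop k (wp p) x) - J (fun x => \1_(cube Q) x * wp p x).
      by rewrite -JB//; apply: eqJ => x; ring.
    rewrite condop_mean ?subrr//.
    by move=> P tP [x [Px Qx]]; rewrite (top_disjoint tP tQ Px Qx).
  have := lp_sub lp hc hwp; apply: filterS2 => x e1 e2 ox.
  by have := e2 ox; rewrite e1 => /eqP; rewrite subr_eq0 => /eqP.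
have := ext_good hp; have := ae_foralln hk; have := bad_null.
apply: filterS3 => x nb e1 e2; have gx := level_good x.
by rewrite (e2 _ gx) e1//; case: gx.
Qed.

(** The good part of w p is again a function on T of mean zero: a maximal cube
    inside T keeps its mean, and if some maximal cube is larger than T then the
    good part is zero there. *)
Lemma ext_local p T : Lw mu w p -> (forall x, ~ cube T x -> p x = 0) -> J (wp p) = 0 ->
  {ae mu, forall x, ~ cube (anc r T) x -> ext p x = 0}.
Proof.
move=> hp pT p0; have hf := Li_wp hw iw hp.
have fT x : ~ cube T x -> wp p x = 0 by move=> /pT ->; rewrite mulr0.
have JT : J (fun x => \1_(cube T) x * wp p x) = 0.
  rewrite -[RHS]p0; apply: eqJ => x; have [Tx|Tx] := pselect (cube T x).
    by rewrite indicE mem_set// mul1r.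
  by rewrite pT// !mulr0.
have hk k : {ae mu, forall x, ~ cube (anc r T) x -> S (condop k (wp p)) x = 0}.
  have [hc _] := condop_bound hw iw N0 k hp.
  have J0Q Q : ~ (cube Q `<=` cube T) -> J (fun x => \1_(cube Q) x * wp p x) = 0.
    move=> QT; have [[x [Qx Tx]]|nQ] := pselect (exists x, cube Q x /\ cube T x); last first.
      rewrite -[RHS](J0 mu); apply: eqJ => x; rewrite indicE.
      case: (boolP (x \in cube Q)) => [/set_mem Qx|_]; last by rewrite mul0r.
      by rewrite pT ?mulr0// => Tx; apply: nQ; exists x.
    have [QT1|TQ1] := leP Q.1 T.1; first by case: QT; exact: cube_nested Qx Tx QT1.
    have TQ := cube_nested Tx Qx (ltW TQ1).
    rewrite -[RHS]p0; apply: eqJ => y; have [Ty|Ty] := pselect (cube T y).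
      by rewrite indicE mem_set ?mul1r//; exact: TQ.
    by rewrite pT// !mulr0.
  have cT x : ~ cube T x -> condop k (wp p) x = 0.
    move=> nT; have [[Q [tQ Qx]]|nx] := pselect (stopped k x); last by rewrite condop_out// pT// mulr0.
    by rewrite (condop_in _ tQ Qx) J0Q ?mul0r// => QT; apply: nT; exact: QT.
  apply: (local_off N0 lp hc cT).
  have -> : J (condop k (wp p)) = J (fun x => \1_(cube T) x * condop k (wp p) x).
    apply: eqJ => x; have [Tx|Tx] := pselect (cube T x).
      by rewrite indicE mem_set// mul1r.
    by rewrite cT// mulr0.
  have [[Q [tQ [x [Qx Tx]] QT]]|hn] := pselect (exists Q, [/\ top k Q, exists x, cube Q x /\ cube T x & ~ (cube Q `<=` cube T)]).
    have TQ : cube T `<=` cube Q.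
      have [QT1|TQ1] := leP Q.1 T.1; first by case: QT; exact: cube_nested Qx Tx QT1.
      exact: (cube_nested Tx Qx (ltW TQ1)).
    rewrite -[RHS](J0 mu); apply: eqJ => y; rewrite indicE.
    case: (boolP (y \in cube T)) => [/set_mem Ty|_]; last by rewrite mul0r.
    by rewrite (condop_in _ tQ (TQ _ Ty)) J0Q// mul0r mulr0.
  rewrite condop_mean//; first exact: L2_Li_cube.
  move=> Q tQ ex; apply: contrapT => QT; apply: hn; by exists Q.
have := ext_good hp; have := ae_foralln hk.
apply: filterS2 => x e1 e2 nx; have gx := level_good x.
by rewrite (e2 _ gx) e1.
Qed.

End Operator.
End Extension.

(** * Limits and duality for the extension *)

Section Testing.
Context {R : realType} {N : nat}.
Local Notation X := (Rn R N).
Local Notation mu := (Defs.lebesgue_measureN R N).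
Local Notation cube := (@Defs.cube R N).
Local Notation Li := (Li mu).
Local Notation J := (J mu).
Local Notation Lw := (Lw mu).
Local Notation nw := (nw mu).
Local Notation ipw := (ipw mu).
Local Notation L2r := (Lw (fun=> 1)).
Implicit Types (P Q T : dyadic N) (x y : X) (f g h p u v : X -> R).
Let w1 : weight (fun _ : X => 1 : R) := weight1.

(** The form in which testing enters: f is the limit in L^2(u) of functions p n
    to which S itself can be applied, with a uniform bound in L^2(v). *)
Definition approximable (r : nat) (S : (X -> R) -> X -> R) u v f (K : R) := exists p : nat -> X -> R,
  [/\ forall n, Lw u (p n), forall n, L2r (fun x => u x * p n x),
      nw u (fun x => p n x - f x) @[n --> \oo] --> 0 &
      forall n, Lw v (ext r u S (p n)) /\ nw v (ext r u S (p n)) <= K].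

Section OneOperator.
Variables (r : nat) (B : R) (S S' : (X -> R) -> X -> R) (u v : X -> R).
Hypotheses (N0 : (0 < N)%N) (lp : local_pair r B S S').
Hypotheses (hu : weight u) (iu : Li u) (hv : weight v).
Local Notation Tu := (ext r u S).

Lemma ext_sub p q : Lw u p -> Lw u q ->
  {ae mu, forall x, Tu (fun y => p y - q y) x = Tu p x - Tu q x}.
Proof.
move=> hp hq; have := ext_lin hu iu N0 lp (-1) hq hp; apply: filterS => x.
have -> : (fun y => -1 * q y + p y) = (fun y => p y - q y) by apply/funext => y; ring.
by move=> ->; ring.
Qed.

Lemma ext_sum (I : finType) (a : I -> R) (p : I -> X -> R) : (forall i, Lw u (p i)) ->
  {ae mu, forall x, Tu (fun y => \sum_i a i * p i y) x = \sum_i a i * Tu (p i) x}.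
Proof.
move=> hp; suff : forall s : seq I, Lw u (fun y => \sum_(i <- s) a i * p i y) /\
   {ae mu, forall x, Tu (fun y => \sum_(i <- s) a i * p i y) x = \sum_(i <- s) a i * Tu (p i) x}.
  by move=> /(_ (index_enum I))[].
elim=> [|i s [ih1 ih2]].
  have -> : (fun x => \sum_(i <- [::]) a i * p i x) = (fun=> 0).
    by apply/funext => x; rewrite big_nil.
  have h0 := Lw0 mu u; split => //.
  have := ext_sub h0 h0; apply: filterS => x e.
  rewrite big_nil -[RHS](subrr (Tu (fun=> 0) x)) -e.
  by congr (ext _ _ _ _ x); apply/funext => y; rewrite subrr.
have -> : (fun x => \sum_(j <- i :: s) a j * p j x) = (fun x => a i * p i x + \sum_(j <- s) a j * p j x).
  by apply/funext => x; rewrite big_cons.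
split; first by apply: LwD => //; exact: LwZ.
have := ext_lin hu iu N0 lp (a i) (hp i) ih1; apply: filterS2 ih2 => x e1 ->.
by rewrite big_cons e1.
Qed.

Lemma ext_cvg (p : nat -> X -> R) f k : (forall n, Lw u (p n)) -> Lw u f ->
  nw u (fun x => p n x - f x) @[n --> \oo] --> 0 ->
  nw \1_(good r u k) (fun x => Tu (p n) x - Tu f x) @[n --> \oo] --> 0.
Proof.
move=> hp hf c.
pose C := B * Num.sqrt (2 ^+ N * k.+1%:R).
apply: (@squeeze_cvgr _ _ _ _ (fun=> 0) (fun n => C * nw u (fun x => p n x - f x))).
- apply: nearW => n; rewrite nw_ge0/=.
  have hd := LwB hu (hp n) hf.
  have [h1 h2] := ext_bound hu iu N0 lp k hd.
  apply: le_trans h2; rewrite le_eqVlt; apply/orP; left; apply/eqP.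
  have mp := measurable_ext hu iu N0 lp (hp n); have mf := measurable_ext hu iu N0 lp hf.
  apply: nw_ae.
  + by have mg := measurable_good r u k; split => // x; rewrite indicE.
  + exact: measurable_funB.
  + exact: (measurable_ext hu iu N0 lp hd).
  + by have := ext_sub (hp n) hf; apply: filterS => x ->.
- exact: cvg_cst.
- by rewrite -[X in _ --> X](mulr0 C); apply: cvgMr.
Qed.

Section Limit.
Variables (p : nat -> X -> R) (f : X -> R) (K : R).
Hypotheses (hp : forall n, Lw u (p n)) (hf : Lw u f).
Hypothesis c : nw u (fun x => p n x - f x) @[n --> \oo] --> 0.
Hypothesis hv' : forall n, Lw v (Tu (p n)) /\ nw v (Tu (p n)) <= K.

Let mE k : measurable (good r u k).
Proof. exact: measurable_good. Qed.

Lemma ext_limit_bound : Lw v (Tu f) /\ nw v (Tu f) <= K.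
Proof.
apply: (@exhaustion_bound _ _ _ mu (good r u) v hv mE _ (good_total r u) (fun n => Tu (p n)) (Tu f) K).
- by move=> k l; exact: good_nd.
- by move=> n; case: (hv' n).
- by move=> n k; case: (ext_bound hu iu N0 lp k (hp n)).
- by move=> k; case: (ext_bound hu iu N0 lp k hf).
- by move=> k; exact: ext_cvg.
- by move=> n; case: (hv' n).
Qed.

Lemma ext_limit_weak g : Lw v g -> ipw v (Tu (p n)) g @[n --> \oo] --> ipw v (Tu f) g.
Proof.
move=> hg.
apply: (@exhaustion_weak _ _ _ mu (good r u) v hv mE _ (good_total r u) (fun n => Tu (p n)) (Tu f) K).
- by move=> k l; exact: good_nd.
- by move=> n; case: (hv' n).
- by move=> n k; case: (ext_bound hu iu N0 lp k (hp n)).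
- by move=> k; case: (ext_bound hu iu N0 lp k hf).
- by move=> k; exact: ext_cvg.
- by move=> n; case: (hv' n).
- exact: hg.
Qed.

End Limit.

Lemma approximable_bound f K : Lw u f -> approximable r S u v f K -> Lw v (Tu f) /\ nw v (Tu f) <= K.
Proof. move=> hf [p [hp _ c hK]]; exact: ext_limit_bound c hK. Qed.

End OneOperator.

Section Duality.
Variables (r : nat) (B : R) (S S' : (X -> R) -> X -> R) (u v : X -> R).
Hypotheses (N0 : (0 < N)%N) (lp : local_pair r B S S').
Hypotheses (hu : weight u) (iu : Li u) (hv : weight v) (iv : Li v).

(** For the approximating functions this is the adjoint relation in L^2. The
    uniform bounds allow passing to the weak limit in f and then in g. *)
Lemma ext_duality f g K K' : Lw u f -> Lw v g ->
  approximable r S u v f K -> approximable r S' v u g K' ->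
  ipw v (ext r u S f) g = ipw u f (ext r v S' g).
Proof.
move=> hf hg af ag; have lp' := local_pair_sym lp.
have [hTf _] := approximable_bound N0 lp hu iu hv hf af.
have [hTg _] := approximable_bound N0 lp' hv iv hu hg ag.
case: af => p [hp Lp cp Tp]; case: ag => q [hq Lq cq Tq].
have e0 n m : ipw v (ext r u S (p n)) (q m) = ipw u (p n) (ext r v S' (q m)).
  have e1 := ext_L2 hu iu N0 lp (hp n) (Lp n).
  have e2 := ext_L2 hv iv N0 lp' (hq m) (Lq m).
  have [mS _] := lp_mem lp (Lp n); have [mS' _] := lp_mem' lp (Lq m).
  have -> : ipw v (ext r u S (p n)) (q m) = ipw (fun=> 1) (S (fun x => u x * p n x)) (fun x => v x * q m x).
    rewrite -[LHS](@ipw_ae _ _ _ mu v hv (S (fun x => u x * p n x)) _ (q m) (q m)) //.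
    - by apply: eqJ => x; ring.
    - exact: (measurable_ext hu iu N0 lp (hp n)).
    - by case: (hq m).
    - by case: (hq m).
    - by apply: filterS e1 => x ->.
    - exact: aeW.
  have -> : ipw u (p n) (ext r v S' (q m)) = ipw (fun=> 1) (fun x => u x * p n x) (S' (fun x => v x * q m x)).
    rewrite -[LHS](@ipw_ae _ _ _ mu u hu (p n) (p n) (S' (fun x => v x * q m x)) _) //.
    - by apply: eqJ => x; ring.
    - by case: (hp n).
    - by case: (hp n).
    - exact: (measurable_ext hv iv N0 lp' (hq m)).
    - exact: aeW.
    - by apply: filterS e2 => x ->.
  exact: (lp_adj lp).
have e1 m : ipw v (ext r u S f) (q m) = ipw u f (ext r v S' (q m)).
  have c1 := ext_limit_weak N0 lp hu iu hv hp hf cp Tp (hq m).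
  have c2 := ipw_cvg hu hp hf (Tq m).1 cp.
  have e : (fun n => ipw v (ext r u S (p n)) (q m)) = (fun n => ipw u (p n) (ext r v S' (q m))).
    by apply/funext => n; exact: e0.
  rewrite e in c1; have h1 := cvg_lim (@Rhausdorff R) c1.
  by have h2 := cvg_lim (@Rhausdorff R) c2; rewrite -h1 -h2.
have c1 := ext_limit_weak N0 lp' hv iv hu hq hg cq Tq hf.
have c2 := ipw_cvg hv hq hg hTf cq.
have e2 : ipw v g (ext r u S f) = ipw u (ext r v S' g) f.
  have e : (fun m => ipw v (q m) (ext r u S f)) = (fun m => ipw u (ext r v S' (q m)) f).
    by apply/funext => m; rewrite ipwC e1 ipwC.
  rewrite e in c2; have h1 := cvg_lim (@Rhausdorff R) c1.
  by have h2 := cvg_lim (@Rhausdorff R) c2; rewrite -h1 -h2.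
by rewrite ipwC e2 ipwC.
Qed.

End Duality.
End Testing.

(** * The finite tree of a centred box *)

Section Leaves.
Context {R : realType} {N : nat}.
Local Notation X := (Rn R N).
Local Notation cube := (@Defs.cube R N).
Variables (n k : nat).
Local Notation I := {ffun 'I_N -> 'I_(2 ^ n.+1)}.
Implicit Types (i j d : nat) (x y w : I).

Definition leaf_origin : N.-tuple int := [tuple - (2 ^ n)%N%:Z | _ < N].
(** These cubes of side 2^(-k) tile the box [-2^(n-k), 2^(n-k))^N. *)
Definition leaf x : dyadic N := grid (- k%:Z) leaf_origin x.

(** A cell of generation j is named by one of its leaves, so that one finite
    type serves all generations. The leaf selected depends on the cell only,
    since [pick] depends on the predicate only. *)
Definition label j x : I := odflt x [pick y | anc j (leaf y) == anc j (leaf x)].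

Lemma label_anc j x : anc j (leaf (label j x)) = anc j (leaf x).
Proof. by rewrite /label; case: pickP => [y /eqP //|/(_ x)]; rewrite eqxx. Qed.

Lemma labelP j x y : label j x = label j y <-> anc j (leaf x) = anc j (leaf y).
Proof.
split => [e|e]; first by rewrite -label_anc e label_anc.
rewrite /label e; case: pickP => [//|/(_ y)]; by rewrite eqxx.
Qed.

Lemma leaf_inj : injective leaf.
Proof. exact: grid_inj. Qed.

Lemma label_inj : injective (label 0).
Proof. by move=> x y /labelP; rewrite !anc0 => /leaf_inj. Qed.

Lemma label_nest j x y : label j x = label j y -> label j.+1 x = label j.+1 y.
Proof. by move=> /labelP e; apply/labelP; rewrite -add1n !ancD e. Qed.

(** At generation n each cube fills the part of the box in one orthant. *)
Lemma top_coord x t : exists b : bool, tnth (anc n (leaf x)).2 t = - (b : nat)%:Z.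
Proof.
rewrite !tnth_mktuple; set p := (2 ^ n)%N.
have p0 : (0 < p)%N by rewrite expn_gt0.
have xp : (x t < p + p)%N by rewrite addnn -mul2n -expnS.
have pZ : (p%:Z : int) != 0 by rewrite gt_eqF.
case: (leqP p (x t)) => h; [exists false|exists true].
  rewrite divz_small//; lia.
have -> : - p%:Z + x t = (-1) * p%:Z + x t by lia.
by rewrite divzMDl// divz_small ?addr0//; lia.
Qed.

(** Beyond generation n cells never merge, because a dyadic cube stays inside one
    orthant; the top generation of the tree has 2^N cells. *)
Lemma label_top j x y : (n <= j)%N -> label j x = label j y -> label n x = label n y.
Proof.
move=> nj /labelP; rewrite -(subnK nj) !ancD => e; apply/labelP.
rewrite [LHS]surjective_pairing [RHS]surjective_pairing; congr pair => //.
apply: eq_from_tnth => t.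
have := congr1 (fun S : dyadic N => tnth S.2 t) e; rewrite ![tnth (anc (j - n) _).2 t]tnth_mktuple.
have [b ->] := top_coord x t; have [b' ->] := top_coord y t.
have p0 : (0 < 2 ^ (j - n))%N by rewrite expn_gt0.
have pZ : ((2 ^ (j - n))%N%:Z : int) != 0 by rewrite gt_eqF.
have h (c : bool) : ((- (c : nat)%:Z) %/ (2 ^ (j - n))%N%:Z)%Z = - (c : nat)%:Z.
  case: c => /=; last by rewrite oppr0 div0z.
  set p := (2 ^ (j - n))%N in p0 pZ *.
  have -> : - 1%N%:Z = (-1) * p%:Z + (p%:Z - 1) by lia.
  by rewrite divzMDl// divz_small; lia.
by rewrite !h.
Qed.

Lemma card_desc i d w : (#|[set label i x | x in [set x | label (i + d) x == w]]%SET| <= (2 ^ N) ^ d)%N.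
Proof.
have [/existsP[x0 /eqP x0w]|/existsPn h] := boolP [exists x, label (i + d) x == w]; last first.
  by rewrite (_ : [set x | _]%SET = finset.set0) ?imset0 ?cards0//; apply/finset.setP => x; rewrite !inE; apply/negbTE.
pose Q := anc (i + d) (leaf x0).
pose g (idx : {ffun 'I_N -> 'I_(2 ^ d)}) : I :=
  if [pick y | anc i (leaf y) == desc d Q idx] is Some y then label i y else x0.
apply: (@leq_trans #|[set g idx | idx in [set: {ffun 'I_N -> 'I_(2 ^ d)}]]%SET|).
  apply: subset_leq_card; apply/fintype.subsetP => y /imsetP[x]; rewrite inE => /eqP xw ->.
  have e : anc (i + d) (leaf x) = Q by apply/labelP; rewrite xw x0w.
  have [idx hidx] : exists idx, anc i (leaf x) = desc d Q idx.
    apply: (@desc_level R N); last by rewrite -e /=; lia.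
    by rewrite -e addnC ancD; exact: cube_sub_anc.
  apply/imsetP; exists idx; first by rewrite inE.
  rewrite /g; case: pickP => [z /eqP zi|/(_ x)]; last by rewrite hidx eqxx.
  by apply/labelP; rewrite zi.
apply: leq_trans (leq_imset_card _ _) _.
by rewrite cardsT card_ffun !card_ord -!expnM mulnC.
Qed.

Lemma card_top : (#|[set label n x | x in [set: I]]%SET| <= 2 ^ N)%N.
Proof.
have e0 : (0 < 2 ^ n.+1)%N by rewrite expn_gt0.
pose g (b : {ffun 'I_N -> bool}) : I :=
  if [pick y : I | [forall t, tnth (anc n (leaf y)).2 t == - (b t : nat)%:Z]] is Some y
  then label n y else [ffun => Ordinal e0].
apply: (@leq_trans #|[set g b | b in [set: {ffun 'I_N -> bool}]]%SET|).
  apply: subset_leq_card; apply/fintype.subsetP => y /imsetP[x _ ->].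
  pose b := [ffun t => sval (cid (top_coord x t))].
  have hb t : tnth (anc n (leaf x)).2 t = - (b t : nat)%:Z.
    by rewrite ffunE; exact: (svalP (cid (top_coord x t))).
  apply/imsetP; exists b; first by rewrite inE.
  rewrite /g; case: pickP => [z /forallP hz|/(_ x)/negP[]]; last by apply/forallP => t; rewrite hb.
  apply/labelP; rewrite [LHS]surjective_pairing [RHS]surjective_pairing; congr pair => //.
  by apply: eq_from_tnth => t; rewrite hb (eqP (hz t)).
apply: leq_trans (leq_imset_card _ _) _.
by rewrite cardsT card_ffun card_bool card_ord.
Qed.

Definition region : set X := \bigcup_x cube (leaf x).

Lemma measurable_region : measurable region.
Proof. by apply: fin_bigcup_measurable => [|x _]; [exact: finite_finset|exact: measurable_cube]. Qed.

Lemma regionP (x : X) : region x <-> forall t, - (2 ^ n)%N%:R <= tnth x t * 2 ^+ k < (2 ^ n)%N%:R.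
Proof.
have e (t : 'I_N) : tnth x t / 2 ^ (- k%:Z) = tnth x t * 2 ^+ k.
  by rewrite -invr_expz invrK.
split.
  move=> [i _ /cubeP /= h] t; have := congr1 (fun s => tnth s t) h; rewrite !tnth_mktuple e => e1.
  have := floor_itv (tnth x t * 2 ^+ k); rewrite e1.
  have hi : (i t < 2 * 2 ^ n)%N by rewrite -expnS; exact: ltn_ord.
  set p := (2 ^ n)%N in hi *; move=> /andP[h1 h2].
  apply/andP; split.
    have -> : - p%:R = (- p%:Z)%:~R :> R by rewrite mulrNz.
    by apply: le_trans h1; rewrite ler_int; lia.
  by apply: lt_le_trans h2 _; rewrite -[p%:R]/(p%:Z%:~R) ler_int; lia.
move=> h; suff [s hs] : exists s, cube (@grid N (- k%:Z) leaf_origin (2 ^ n.+1) s) x by exists s.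
apply: gridP.
move=> t; rewrite !tnth_mktuple e; have /andP[h1 h2] := h t.
apply/andP; split.
  by rewrite floor_ge_int intrN.
rewrite floor_lt_int; apply: lt_le_trans h2 _; rewrite -[(2 ^ n)%N%:R]/((2 ^ n)%N%:Z%:~R) ler_int.
by rewrite expnS; lia.
Qed.

Lemma region_leaf x : cube (leaf x) `<=` region.
Proof. by move=> z xz; exists x. Qed.

Lemma region_anc j x : (j <= n)%N -> cube (anc j (leaf x)) `<=` region.
Proof.
move=> jn; have -> : cube (anc j (leaf x)) `<=` region <-> forall z, cube (anc j (leaf x)) z -> region z by [].
move=> z /(cube_anc (n - j)); rewrite -ancD subnK// => zx; apply/regionP => t.
have := zx t; have [b ->] := top_coord x t.
have -> : (2 : R) ^ (anc n (leaf x)).1 = 2 ^+ n / 2 ^+ k.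
  by rewrite /= addrC expfzDr ?pnatr_eq0// -invr_expz.
have k0 : 0 < 2 ^+ k :> R by rewrite exprn_gt0.
rewrite !mulrA ler_pdivrMr// ltr_pdivlMr// natrX => /andP[h1 h2].
have n0 : 0 < 2 ^+ n :> R by rewrite exprn_gt0.
by apply/andP; split; [apply: le_trans h1|apply: lt_le_trans h2 _]; case: (b); rewrite /= ?mulr1z; lra.
Qed.

Lemma ind_class j x (z : X) : (j <= n)%N ->
  \sum_(y : I | label j y == label j x) (\1_(cube (leaf y)) z : R) = \1_(cube (anc j (leaf x))) z.
Proof.
move=> jn; have jP y : (label j y == label j x) = (anc j (leaf y) == anc j (leaf x)).
  by apply/eqP/eqP => /labelP.
under eq_bigl do rewrite jP.
rewrite [RHS]indicE; case: (boolP (z \in cube (anc j (leaf x)))) => [/set_mem|/negP] h; last first.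
  apply: big1 => y /eqP e; rewrite indicE memNset// => yz; apply: h; apply/mem_set.
  by rewrite -e; exact: cube_anc.
have [y _ yz] := region_anc jn h.
rewrite (bigD1 y)/=; last by apply/eqP/(cube_eq _ (cube_anc j yz) h).
rewrite indicE mem_set// big1 ?addr0// => s /andP[_ sy].
rewrite indicE memNset// => sz; move/eqP: sy; apply.
by apply: leaf_inj; apply: (cube_eq _ sz yz).
Qed.

End Leaves.

(** * The matrix of the extension on the leaves *)

Section BoxMatrix.
Context {R : realType} {N : nat}.
Local Notation X := (Rn R N).
Local Notation mu := (Defs.lebesgue_measureN R N).
Local Notation cube := (@Defs.cube R N).
Local Notation Li := (Li mu).
Local Notation J := (J mu).
Local Notation Lw := (Lw mu).
Local Notation nw := (nw mu).
Local Notation ipw := (ipw mu).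
Local Notation L2r := (Lw (fun=> 1)).
Variables (n k : nat).
Local Notation I := {ffun 'I_N -> 'I_(2 ^ n.+1)}.
Local Notation leaf := (@leaf N n k).
Local Notation label := (@label N n k).
Implicit Types (x y z : I) (t : X).

Definition comb (f : I -> R) t : R := \sum_x f x * \1_(cube (leaf x)) t.
Definition leaf_mass (w : X -> R) x : R := J (fun t => \1_(cube (leaf x)) t * w t).

Lemma comb_leaf f x t : cube (leaf x) t -> comb f t = f x.
Proof.
move=> xt; rewrite /comb (bigD1 x)//= indicE mem_set// mulr1 big1 ?addr0// => y yx.
rewrite indicE memNset ?mulr0// => yt; move/eqP: yx; apply.
exact: leaf_inj (cube_eq _ yt xt).
Qed.

Lemma comb_out f t : ~ region n k t -> comb f t = 0.
Proof.
move=> h; apply: big1 => x _; rewrite indicE memNset ?mulr0// => xt; apply: h.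
exact: region_leaf xt.
Qed.

Lemma step_comb (F : X -> R) t : step k F -> region n k t ->
  comb (fun x => F (corner (leaf x))) t = F t.
Proof.
move=> sF [x _ xt]; rewrite (comb_leaf _ xt); apply: sF.
have := cube_corner (R := R) (leaf x); move/cubeP: xt => /= ->; by move/cubeP => /= ->.
Qed.

Section Weight.
Variable w : X -> R.
Hypotheses (hw : weight w) (iw : Li w).

Lemma leaf_mass_ge0 x : 0 <= leaf_mass w x.
Proof. by apply: J_ge0 => t; rewrite mulr_ge0 ?indicE//; case: hw. Qed.

Lemma Lw_leaf x : Lw w \1_(cube (leaf x)).
Proof. exact: (Lw_indic hw iw (measurable_cube _)). Qed.

Lemma Lw_comb f : Lw w (comb f).
Proof. by apply: Lw_sum => // x; apply: LwZ; exact: Lw_leaf. Qed.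

Lemma J_comb f : J (fun t => w t * comb f t) = \sum_x leaf_mass w x * f x.
Proof.
transitivity (J (fun t => \sum_x f x * (\1_(cube (leaf x)) t * w t))).
  by apply: eqJ => t; rewrite mulr_sumr; apply: eq_bigr => x _; ring.
rewrite J_sum => [|x]; last by apply: LiZ; apply: Li_ind => //; exact: measurable_cube.
apply: eq_bigr => x _; rewrite JZ 1?mulrC//.
by apply: Li_ind => //; exact: measurable_cube.
Qed.

Lemma nw_comb f : nw w (comb f) = wnorm (leaf_mass w) f.
Proof.
congr Num.sqrt; rewrite /ipw /wip.
transitivity (J (fun t => w t * comb (fun x => f x * f x) t)).
  apply: eqJ => t; rewrite -mulrA; congr (_ * _).
  have [[x _ xt]|h] := pselect (region n k t); last by rewrite !comb_out ?mulr0.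
  by rewrite !(comb_leaf _ xt).
by rewrite J_comb; apply: eq_bigr => x _; rewrite mulrA.
Qed.

Lemma mass_class j x : (j <= n)%N ->
  mass label (leaf_mass w) j (label j x) = J (fun t => \1_(cube (anc j (leaf x))) t * w t).
Proof.
move=> jn; rewrite /mass big_mkcond.
transitivity (\sum_y leaf_mass w y * (label j y == label j x)%:R).
  by apply: eq_bigr => y _; case: ifP; rewrite ?mulr1 ?mulr0.
rewrite -J_comb; apply: eqJ => t; rewrite mulrC; congr (_ * _).
rewrite -ind_class// /comb [RHS]big_mkcond; apply: eq_bigr => y _.
by case: ifP; rewrite ?mul1r ?mul0r.
Qed.

Lemma ipw_combr h g : Lw w h -> ipw w h (comb g) = \sum_y ipw w h \1_(cube (leaf y)) * g y.
Proof.
move=> hh; transitivity (J (fun t => \sum_y g y * (w t * h t * \1_(cube (leaf y)) t))).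
  by apply: eqJ => t; rewrite mulr_sumr; apply: eq_bigr => y _; ring.
rewrite J_sum => [|y]; last by apply: LiZ; apply: Lw_mul => //; exact: Lw_leaf.
by apply: eq_bigr => y _; rewrite JZ 1?mulrC//; apply: Lw_mul => //; exact: Lw_leaf.
Qed.

End Weight.

Section Operator.
Variables (r : nat) (B : R) (S S' : (X -> R) -> X -> R) (u v : X -> R) (c : R).
Hypotheses (N0 : (0 < N)%N) (lp : local_pair r B S S').
Hypotheses (hu : weight u) (iu : Li u) (hv : weight v) (iv : Li v) (c0 : 0 <= c).
Hypothesis tst : forall Q, cube Q `<=` region n k ->
  approximable r S u v \1_(cube Q) (c * Num.sqrt (J (fun t => \1_(cube Q) t * u t))).
Local Notation Tu := (ext r u S).

Definition leaf_matrix x y : R := ipw v (Tu \1_(cube (leaf x))) \1_(cube (leaf y)).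

Lemma Tu_leaf x : Lw v (Tu \1_(cube (leaf x))).
Proof. by have [] := approximable_bound N0 lp hu iu hv (Lw_leaf hu iu x) (tst (@region_leaf _ _ _ _ x)). Qed.

Lemma measurable_Tu p : Lw u p -> measurable_fun setT (Tu p).
Proof. exact: (measurable_ext hu iu N0 lp). Qed.

Lemma Tu_comb f : {ae mu, forall t, \sum_x f x * Tu \1_(cube (leaf x)) t = Tu (comb f) t}.
Proof.
have := ext_sum N0 lp hu iu f (Lw_leaf hu iu); apply: filterS => t <-; by [].
Qed.

Lemma Lw_Tu_comb f : Lw v (Tu (comb f)).
Proof.
apply: (Lw_ae hv (measurable_Tu (Lw_comb hu iu f)) (Tu_comb f)).
by apply: Lw_sum => // x; apply: LwZ; exact: Tu_leaf.
Qed.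

Lemma form_matrix f g : form leaf_matrix f g = ipw v (Tu (comb f)) (comb g).
Proof.
rewrite (ipw_combr hv iv _ (Lw_Tu_comb f)) /form exchange_big; apply: eq_bigr => y _ /=.
have -> : ipw v (Tu (comb f)) \1_(cube (leaf y)) = \sum_x f x * leaf_matrix x y.
  have h x : Lw v (fun t => f x * Tu \1_(cube (leaf x)) t) by apply: LwZ; exact: Tu_leaf.
  have my := Lw_leaf hv iv y.
  rewrite -(@ipw_ae _ _ _ mu v hv _ _ _ _ (Lw_sum hv h).1 _ my.1 my.1 (Tu_comb f)) //; last 2 first.
  - exact: measurable_Tu (Lw_comb hu iu f).
  - exact: aeW.
  transitivity (J (fun t => \sum_x f x * (v t * Tu \1_(cube (leaf x)) t * \1_(cube (leaf y)) t))).
    by apply: eqJ => t; rewrite mulr_sumr mulr_suml; apply: eq_bigr => x _; ring.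
  rewrite J_sum => [|x]; last by apply: LiZ; apply: Lw_mul => //; exact: Tu_leaf.
  by apply: eq_bigr => x _; rewrite JZ//; apply: Lw_mul => //; exact: Tu_leaf.
by rewrite mulr_suml.
Qed.

(** Up to generation n the indicator of a tree cell is that of a dyadic cube in
    the box, to which testing applies; beyond n the cells remain those of
    generation n. *)
Lemma matrix_testing : testing_form label (leaf_mass u) (leaf_mass v) leaf_matrix c.
Proof.
move=> j w g.
have [/existsP[x /eqP xw]|/existsPn h] := boolP [exists x, label j x == w]; last first.
  have -> : form leaf_matrix (cell R label j w) g = 0.
    by apply: big1 => x _; apply: big1 => y _; rewrite /cell (negbTE (h x)) !mul0r.
  by rewrite normr0 mulr_ge0 ?wnorm_ge0// mulr_ge0 ?sqrtr_ge0.
suff main j' : (j' <= n)%N -> (forall y, (label j y == w) = (label j' y == label j' x)) ->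
    `|form leaf_matrix (cell R label j w) g| <=
    c * Num.sqrt (mass label (leaf_mass u) j w) * wnorm (leaf_mass v) g.
  case: (leqP j n) => jn; first by apply: (main j) => // y; rewrite xw.
  apply: (main n) => // y; rewrite -xw; apply/eqP/eqP; first exact: label_top (ltnW jn).
  by apply: (@nest_le I I label (@label_nest N n k)); exact: ltnW.
move=> j'n e; pose Q := anc j' (leaf x).
have Qr : cube Q `<=` region n k by exact: region_anc.
have -> : mass label (leaf_mass u) j w = J (fun t => \1_(cube Q) t * u t).
  by rewrite -(mass_class iu)// /mass; apply: eq_bigl => y; rewrite e.
have cQ : comb (cell R label j w) = \1_(cube Q).
  apply/funext => t; rewrite -(ind_class _ _ _ j'n) /comb [RHS]big_mkcond; apply: eq_bigr => y _.
  by rewrite /cell e; case: ifP; rewrite ?mul1r ?mul0r.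
rewrite form_matrix cQ -nw_comb//.
have [h1 h2] := approximable_bound N0 lp hu iu hv (Lw_indic hu iu (measurable_cube Q)) (tst Qr).
apply: le_trans (ipw_CS hv h1 (Lw_comb hv iv g)) _.
by apply: ler_wpM2r => //; exact: nw_ge0.
Qed.

(** [ext_local] for the function that f defines; the roles of the variables are
    exchanged, so that this is the hypothesis for the dual form. *)
Lemma matrix_local : local_form label (leaf_mass u) (fun x y => leaf_matrix y x) r.
Proof.
move=> j y g f fy f0 gy.
have -> : form (fun x y => leaf_matrix y x) g f = form leaf_matrix f g.
  by rewrite /form [LHS]exchange_big; apply: eq_bigr => x _; apply: eq_bigr => z _; ring.
rewrite form_matrix; pose T := anc j.+1 (leaf y).
have in_anc i x t : cube (leaf x) t -> cube (anc i (leaf y)) t -> label i x = label i y.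
  by move=> xt yt; apply/labelP; apply: (cube_eq _ (cube_anc i xt) yt).
have hT t : ~ cube T t -> comb f t = 0.
  move=> Tt; apply: big1 => x _; have [xt|xt] := pselect (cube (leaf x) t); last first.
    by rewrite indicE memNset ?mulr0.
  rewrite fy ?mul0r//; apply/eqP => e; apply: Tt.
  by move/labelP: e => e; rewrite /T -e; exact: cube_anc.
have := ext_local hu iu N0 lp (Lw_comb hu iu f) hT; rewrite J_comb// => /(_ f0) loc.
rewrite -(@J0 _ _ R mu); apply: J_ae.
- apply: measurable_funM; last exact: (Lw_comb hv iv g).1.
  by apply: measurable_funM; [case: hv|exact: measurable_Tu (Lw_comb hu iu f)].
- exact: measurable_cst.
apply: filterS loc => t loc; have [tT|/loc ->] := pselect (cube (anc r T) t); last by rewrite mulr0 mul0r.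
have [[x _ xt]|h] := pselect (region n k t); last by rewrite (comb_out g h) mulr0.
rewrite (comb_leaf g xt) gy ?mulr0//; rewrite addnC; apply: (in_anc _ _ t) => //.
by rewrite ancD.
Qed.

End Operator.
End BoxMatrix.

(** * The theorem for weights supported in a box *)

Section BoxTheorem.
Context {R : realType} {N : nat}.
Local Notation X := (Rn R N).
Local Notation mu := (Defs.lebesgue_measureN R N).
Local Notation cube := (@Defs.cube R N).
Local Notation Li := (Li mu).
Local Notation J := (J mu).
Local Notation Lw := (Lw mu).
Local Notation nw := (nw mu).
Local Notation ipw := (ipw mu).
Local Notation L2r := (Lw (fun=> 1)).
Implicit Types (f g F G u v : X -> R) (k l n : nat) (t : X).

Definition centered_box (K : nat) : set X :=
  [set t : X | forall i, - 2 ^+ K <= tnth t i < 2 ^+ K].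

Lemma region_box K k : region (K + k) k = centered_box K.
Proof.
have k0 : 0 < 2 ^+ k :> R by rewrite exprn_gt0.
apply/seteqP; split => t.
  move=> /regionP h i; have := h i.
  by rewrite natrX exprD -mulNr ler_pM2r// ltr_pM2r.
move=> h; apply/regionP => i; have := h i.
by rewrite natrX exprD -mulNr ler_pM2r// ltr_pM2r.
Qed.

(** The constant of the finite theorem for trees with 2^N children. *)
Definition two_weight_const (r : nat) : R :=
  4 + (2 * r).+1%:R * Num.sqrt ((2 ^ N) ^ (2 * r).+1)%N%:R + Num.sqrt (2 ^ N)%N%:R.

Lemma two_weight_const_ge0 r : 0 <= two_weight_const r.
Proof. by rewrite /two_weight_const !addr_ge0// mulr_ge0// sqrtr_ge0. Qed.

(** Test with a function G close to H itself, for which the pairing with H is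
    almost the square of the norm. *)
Lemma nw_le_dual v H a : weight v -> Lw v H -> 0 <= a ->
  (forall e, 0 < e -> exists G, [/\ Lw v G, nw v (fun t => H t - G t) <= e &
     `|ipw v H G| <= a * nw v G]) -> nw v H <= a.
Proof.
move=> hv hH a0 hG; rewrite leNgt; apply/negP => lt.
set m := nw v H in lt *; have m0 : 0 < m by apply: le_lt_trans lt.
have ma : 0 < m + a by rewrite ltr_pwDl.
(* With this e, the inequality m^2 <= e (m + a) + a m below contradicts a < m. *)
have e0 : 0 < m * (m - a) / (2 * (m + a)) by rewrite divr_gt0 ?mulr_gt0 ?subr_gt0.
have [G [LG nG bG]] := hG _ e0; set e := _ / _ in e0 nG.
have hHG := LwB hv hH LG.
have G_le : nw v G <= m + e.
  have -> : G = (fun t => H t - (H t - G t)) by apply/funext => t; ring.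
  by apply: le_trans (nwB hv hH hHG) _; rewrite lerD2l.
have : m ^+ 2 <= e * m + a * (m + e).
  rewrite /m sqr_nw// {1}(_ : H = fun t => (H t - G t) + G t); last by apply/funext => t; ring.
  rewrite ipwDl//; apply: lerD.
    apply: le_trans (ler_norm _) _; apply: le_trans (ipw_CS hv hHG hH) _.
    by apply: ler_wpM2r => //; exact: nw_ge0.
  rewrite ipwC; apply: le_trans (ler_norm _) _; apply: le_trans bG _.
  by apply: ler_wpM2l.
have -> : e * m + a * (m + e) = e * (m + a) + a * m by ring.
have -> : e * (m + a) = m * (m - a) / 2 by rewrite /e; field; rewrite gt_eqF.
have := mulr_gt0 m0 (_ : 0 < m - a); rewrite subr_gt0 => /(_ lt); lra.
Qed.

Section TwoWeights.
Variables (r : nat) (B : R) (S S' : (X -> R) -> X -> R) (u v : X -> R) (c : R) (K : nat).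
Hypotheses (N0 : (0 < N)%N) (lp : local_pair r B S S').
Hypotheses (hu : weight u) (iu : Li u) (hv : weight v) (iv : Li v) (c0 : 0 <= c).
Hypothesis usupp : forall t, ~ centered_box K t -> u t = 0.
Hypothesis vsupp : forall t, ~ centered_box K t -> v t = 0.
Hypothesis tst : forall Q, cube Q `<=` centered_box K ->
  approximable r S u v \1_(cube Q) (c * Num.sqrt (J (fun t => \1_(cube Q) t * u t))).
Hypothesis tst' : forall Q, cube Q `<=` centered_box K ->
  approximable r S' v u \1_(cube Q) (c * Num.sqrt (J (fun t => \1_(cube Q) t * v t))).
Local Notation Tu := (ext r u S).
Local Notation A := (two_weight_const r).

Section Level.
Variable k : nat.
Let n := (K + k)%N.
Let lp' := local_pair_sym lp.

Let tstn Q : cube Q `<=` region n k ->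
  approximable r S u v \1_(cube Q) (c * Num.sqrt (J (fun t => \1_(cube Q) t * u t))).
Proof. by rewrite region_box; exact: tst. Qed.
Let tstn' Q : cube Q `<=` region n k ->
  approximable r S' v u \1_(cube Q) (c * Num.sqrt (J (fun t => \1_(cube Q) t * v t))).
Proof. by rewrite region_box; exact: tst'. Qed.

Let dual : (fun x y => @leaf_matrix R N n k r S u v y x) = @leaf_matrix R N n k r S' v u.
Proof.
apply/funext => x; apply/funext => y; rewrite /leaf_matrix.
rewrite (ext_duality N0 lp hu iu hv iv (Lw_leaf _ hu iu y) (Lw_leaf _ hv iv x) (tstn _) (tstn' _)).
- exact: ipwC.
- exact: region_leaf.
- exact: region_leaf.
Qed.

Lemma comb_bound (f g : {ffun 'I_N -> 'I_(2 ^ n.+1)} -> R) : Lw v (Tu (@comb R N n k f)) /\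
  `|ipw v (Tu (@comb R N n k f)) (@comb R N n k g)| <= A * c * nw u (@comb R N n k f) * nw v (@comb R N n k g).
Proof.
split; first exact: (Lw_Tu_comb N0 lp hu iu hv tstn f).
rewrite -(form_matrix N0 lp hu iu hv iv tstn) !nw_comb// /two_weight_const.
have D0 : (0 < 2 ^ N)%N by rewrite expn_gt0.
have tm := matrix_testing N0 lp hu iu hv iv c0 tstn.
have tm' := matrix_testing N0 lp' hv iv hu iu c0 tstn'; rewrite -dual in tm'.
have lm := matrix_local N0 lp hu iu hv iv tstn.
have lm' := matrix_local N0 lp' hv iv hu iu tstn'; rewrite -dual in lm'.
exact: (@well_localized_bound R _ _ (@label N n k) (@label_inj N n k) (@label_nest N n k)
  (leaf_mass k u) (leaf_mass k v) (leaf_matrix k r S u v) c r n (2 ^ N)%N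
  (leaf_mass_ge0 k hu) (leaf_mass_ge0 k hv) c0 D0 (fun j x y => @label_top N n k j x y)
  (@card_desc R N n k) (@card_top N n k) tm tm' lm' lm f g).
Qed.

End Level.

Lemma step_eq w k F t : (forall t, ~ centered_box K t -> w t = 0) -> step k F ->
  w t * @comb R N (K + k) k (fun x => F (corner (leaf k x))) t = w t * F t.
Proof.
move=> ws sF; have [bt|bt] := pselect (centered_box K t); last by rewrite ws// !mul0r.
by rewrite step_comb// region_box.
Qed.

(** The extension depends on the product u F only, and u vanishes off the box. *)
Lemma step_ext k F : step k F -> Tu (@comb R N (K + k) k (fun x => F (corner (leaf k x)))) = Tu F.
Proof.
move=> sF; apply/funext => t; rewrite /ext; congr (S (condop _ _ _) _).
by apply/funext => s; exact: step_eq.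
Qed.

Lemma step_form_bound k F G : step k F -> step k G -> Lw v (Tu F) /\
  `|ipw v (Tu F) G| <= A * c * nw u F * nw v G.
Proof.
move=> sF sG; pose f x := F (corner (@leaf N (K + k) k x)); pose g x := G (corner (@leaf N (K + k) k x)).
have := comb_bound f g; rewrite /f step_ext//; congr (_ /\ `|_| <= _ * _ * _).
- by apply: eqJ => t; rewrite mulrAC step_eq// mulrAC.
- by congr Num.sqrt; apply: eqJ => t; rewrite step_eq// mulrAC step_eq// mulrAC.
- by congr Num.sqrt; apply: eqJ => t; rewrite step_eq// mulrAC step_eq// mulrAC.
Qed.

Lemma step_norm_bound k F : step k F -> Lw v (Tu F) /\ nw v (Tu F) <= A * c * nw u F.
Proof.
move=> sF; have [hF _] := step_form_bound sF sF; split => //.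
apply: (nw_le_dual hv hF) => [|e e0].
  by rewrite !mulr_ge0 ?nw_ge0 ?two_weight_const_ge0.
have [l [G [sG LG Ge]]] := steps_dense hv iv hF e0.
exists G; split => //.
have [_] := step_form_bound (step_refine (leq_maxl k l) sF) (step_refine (leq_maxr k l) sG).
by [].
Qed.

(** The finite theorem bounds step functions at every scale by the same
    constant; density and [ext_limit_bound] do the rest. *)
Theorem box_theorem F : Lw u F -> Lw v (Tu F) /\ nw v (Tu F) <= A * c * nw u F.
Proof.
move=> LF; have Ac0 : 0 <= A * c by rewrite mulr_ge0 ?two_weight_const_ge0.
have main e : 0 < e -> Lw v (Tu F) /\ nw v (Tu F) <= A * c * (nw u F + e).
  move=> e0; have en m : 0 < e / m.+1%:R by rewrite divr_gt0.
  have h m : exists G, [/\ exists k, step k G, Lw u G & nw u (fun t => F t - G t) <= e / m.+1%:R].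
    by have [k [G [h1 h2 h3]]] := steps_dense hu iu LF (en m); exists G; split => //; exists k.
  pose p m := sval (cid (h m)).
  have hp m : [/\ exists k, step k (p m), Lw u (p m) & nw u (fun t => F t - p m t) <= e / m.+1%:R].
    exact: (svalP (cid (h m))).
  have nwC m : nw u (fun t => p m t - F t) = nw u (fun t => F t - p m t).
    by congr Num.sqrt; apply: eqJ => t; ring.
  apply: (ext_limit_bound N0 lp hu iu hv (p := p) (f := F)) => //.
  - by move=> m; case: (hp m).
  - apply: (@squeeze_cvgr _ _ _ _ (fun=> 0) (fun m => e * (m.+1%:R)^-1)).
    + by apply: nearW => m; rewrite nw_ge0/= nwC; case: (hp m).
    + exact: cvg_cst.
    + rewrite -[X in _ --> X](mulr0 e); apply: cvgMr; exact: cvg_harmonic.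
  - move=> m; have [[k sk] Lp pe] := hp m; have [h1 h2] := step_norm_bound sk; split => //.
    apply: le_trans h2 _; apply: ler_wpM2l => //.
    have -> : p m = (fun t => F t - (F t - p m t)) by apply/funext => t; ring.
    apply: le_trans (nwB hu LF (LwB hu LF Lp)) _; rewrite lerD2l; apply: le_trans pe _.
    by rewrite ler_pdivrMr// ler_peMr ?ler1n// ltW.
have [LT _] := main _ ltr01; split => //; apply/ler_addgt0Pr => e e0.
have d0 : 0 < A * c + 1 by rewrite ltr_wpDl.
have [_ h] := main _ (divr_gt0 e0 d0); apply: le_trans h _.
rewrite mulrDr lerD2l mulrCA ler_piMr ?(ltW e0)// ler_pdivrMr// mul1r.
lra.
Qed.

End TwoWeights.
End BoxTheorem.

(** * Exhaustion by boxes *)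

Section RealTwoWeight.
Context {R : realType} {N : nat}.
Local Notation X := (Rn R N).
Local Notation mu := (Defs.lebesgue_measureN R N).
Local Notation cube := (@Defs.cube R N).
Local Notation Li := (Li mu).
Local Notation J := (J mu).
Local Notation Lw := (Lw mu).
Local Notation nw := (nw mu).
Local Notation ipw := (ipw mu).
Local Notation L2r := (Lw (fun=> 1)).
Local Notation nr := (nw (fun=> 1)).
Local Notation bx := (@centered_box R N).
Implicit Types (f g F G u v : X -> R) (k l n K : nat) (x : X).
Let w1 : weight (fun _ : X => 1 : R) := weight1.

Lemma measurable_inv_ge0 g : measurable_fun setT g -> (forall x, 0 <= g x) ->
  measurable_fun setT (fun x => (g x)^-1).
Proof.
move=> mg g0; have -> : (fun x => (g x)^-1) = (fun x => g x `^ (-1)).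
  by apply/funext => x; rewrite powR_inv1.
by apply: (measurableT_comp (f := @powR R ^~ _)) => //; exact: measurable_powR.
Qed.

Lemma measurable_sqrt_ge0 g : measurable_fun setT g -> (forall x, 0 <= g x) ->
  measurable_fun setT (fun x => Num.sqrt (g x)).
Proof.
move=> mg g0; have -> : (fun x => Num.sqrt (g x)) = (fun x => g x `^ (2^-1)).
  by apply/funext => x; rewrite powR12_sqrt.
by apply: (measurableT_comp (f := @powR R ^~ _)) => //; exact: measurable_powR.
Qed.

Lemma measurable_centered_box K : measurable (bx K).
Proof. by rewrite -(region_box K 0); exact: measurable_region. Qed.

Lemma centered_box_nd : {homo bx : k l / (k <= l)%N >-> k `<=` l}.
Proof.
move=> k l kl x h i; have := h i; have : (2 ^+ k <= 2 ^+ l :> R) by rewrite ler_weXn2l// ler1n.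
by move=> le /andP[h1 h2]; apply/andP; split; [apply: le_trans h1; rewrite lerN2|apply: lt_le_trans le].
Qed.

Lemma centered_box_near x : \forall K \near \oo, bx K x.
Proof.
suff [K0 h] : exists K, bx K x by exists K0 => // K /= le; exact: centered_box_nd h.
pose m := (\max_(i < N) (Num.truncn `|tnth x i|).+1)%N.
exists m => i; have : `|tnth x i| < 2 ^+ m.
  apply: lt_le_trans (truncnS_gt _) _.
  apply: (@le_trans _ _ m%:R); last by rewrite -natrX ler_nat ltnW// ltn_expl.
  by rewrite ler_nat /m (@leq_bigmax _ (fun i => (Num.truncn `|tnth x i|).+1) i).
by rewrite ltr_norml => /andP[/ltW -> ->].
Qed.

(** Both readings of a testing condition: the sequence w is constantly u when u
    is square integrable on Q, and consists of truncations of u otherwise. *)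
Definition truncation_testing (S : (X -> R) -> X -> R) u v c Q := exists w : nat -> X -> R,
  [/\ forall n, measurable_fun setT (w n), forall n x, 0 <= w n x <= u x,
      forall x, w n x @[n --> \oo] --> u x, forall n, L2r (fun x => \1_(cube Q) x * w n x) &
      forall n, Lw v (S (fun x => \1_(cube Q) x * w n x)) /\
        nw v (S (fun x => \1_(cube Q) x * w n x)) <= c * Num.sqrt (J (fun x => \1_(cube Q) x * u x))].

Section Operator.
Variables (r : nat) (B : R) (S S' : (X -> R) -> X -> R) (u v : X -> R) (c : R).
Hypotheses (N0 : (0 < N)%N) (lp : local_pair r B S S') (hu : weight u) (hv : weight v).
Local Notation cut K w := (fun x => \1_(bx K) x * w x).

(** The functions w n / u on Q converge to the indicator of Q, and their product
    with u is w n, to which the testing bound applies. *)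
Lemma approximable_cut K Q : Li (cut K u) -> cube Q `<=` bx K ->
  truncation_testing S u v c Q -> approximable r S (cut K u) (cut K v) \1_(cube Q)
    (c * Num.sqrt (J (fun x => \1_(cube Q) x * (\1_(bx K) x * u x)))).
Proof.
move=> iu QK [w [mw wu wcv wL wT]].
have mb := measurable_centered_box K; have mQ := @measurable_cube R N Q.
have huK := weight_ind mb hu.
have u0 x : u x = 0 -> forall n, w n x = 0.
  by move=> e n; have := wu n x; rewrite e => h; apply/eqP; rewrite eq_le andbC.
have QuE x : \1_(cube Q) x * (\1_(bx K) x * u x) = \1_(cube Q) x * u x.
  have [Qx|Qx] := pselect (cube Q x); last by rewrite indicE memNset ?mul0r.
  by rewrite [X in X * u x]indicE mem_set ?mul1r//; exact: QK.
have -> : J (fun x => \1_(cube Q) x * (\1_(bx K) x * u x)) = J (fun x => \1_(cube Q) x * u x).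
  exact: eqJ.
pose p n x := \1_(cube Q) x * (w n x / u x).
have wu01 n x : 0 <= w n x / u x <= 1.
  have [e|e] := eqVneq (u x) 0; first by rewrite (u0 _ e) mul0r lexx ler01.
  have up : 0 < u x by rewrite lt_def e hu.2.
  by rewrite ler_pdivlMr// ler_pdivrMr// mul0r mul1r; exact: wu.
have up n x : \1_(bx K) x * u x * p n x = \1_(cube Q) x * w n x.
  have -> : \1_(bx K) x * u x * p n x = \1_(cube Q) x * (\1_(bx K) x * (u x * (w n x / u x))).
    by rewrite /p; ring.
  have -> : u x * (w n x / u x) = w n x.
    by have [e|e] := eqVneq (u x) 0; [rewrite (u0 _ e) mul0r mulr0|rewrite mulrC divfK].
  have [Qx|Qx] := pselect (cube Q x); last by rewrite indicE memNset ?mul0r.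
  by rewrite [\1_(bx K) x]indicE mem_set ?mul1r//; exact: QK.
have upE n : (fun x => \1_(bx K) x * u x * p n x) = (fun x => \1_(cube Q) x * w n x) by apply/funext.
have mp n : measurable_fun setT (p n).
  by apply: measurable_funM => //; apply: measurable_funM => //; apply: measurable_inv_ge0; case: hu.
have Lp n : Lw (cut K u) (p n).
  apply: (@Lw_bounded _ _ _ huK iu _ 1) => // x; have /andP[a b] := wu01 n x.
  by rewrite /p indicE normrM [`|w n x / _|]ger0_norm//; case: (_ \in _); rewrite /= ?normr1 ?normr0 ?mul1r ?mul0r.
exists p; split => //.
- by move=> n; rewrite upE.
- pose F n x := \1_(bx K) x * u x * (p n x - \1_(cube Q) x) * (p n x - \1_(cube Q) x).
  have mF n : measurable_fun setT (F n).
    have mpQ : measurable_fun setT (fun x => p n x - \1_(cube Q) x) by exact: measurable_funB.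
    by apply: measurable_funM => //; apply: measurable_funM => //; case: huK.
  have F0 x : F n x @[n --> \oo] --> (0 : R).
    have [Qx|Qx] := pselect (cube Q x); last first.
      rewrite (_ : (fun n => F n x) = fun=> 0); first exact: cvg_cst.
      by apply/funext => n; rewrite /F /p [\1_(cube Q) x]indicE memNset// mul0r subrr mulr0.
    have [e|e] := eqVneq (u x) 0.
      rewrite (_ : (fun n => F n x) = fun=> 0); first exact: cvg_cst.
      by apply/funext => n; rewrite /F e mulr0 !mul0r.
    have c1 : w n x / u x - 1 @[n --> \oo] --> (0 : R).
      have -> : (0 : R) = u x / u x - 1 by rewrite divff ?subrr.
      by apply: cvgB; [apply: cvgMl; exact: wcv|exact: cvg_cst].
    have -> : (fun n => F n x) = (fun n => (\1_(bx K) x * u x) * ((w n x / u x - 1) * (w n x / u x - 1))).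
      by apply/funext => n; rewrite /F /p [\1_(cube Q) x]indicE mem_set// mul1r mulrA.
    have -> : 0 = (\1_(bx K) x * u x) * (0 * 0) :> R by rewrite mulr0 mulr0.
    by apply: cvgMr; apply: cvgM.
  have Fu n x : `|F n x| <= \1_(bx K) x * u x.
    rewrite /F -!mulrA mulrA normrM [`|_ * u x|]ger0_norm; last by case: huK.
    rewrite ler_piMr//; first by case: huK.
    have /andP[a b] := wu01 n x; rewrite normrM -expr2 exprn_ile1// /p indicE.
    case: (_ \in _); rewrite /= ?mul1r ?mul0r ?subrr ?normr0// ler_norml; apply/andP; split; lra.
  have [_] := J_dct mF F0 iu Fu.
  rewrite J0 => h; have := continuous_cvg _ (@sqrt_continuous R 0) h.
  by rewrite sqrtr0; apply.
- move=> n; have [h1 h2] := wT n.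
  have hvK := weight_ind mb hv.
  have le1 x : \1_(bx K) x * v x <= 1 * v x.
    by rewrite mul1r ler_piMl ?hv.2// indicE; case: (_ \in _).
  have [h3 h4] := nw_weight_le hvK hv ler01 le1 h1.
  have e : {ae mu, forall x, S (fun x => \1_(cube Q) x * w n x) x = ext r (cut K u) S (p n) x}.
    have := ext_L2 huK iu N0 lp (Lp n); rewrite upE => /(_ (wL n)).
    by apply: filterS => x ->.
  have me := measurable_ext huK iu N0 lp (Lp n).
  set q := ext r (cut K u) S (p n) in e me *; set q' := S _ in e h1 h2 h3 h4.
  split; first exact: (@Lw_ae _ _ _ mu _ hvK q' q me e h3).
  have <- := @nw_ae _ _ _ mu _ hvK q' q h1.1 me e.
  by apply: le_trans h4 _; rewrite sqrtr1 mul1r.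
Qed.

End Operator.

Section Bound.
Variables (r : nat) (B : R) (S S' : (X -> R) -> X -> R) (u v : X -> R) (c : R).
Hypotheses (N0 : (0 < N)%N) (lp : local_pair r B S S') (c0 : 0 <= c).
Hypotheses (hu : weight u) (iu : forall K, Li (fun x => \1_(bx K) x * u x)).
Hypotheses (hv : weight v) (iv : forall K, Li (fun x => \1_(bx K) x * v x)).
Hypothesis tst : forall Q, truncation_testing S u v c Q.
Hypothesis tst' : forall Q, truncation_testing S' v u c Q.
Local Notation A := (@two_weight_const R N r).
Local Notation cut K w := (fun x => \1_(bx K) x * w x).
Let mb := measurable_centered_box.
Let lp' := local_pair_sym lp.

(** Substitute F = f / sqrt u in [box_theorem]. *)
Lemma box_bound K f : L2r f -> L2r (fun x => Num.sqrt (u x) * f x) ->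
  let g := S (fun x => \1_(bx K) x * (Num.sqrt (u x) * f x)) in
  Lw (cut K v) g /\ nw (cut K v) g <= A * c * nr f.
Proof.
move=> hf huf g.
have huK := weight_ind (mb K) hu; have hvK := weight_ind (mb K) hv.
pose F x := \1_(bx K) x * (f x / Num.sqrt (u x)).
have mF : measurable_fun setT F.
  apply: measurable_funM => //; apply: measurable_funM; first by case: hf.
  by apply: measurable_inv_ge0 => [|x]; [apply: measurable_sqrt_ge0; case: hu|exact: sqrtr_ge0].
have le x : \1_(bx K) x * u x * F x * F x <= 1 * f x * f x.
  have -> : \1_(bx K) x * u x * F x * F x = (\1_(bx K) x) ^+ 3 * (u x * (f x / Num.sqrt (u x)) ^+ 2).
    by rewrite /F; ring.
  have -> : u x * (f x / Num.sqrt (u x)) ^+ 2 = if u x == 0 then 0 else f x ^+ 2.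
    case: ifPn => [/eqP ->|e]; first by rewrite mul0r.
    have u0 := hu.2 x; rewrite exprMn exprVn sqr_sqrtr//.
    by rewrite mulrCA divff// mulr1.
  rewrite mul1r -expr2 indicE; case: (_ \in _); rewrite /= ?expr1n ?expr0n ?mul1r ?mul0r ?sqr_ge0//.
  by case: ifP; rewrite ?sqr_ge0.
have LF : Lw (cut K u) F.
  split => //; apply: Li_le hf.2.
    by apply: measurable_funM => //; apply: measurable_funM => //; case: huK.
  by move=> x; rewrite ger0_norm ?le// (w_sqr_ge0 huK).
have nF : nw (cut K u) F <= nr f by rewrite ler_wsqrtr// J_le//; [exact: LF.2|exact: hf.2].
have uF : (fun x => \1_(bx K) x * u x * F x) = (fun x => \1_(bx K) x * (Num.sqrt (u x) * f x)).
  apply/funext => x; rewrite /F indicE; case: (_ \in _); rewrite /= ?mul1r ?mul0r//.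
  have [->|e] := eqVneq (u x) 0; first by rewrite sqrtr0 !mul0r.
  have u0 : 0 <= u x by case: hu.
  rewrite -{1}(sqr_sqrtr u0) expr2; field; rewrite sqrtr_eq0 -ltNge lt_neqAle eq_sym e//.
have gE : {ae mu, forall x, ext r (cut K u) S F x = g x}.
  have := ext_L2 huK (iu K) N0 lp LF; rewrite uF; apply; exact: Lw_ind.
have supp (w : X -> R) x : ~ bx K x -> \1_(bx K) x * w x = 0 by move=> Kx; rewrite indicE memNset ?mul0r.
have [h1 h2] := box_theorem N0 lp huK (iu K) hvK (iv K) c0 (supp u) (supp v)
  (fun Q QK => approximable_cut N0 lp hu hv (iu K) QK (tst Q))
  (fun Q QK => approximable_cut N0 lp' hv hu (iv K) QK (tst' Q)) LF.
have mg : measurable_fun setT g by case: (lp_mem lp (Lw_ind w1 (mb K) huf)).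
split; first exact: (@Lw_ae _ _ _ mu _ hvK _ g mg gE h1).
have <- := @nw_ae _ _ _ mu _ hvK _ g h1.1 mg gE.
apply: le_trans h2 _; apply: ler_wpM2l => //.
by rewrite mulr_ge0// two_weight_const_ge0.
Qed.

(** As the box grows, S (sqrt u f) cut to the box is approached in L^2, so the
    bound for boxes passes to the limit by [exhaustion_bound]. *)
Theorem real_two_weight f : L2r f -> L2r (fun x => Num.sqrt (u x) * f x) ->
  Lw v (S (fun x => Num.sqrt (u x) * f x)) /\
  nw v (S (fun x => Num.sqrt (u x) * f x)) <= A * c * nr f.
Proof.
move=> hf; set g := (fun x => Num.sqrt (u x) * f x) => hg.
pose gK K x := \1_(bx K) x * g x.
have hgK K : L2r (gK K) by exact: Lw_ind.
have hS := lp_mem lp hg; have hSK K := lp_mem lp (hgK K).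
pose H K x := \1_(bx K) x * S (gK K) x.
have hH K : L2r (H K) by exact: Lw_ind.
have T1 : (\1_(setT : set X) : X -> R) = fun=> 1 by apply/funext => x; rewrite indicE mem_set.
have HE K : Lw v (H K) /\ nw v (H K) <= A * c * nr f.
  have [h1 h2] := box_bound K hf hg; have mH := (hH K).1.
  have e x : v x * H K x * H K x = \1_(bx K) x * v x * S (gK K) x * S (gK K) x.
    by rewrite /H indicE; case: (_ \in _); rewrite /= ?mul1r ?mul0r ?mulr0 ?mul0r.
  split.
    by split => //; rewrite (_ : (fun x => _) = (fun x => \1_(bx K) x * v x * S (gK K) x * S (gK K) x)); [case: h1|apply/funext].
  by apply: le_trans h2; rewrite le_eqVlt; apply/orP; left; apply/eqP; congr Num.sqrt; exact: eqJ.
apply: (@exhaustion_bound _ _ _ mu (fun=> setT) v hv (fun=> measurableT) (fun _ _ _ => @subset_refl _ _)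
  (fun x => ex_intro _ 0%N I) H) => //.
- by move=> n; case: (HE n).
- by move=> n k; rewrite T1.
- by move=> k; rewrite T1.
- move=> k; rewrite T1.
  have hd K : L2r (fun x => g x - gK K x) by exact: LwB.
  have hSd K := lp_mem lp (hd K).
  have hcut K : L2r (fun x => \1_(bx K) x * S g x) by exact: Lw_ind.
  apply: (@squeeze_cvgr _ _ _ _ (fun=> 0) (fun K => B * nr (fun x => g x - gK K x) +
     nr (fun x => S g x - \1_(bx K) x * S g x))).
  + apply: nearW => K; rewrite nw_ge0/=.
    have hI : L2r (fun x => \1_(bx K) x * (S g x - S (gK K) x)) by apply: Lw_ind => //; exact: LwB.
    have -> : nr (fun x => H K x - S g x) =
       nr (fun x => \1_(bx K) x * (S g x - S (gK K) x) + (S g x - \1_(bx K) x * S g x)).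
      by congr Num.sqrt; apply: eqJ => x; rewrite /H; ring.
    apply: le_trans (nwD w1 hI (LwB w1 hS (hcut K))) _; apply: lerD => //.
    apply: le_trans (lp_bd lp (hd K)).
    have hSB := LwB w1 hS (hSK K).
    apply: le_trans (nw_le w1 hI hSB _) _; first by move=> x; exact: norm_ind_le.
    rewrite le_eqVlt; apply/orP; left; apply/eqP; apply: (nw_ae w1); [by case: hSB|by case: (hSd K)|].
    by have := lp_sub lp hg (hgK K); apply: filterS => x ->.
  + exact: cvg_cst.
  + rewrite -[X in _ --> X](addr0 0); apply: cvgD.
      rewrite -[X in _ --> X](mulr0 B); apply: cvgMr.
      exact: (cut_cvg w1 mb centered_box_near hg).
    exact: (cut_cvg w1 mb centered_box_near hS).
- by move=> n; case: (HE n).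
Qed.

End Bound.
End RealTwoWeight.

Local Open Scope complex_scope.

(** * Complex square-integrable functions *)

Section ComplexL2.
Context {R : realType} {N : nat}.
Local Notation X := (Rn R N).
Local Notation mu := (Defs.lebesgue_measureN R N).
Local Notation cube := (@Defs.cube R N).
Local Notation Li := (Li mu).
Local Notation J := (J mu).
Local Notation Lw := (Lw mu).
Local Notation nw := (nw mu).
Local Notation ipw := (ipw mu).
Local Notation L2r := (Lw (fun=> 1)).
Local Notation nr := (nw (fun=> 1)).
Local Notation ip := (ipw (fun=> 1)).
Implicit Types (f g h : X -> R[i]) (p q u v w : X -> R).
Let w1 : weight (fun _ : X => 1 : R) := weight1.

Definition re f : X -> R := fun x => complex.Re (f x).
Definition im f : X -> R := fun x => complex.Im (f x).
Definition of_real p : X -> R[i] := fun x => (p x)%:C.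

Lemma sqr_normcE (z : R[i]) : normc z ^+ 2 = complex.Re z ^+ 2 + complex.Im z ^+ 2.
Proof. by case: z => a b; rewrite /normc sqr_sqrtr// addr_ge0// sqr_ge0. Qed.

(** Stated for arbitrary f, so that it applies to sqrt v T f before this is known
    to be square integrable. *)
Lemma L2normE f : L2norm f = ((\int[mu]_x (normc (f x) ^+ 2)%:E) `^ (2^-1))%E.
Proof.
rewrite /L2norm unlock; congr (_ `^ _)%E; apply: eq_integral => x _ /=.
by rewrite -[2]/(2%:R) powR_mulrn ?normr_ge0// real_normK// num_real.
Qed.

Lemma sqr_normc_parts f x : normc (f x) ^+ 2 = 1 * re f x * re f x + 1 * im f x * im f x.
Proof. by rewrite sqr_normcE !mul1r -!expr2. Qed.

Lemma integral_normc f : L2r (re f) -> L2r (im f) ->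
  (\int[mu]_x (normc (f x) ^+ 2)%:E = (nr (re f) ^+ 2 + nr (im f) ^+ 2)%:E)%E.
Proof.
move=> [_ hr] [_ hi]; under eq_integral do rewrite sqr_normc_parts.
by rewrite Li_EFin; [rewrite JD// !(sqr_nw mu w1)|exact: LiD].
Qed.

(** The L^2 norm as a real number. *)
Definition cnorm f : R := Num.sqrt (nr (re f) ^+ 2 + nr (im f) ^+ 2).

Lemma cnorm_ge0 f : 0 <= cnorm f. Proof. exact: sqrtr_ge0. Qed.

Lemma sqr_cnorm f : cnorm f ^+ 2 = nr (re f) ^+ 2 + nr (im f) ^+ 2.
Proof. by rewrite sqr_sqrtr// addr_ge0// sqr_ge0. Qed.

Lemma L2norm_parts f : L2r (re f) -> L2r (im f) -> L2norm f = (cnorm f)%:E.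
Proof.
move=> hr hi; rewrite L2normE integral_normc// poweR_EFin powR12_sqrt//.
by rewrite addr_ge0// sqr_ge0.
Qed.

Lemma L2P f : L2 f <-> L2r (re f) /\ L2r (im f).
Proof.
split=> [[mr mi fy]|[hr hi]]; last first.
  by split; [case: hr|case: hi|rewrite L2norm_parts// ltry].
have mn : measurable_fun setT (fun x => normc (f x) ^+ 2).
  rewrite (_ : (fun x => _) = (fun x => re f x * re f x + im f x * im f x)).
    by apply: measurable_funD; exact: measurable_funM.
  by apply/funext => x; rewrite sqr_normcE !expr2.
have hn : Li (fun x => normc (f x) ^+ 2).
  apply: Li_ge0 => //; first by move=> x; exact: sqr_ge0.
  rewrite ltey; apply/eqP => e; by move: fy; rewrite L2normE e poweRyr ?ltxx//.
split; split => //; apply: Li_le hn.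
- by do 2?apply: measurable_funM.
- by move=> x; rewrite sqr_normcE mul1r -expr2 ger0_norm ?sqr_ge0// lerDl sqr_ge0.
- by do 2?apply: measurable_funM.
- by move=> x; rewrite sqr_normcE mul1r -expr2 ger0_norm ?sqr_ge0// lerDr sqr_ge0.
Qed.

Lemma L2norm_cnorm f : L2 f -> L2norm f = (cnorm f)%:E.
Proof. by move=> /L2P[]; exact: L2norm_parts. Qed.


Lemma L2_of_real p : L2 (of_real p) <-> L2r p.
Proof. by split=> [/L2P[]//|hp]; apply/L2P; split => //; exact: Lw0. Qed.

Lemma cnorm_of_real p : cnorm (of_real p) = nr p.
Proof.
have -> : cnorm (of_real p) = Num.sqrt (nr p ^+ 2 + nr (fun=> 0) ^+ 2) by [].
have -> : nr (fun=> 0) = 0.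
  rewrite /nw /ipw (_ : (fun x => _) = (fun=> 0)) ?J0 ?sqrtr0//.
  by apply/funext => x; rewrite mulr0.
by rewrite expr0n/= addr0 sqrtr_sqr ger0_norm ?nw_ge0.
Qed.

Lemma le_cnorm f : nr (re f) <= cnorm f /\ nr (im f) <= cnorm f.
Proof.
split; rewrite -(ler_pXn2r (_ : 0 < 2)%N)// ?nnegrE ?nw_ge0 ?cnorm_ge0// sqr_cnorm.
  by rewrite lerDl sqr_ge0.
by rewrite lerDr sqr_ge0.
Qed.

Lemma L2inner_parts f g : L2 f -> L2 g -> L2inner f g =
  (ip (re f) (re g) + ip (im f) (im g)) +i* (ip (im f) (re g) - ip (re f) (im g)).
Proof.
move=> /L2P[fr fi] /L2P[gr gi]; rewrite /L2inner /cintegral.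
have h p q : L2r p -> L2r q -> Li (fun x => 1 * p x * q x) by exact: Lw_mul.
congr (_ +i* _).
  rewrite /ipw -JD; [|exact: h..].
  by apply: eqJ => x; rewrite /re /im; case: (f x) => a b; case: (g x) => c d /=; ring.
rewrite /ipw -JB; [|exact: h..].
by apply: eqJ => x; rewrite /re /im; case: (f x) => a b; case: (g x) => c d /=; ring.
Qed.

Lemma re_L2inner_le f g : L2 f -> L2 g -> complex.Re (L2inner f g) <= cnorm f * cnorm g.
Proof.
move=> hf hg; rewrite L2inner_parts//=; have [fr fi] := (L2P f).1 hf; have [gr gi] := (L2P g).1 hg.
have h1 := le_trans (ler_norm _) (ipw_CS w1 fr gr).
have h2 := le_trans (ler_norm _) (ipw_CS w1 fi gi).
apply: le_trans (lerD h1 h2) _.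
rewrite -(ler_pXn2r (_ : 0 < 2)%N)// ?nnegrE ?mulr_ge0 ?cnorm_ge0 ?addr_ge0 ?mulr_ge0 ?nw_ge0//.
rewrite exprMn !sqr_cnorm -subr_ge0.
set a := nr _; set b := nr _; set c := nr _; set d := nr _.
by rewrite (_ : _ - _ = (a * d - c * b) ^+ 2) ?sqr_ge0//; ring.
Qed.

End ComplexL2.

(** * Real and imaginary parts of a band operator *)

Section ComplexOperator.
Context {R : realType} {N : nat}.
Local Notation X := (Rn R N).
Local Notation mu := (Defs.lebesgue_measureN R N).
Local Notation cube := (@Defs.cube R N).
Local Notation Li := (Li mu).
Local Notation J := (J mu).
Local Notation Lw := (Lw mu).
Local Notation nw := (nw mu).
Local Notation ipw := (ipw mu).
Local Notation L2r := (Lw (fun=> 1)).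
Local Notation nr := (nw (fun=> 1)).
Local Notation ip := (ipw (fun=> 1)).
Implicit Types (f g h : X -> R[i]) (p q u v w : X -> R) (T : (X -> R[i]) -> X -> R[i]).
Let w1 : weight (fun _ : X => 1 : R) := weight1.

Definition re_op T p : X -> R := re (T (of_real p)).
Definition im_op T p : X -> R := im (T (of_real p)).
(** Needed for the adjoint of the imaginary part. *)
Definition neg_op (S : (X -> R) -> X -> R) p : X -> R := fun x => - S p x.

Lemma im_of_real p : im (of_real p) = fun=> 0. Proof. by []. Qed.

Lemma is_haar_of_real Q p : real_haar Q p -> is_haar Q (of_real p).
Proof.
move=> hp; split.
- by move=> x Qx; rewrite /of_real (rhaar_supp hp).
- move=> P /is_childP PQ x y Px Py; rewrite /of_real; congr (_%:C).
  exact: (rhaar_child hp PQ).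
- rewrite /cintegral /of_real /=.
  have -> : \int[mu]_(x in cube Q) p x = J p.
    rewrite Rintegral_mkcond; apply: eqJ => x; rewrite patchE.
    by case: ifPn => // /negP h; rewrite (rhaar_supp hp)// => Qx; apply: h; exact/mem_set.
  rewrite (rhaar_mean hp); congr (_ +i* _).
  by rewrite /Rintegral integral0.
Qed.

Section Band.
Variables (r : nat) (T T' : (X -> R[i]) -> X -> R[i]).
Hypotheses (band : band_operator r T) (adj : L2_adjoint T T').

Let T_mem f : L2 f -> L2 (T f). Proof. by case: band => -[h _ _] _; exact: h. Qed.
Let T'_mem f : L2 f -> L2 (T' f). Proof. by case: adj => h _; exact: h. Qed.

Lemma op_bound : exists2 B : R, 0 <= B & forall f, L2 f -> cnorm (T f) <= B * cnorm f.
Proof.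
case: band => -[_ _ [B hB]] _; exists (Num.max B 0); first by rewrite le_max lexx orbT.
move=> f hf; have := hB f hf; rewrite (L2norm_cnorm hf) (L2norm_cnorm (T_mem hf)) lee_fin => h.
apply: le_trans h _; apply: ler_wpM2r; first exact: cnorm_ge0.
by rewrite le_max lexx.
Qed.

Lemma re_inner_op p q : L2r p -> L2r q -> L2inner (T (of_real p)) (of_real q) =
  ip (re_op T p) q +i* ip (im_op T p) q.
Proof.
move=> hp hq; have hp' := (L2_of_real p).2 hp; have hq' := (L2_of_real q).2 hq.
have z0 s : ip s (fun=> 0) = 0.
  by rewrite /ipw (_ : (fun x => _) = (fun=> 0)) ?J0//; apply/funext => x; rewrite mulr0.
by rewrite (L2inner_parts (T_mem hp') hq') im_of_real !z0 addr0 subr0.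
Qed.

Lemma adj_inner_op p q : L2r p -> L2r q -> L2inner (T (of_real p)) (of_real q) =
  ip p (re_op T' q) +i* ip p (neg_op (im_op T') q).
Proof.
move=> hp hq; have hp' := (L2_of_real p).2 hp; have hq' := (L2_of_real q).2 hq.
have z0 s : ip (fun=> 0) s = 0.
  by rewrite /ipw (_ : (fun x => _) = (fun=> 0)) ?J0//; apply/funext => x; rewrite mulr0 mul0r.
rewrite (L2_adjoint_inner adj hp' hq') (L2inner_parts hp' (T'_mem hq')).
rewrite im_of_real !z0 addr0 add0r; congr (_ +i* _).
have hi := ((L2P _).1 (T'_mem hq')).2.
rewrite ipwC [RHS]ipwC -mulN1r -ipwZl//; congr (ipw _ _ _).
by apply/funext => x; rewrite mulN1r.
Qed.

Lemma band_haar P Q p q : real_haar P p -> real_haar Q q ->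
  ~ cube P `<=` cube (anc r Q) \/ ~ cube Q `<=` cube (anc r P) ->
  L2inner (T (of_real p)) (of_real q) = 0.
Proof.
move=> hp hq far; case: band => _; apply; [exact: is_haar_of_real hp|exact: is_haar_of_real hq|].
exact: d_tree_far.
Qed.

(** Separating <T p, q> = <p, T* q> into real and imaginary parts, for real p
    and q, shows that the adjoint of the imaginary part of T is minus the
    imaginary part of T*. *)
Lemma local_pair_parts : exists B,
  local_pair r B (re_op T) (re_op T') /\ local_pair r B (im_op T) (neg_op (im_op T')).
Proof.
have [B B0 hB] := op_bound; exists B.
have mT p : L2r p -> L2r (re_op T p) /\ L2r (im_op T p).
  by move=> hp; apply/L2P/T_mem/L2_of_real.
have mT' p : L2r p -> L2r (re_op T' p) /\ L2r (im_op T' p).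
  by move=> hp; apply/L2P/T'_mem/L2_of_real.
have bd p : L2r p -> cnorm (T (of_real p)) <= B * nr p.
  by move=> hp; rewrite -cnorm_of_real; apply: hB; exact/L2_of_real.
split; split=> //.
- by move=> p /mT[].
- by move=> p /mT'[].
- by move=> p q hp hq; have := re_inner_op hp hq; rewrite adj_inner_op// => -[].
- by move=> p hp; apply: le_trans (bd p hp); case: (le_cnorm (T (of_real p))).
- move=> P Q p q hp hq far; have := re_inner_op (L2_haar hp) (L2_haar hq).
  by rewrite (band_haar hp hq far) => -[].
- by move=> p /mT[].
- move=> p /mT'[_ /(LwZ (-1))]; congr (Lw _ _).
  by apply/funext => x; rewrite mulN1r.
- by move=> p q hp hq; have := re_inner_op hp hq; rewrite adj_inner_op// => -[].
- by move=> p hp; apply: le_trans (bd p hp); case: (le_cnorm (T (of_real p))).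
- move=> P Q p q hp hq far; have := re_inner_op (L2_haar hp) (L2_haar hq).
  by rewrite (band_haar hp hq far) => -[].
Qed.

Lemma op_split p q : L2r p -> L2r q -> {ae mu, forall x,
  re (T (fun y => p y +i* q y)) x = re_op T p x - im_op T q x /\
  im (T (fun y => p y +i* q y)) x = im_op T p x + re_op T q x}.
Proof.
move=> /L2_of_real hp /L2_of_real hq; case: band => -[_ lin _] _.
have := lin 'i%C _ _ hq hp.
have -> : (fun y => 'i%C * of_real q y + of_real p y) = (fun y => p y +i* q y).
  apply/funext => y; rewrite /of_real; simpc; congr (_ +i* _); ring.
apply: filterS => x; rewrite /re /im /re_op /im_op /re /im => ->.
case: (T (of_real q) x) => a b; case: (T (of_real p) x) => c d /=; split; ring.
Qed.

End Band.
End ComplexOperator.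

(** * Local integrability and the testing conditions *)

Section Integrability.
Context {R : realType} {N : nat}.
Local Notation X := (Rn R N).
Local Notation mu := (Defs.lebesgue_measureN R N).
Local Notation cube := (@Defs.cube R N).
Local Notation Li := (Li mu).
Local Notation J := (J mu).
Local Notation Lw := (Lw mu).
Local Notation nw := (nw mu).
Local Notation L2r := (Lw (fun=> 1)).
Local Notation nr := (nw (fun=> 1)).
Local Notation bx := (@centered_box R N).
Implicit Types (f g h : X -> R[i]) (p q u v w : X -> R) (T : (X -> R[i]) -> X -> R[i]).
Let w1 : weight (fun _ : X => 1 : R) := weight1.

Lemma L1loc_weight w : L1loc w -> (forall x, 0 <= w x) -> weight w.
Proof. by move=> [mw _]. Qed.

(** The closed box is compact, as a set of row vectors. *)
Lemma L1loc_box w (a b : 'I_N -> R) (A : set X) : L1loc w -> measurable A ->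
  (forall x, A x -> forall i, a i <= tnth x i <= b i) -> Li (fun x => \1_A x * w x).
Proof.
move=> [mw iw] mA Aab; pose K := [set x : X | forall i, a i <= tnth x i <= b i].
have mK : measurable K.
  rewrite (_ : K = \bigcap_(i in [set: 'I_N])
      ((fun x : X => tnth x i) @^-1` `[a i, b i]%classic)).
    apply: fin_bigcap_measurable; first exact: finite_finset.
    move=> i _; rewrite -[X in measurable X]setTI.
    by apply: measurable_tnth => //; exact: measurable_itv.
  apply/seteqP; split => x /= h i; first by move=> _; rewrite /= in_itv/=; exact: h.
  by have := h i I; rewrite /= in_itv.
have cK : compact ((fun x : X => (\row_i tnth x i : 'rV[R]_N)) @` K).
  rewrite (_ : _ @` K = [set y : 'rV[R]_N | forall i, `[a i, b i]%classic (y ord0 i)]).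
    by apply: (@rV_compact R N (fun i => `[a i, b i]%classic)) => i; exact: segment_compact.
  apply/seteqP; split => y /=.
    by move=> [x Kx <-] i; rewrite mxE /= in_itv; exact: Kx.
  move=> h; exists [tuple y ord0 i | i < N].
    by move=> i; rewrite tnth_mktuple; have := h i; rewrite /= in_itv.
  by apply/rowP => i; rewrite mxE tnth_mktuple.
have iA : mu.-integrable A (EFin \o w).
  by apply: (@integrableS _ _ _ mu K) => //; exact: iw.
have := (integrable_mkcond (EFin \o w) mA).1 iA; congr (mu.-integrable _ _).
apply/funext => x; rewrite patchE /= indicE; case: (x \in A); by rewrite /= ?mul1r ?mul0r.
Qed.

Lemma L1loc_cube w Q : L1loc w -> Li (fun x => \1_(cube Q) x * w x).
Proof.
move=> hw; apply: (L1loc_box (a := fun i => (tnth Q.2 i)%:~R * 2 ^ Q.1)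
  (b := fun i => ((tnth Q.2 i)%:~R + 1) * 2 ^ Q.1)) => //; first exact: measurable_cube.
by move=> x Qx i; have /andP[-> /ltW ->] := Qx i.
Qed.

Lemma L1loc_centered_box w K : L1loc w -> Li (fun x => \1_(bx K) x * w x).
Proof.
move=> hw; apply: (L1loc_box (a := fun=> - 2 ^+ K) (b := fun=> 2 ^+ K)) => //.
  exact: measurable_centered_box.
by move=> x Kx i; have /andP[-> /ltW ->] := Kx i.
Qed.

Lemma integral_cube w Q : L1loc w ->
  (\int[mu]_(x in cube Q) (w x)%:E = (J (fun x => \1_(cube Q) x * w x))%:E)%E.
Proof.
move=> hw; rewrite -(Li_EFin (L1loc_cube Q hw)) [LHS]integral_mkcond; apply: eq_integral => x _.
by rewrite patchE indicE; case: (x \in cube Q); rewrite /= ?mul1r ?mul0r.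
Qed.

Lemma restr_of_real Q w : restr Q w = of_real (fun x => \1_(cube Q) x * w x).
Proof. by []. Qed.

Lemma L2_trunc n u Q : weight u -> L2r (fun x => \1_(cube Q) x * trunc n u x).
Proof.
move=> hu; have mQ := @measurable_cube R N Q; have u0 := hu.2.
have mt : measurable_fun setT (trunc n u).
  by apply: measurable_minr => //; exact: hu.1.
have hQ : L2r (fun x => n%:R * \1_(cube Q) x) by apply: LwZ; exact: L2_ind.
apply: Lw_le hQ => //; first exact: measurable_funM.
move=> x; rewrite !normrM mulrC; apply: ler_wpM2r => //.
by rewrite ger0_norm ?le_min ?u0 ?ler0n// ger0_norm ?ler0n// /trunc ge_min lexx orbT.
Qed.

Section Testing.
Variables (T : (X -> R[i]) -> X -> R[i]) (u v : X -> R) (C : R) (Q : dyadic N).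
Hypotheses (T_mem : forall f, L2 f -> L2 (T f)) (hu : L1loc u) (u0 : forall x, 0 <= u x).
Hypothesis hv : weight v.
Let c := Num.sqrt (Num.max C 0).
Let m := J (fun x => \1_(cube Q) x * u x).

Let m0 : 0 <= m.
Proof. by apply: J_ge0 => x; rewrite mulr_ge0// indicE. Qed.

(** The integrand is the sum of the contributions of the real and the imaginary
    part, so each of them satisfies the bound. *)
Lemma testing_part w : L2r (fun x => \1_(cube Q) x * w x) ->
  (\int[mu]_x (normc (T (restr Q w) x) ^+ 2 * v x)%R%:E
     <= C%:E * \int[mu]_(x in cube Q) (u x)%:E)%E ->
  (Lw v (re_op T (fun x => \1_(cube Q) x * w x)) /\
     nw v (re_op T (fun x => \1_(cube Q) x * w x)) <= c * Num.sqrt m) /\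
  (Lw v (im_op T (fun x => \1_(cube Q) x * w x)) /\
     nw v (im_op T (fun x => \1_(cube Q) x * w x)) <= c * Num.sqrt m).
Proof.
move=> /L2_of_real /T_mem /L2P [[mr _] [mi _]].
rewrite integral_cube// -/m -EFinM restr_of_real.
set F := T _ in mr mi * => bd; have [mv v0] := hv.
have sE x : normc (F x) ^+ 2 * v x = v x * re F x * re F x + v x * im F x * im F x.
  by rewrite sqr_normcE /re /im; ring.
have mF : measurable_fun setT (fun x => normc (F x) ^+ 2 * v x).
  rewrite (_ : (fun x => _) = (fun x => v x * re F x * re F x + v x * im F x * im F x)); last exact/funext.
  by apply: measurable_funD; do 2?apply: measurable_funM.
have LF : Li (fun x => normc (F x) ^+ 2 * v x).
  apply: Li_ge0 => //; first by move=> x; rewrite mulr_ge0// sqr_ge0.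
  by apply: le_lt_trans bd _; rewrite ltry.
have Jb : J (fun x => normc (F x) ^+ 2 * v x) <= c ^+ 2 * m.
  have : J (fun x => normc (F x) ^+ 2 * v x) <= C * m.
    by rewrite -lee_fin; move: bd; rewrite Li_EFin.
  move=> h; apply: le_trans h _; apply: ler_wpM2r => //.
  by rewrite sqr_sqrtr ?le_max ?lexx ?orbT.
have part (G : X -> R) : measurable_fun setT G ->
    (forall x, v x * G x * G x <= normc (F x) ^+ 2 * v x) -> Lw v G /\ nw v G <= c * Num.sqrt m.
  move=> mG Gle; have LG : Lw v G.
    split => //; apply: Li_le LF; first by do 2?apply: measurable_funM.
    by move=> x; rewrite ger0_norm// (w_sqr_ge0 hv).
  split => //; have -> : c * Num.sqrt m = Num.sqrt (c ^+ 2 * m).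
    by rewrite sqrtrM ?sqr_ge0// sqrtr_sqr ger0_norm// sqrtr_ge0.
  rewrite ler_wsqrtr//; apply: le_trans Jb; apply: J_le => //; exact: LG.2.
split; apply: part => // x; rewrite sE.
  by rewrite lerDl (w_sqr_ge0 hv).
by rewrite lerDr (w_sqr_ge0 hv).
Qed.

Lemma testing_truncation : testing T u v C Q ->
  truncation_testing (re_op T) u v c Q /\ truncation_testing (im_op T) u v c Q.
Proof.
move=> [tL tn]; have wu := L1loc_weight hu u0; have [mu' _] := hu.
suff [w [mw wu' wc wL bd]] : exists w : nat -> X -> R,
   [/\ forall n, measurable_fun setT (w n), forall n x, 0 <= w n x <= u x,
      forall x, w n x @[n --> \oo] --> u x, forall n, L2r (fun x => \1_(cube Q) x * w n x) &
      forall n, (\int[mu]_x (normc (T (restr Q (w n)) x) ^+ 2 * v x)%R%:E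
     <= C%:E * \int[mu]_(x in cube Q) (u x)%:E)%E].
  split; exists w; split => // n; by have [h1 h2] := testing_part (wL n) (bd n).
have [hL|nL] := pselect (L2 (restr Q u)).
  exists (fun=> u); split => //.
  - by move=> _ x; rewrite u0 lexx.
  - by move=> x; exact: cvg_cst.
  - by move=> _; exact/L2_of_real.
  - by move=> _; exact: tL.
exists (fun n => trunc n.+1 u); split.
- by move=> n; apply: measurable_minr.
- by move=> n x; rewrite /trunc le_min u0 ler0n ge_min lexx.
- move=> x; apply: cvg_near_cst; exists (Num.truncn (u x)) => // n /= le.
  by apply: min_l; apply: ltW; apply: lt_le_trans (truncnS_gt _) _; rewrite ler_nat.
- by move=> n; exact: L2_trunc.
- by move=> n; exact: tn.
Qed.

End Testing.

Lemma truncation_testing_neg S u v c Q :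
  weight v -> truncation_testing S u v c Q -> truncation_testing (neg_op S) u v c Q.
Proof.
move=> hv [w [mw wu wc wL bd]]; exists w; split => // n; have [h1 h2] := bd n.
have -> : neg_op S (fun x => \1_(cube Q) x * w n x) = (fun x => -1 * S (fun x => \1_(cube Q) x * w n x) x).
  by apply/funext => x; rewrite mulN1r.
split; first exact: LwZ.
by rewrite (nwZ hv)// normrN1 mul1r.
Qed.

End Integrability.

(** * Sufficiency and necessity of testing *)

Section TwoWeight.
Context {R : realType} {N : nat}.
Local Notation X := (Rn R N).
Local Notation mu := (Defs.lebesgue_measureN R N).
Local Notation cube := (@Defs.cube R N).
Local Notation Li := (Li mu).
Local Notation J := (J mu).
Local Notation Lw := (Lw mu).
Local Notation nw := (nw mu).
Local Notation ipw := (ipw mu).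
Local Notation ip := (ipw (fun=> 1)).
Local Notation L2r := (Lw (fun=> 1)).
Local Notation nr := (nw (fun=> 1)).
Implicit Types (f g h : X -> R[i]) (p q u v w : X -> R) (T : (X -> R[i]) -> X -> R[i]) (Q : dyadic N).
Let w1 : weight (fun _ : X => 1 : R) := weight1.

Definition scale p f : X -> R[i] := fun x => (p x)%:C * f x.

Lemma re_scale p f : re (scale p f) = fun x => p x * re f x.
Proof. by apply/funext => x; rewrite /re /scale; case: (f x) => a b /=; ring. Qed.

Lemma im_scale p f : im (scale p f) = fun x => p x * im f x.
Proof. by apply/funext => x; rewrite /im /scale; case: (f x) => a b /=; ring. Qed.

(** Multiplication by sqrt v is an isometry of L^2(v) into L^2. *)
Lemma sqrt_weight v p : weight v -> Lw v p ->
  L2r (fun x => Num.sqrt (v x) * p x) /\ nr (fun x => Num.sqrt (v x) * p x) = nw v p.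
Proof.
move=> [mv v0] [mp hp].
have e x : 1 * (Num.sqrt (v x) * p x) * (Num.sqrt (v x) * p x) = v x * p x * p x.
  by rewrite -[in RHS](sqr_sqrtr (v0 x)); ring.
split; last by congr Num.sqrt; exact: eqJ.
split; first by apply: measurable_funM => //; exact: measurable_sqrt_ge0.
by have -> : (fun x => 1 * (Num.sqrt (v x) * p x) * (Num.sqrt (v x) * p x)) = (fun x => v x * p x * p x)
  by exact/funext.
Qed.

Lemma cnorm_le_parts f (a b K : R) : 0 <= K -> nr (re f) <= K * (a + b) -> nr (im f) <= K * (a + b) ->
  cnorm f <= 2 * K * Num.sqrt (a ^+ 2 + b ^+ 2).
Proof.
move=> K0 hr hi; have h0 := sqrtr_ge0 (a ^+ 2 + b ^+ 2).
rewrite -(ler_pXn2r (_ : 0 < 2)%N)// ?nnegrE ?cnorm_ge0 ?mulr_ge0//.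
have e : Num.sqrt (a ^+ 2 + b ^+ 2) ^+ 2 = a ^+ 2 + b ^+ 2 by rewrite sqr_sqrtr ?addr_ge0 ?sqr_ge0.
rewrite sqr_cnorm !exprMn e.
have sq (s : R) : 0 <= s -> s <= K * (a + b) -> s ^+ 2 <= K ^+ 2 * (a + b) ^+ 2.
  by move=> s0 sK; rewrite -exprMn ler_pXn2r ?nnegrE//; apply: le_trans sK.
have h1 := sq _ (nw_ge0 _ _ _) hr; have h2 := sq _ (nw_ge0 _ _ _) hi.
apply: le_trans (lerD h1 h2) _; rewrite -subr_ge0.
rewrite (_ : _ - _ = 2 * (K * (a - b)) ^+ 2); last by ring.
by rewrite mulr_ge0 ?sqr_ge0.
Qed.

(** [real_two_weight] bounds the real and imaginary parts of T on the real and
    imaginary parts of f; the four pieces are recombined by [cnorm_le_parts]. *)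
Lemma bounded_of_testing r T T' u v C : (0 < N)%N -> band_operator r T -> L2_adjoint T T' ->
  (forall x, 0 <= u x) -> (forall x, 0 <= v x) -> L1loc u -> L1loc v ->
  (forall Q, testing T u v C Q /\ testing T' v u C Q) ->
  weighted_bounded_by T u v (2 * (@two_weight_const R N r * Num.sqrt (Num.max C 0))).
Proof.
move=> N0 band adj u0 v0 lu lv tst f hf; rewrite -/(scale _ f) => hg.
have hu := L1loc_weight lu u0; have hv := L1loc_weight lv v0.
have iu K := L1loc_centered_box K lu; have iv K := L1loc_centered_box K lv.
have T_mem h : L2 h -> L2 (T h) by case: band => -[H _ _] _; exact: H.
have T'_mem h : L2 h -> L2 (T' h) by case: adj => H _; exact: H.
set c := Num.sqrt _; have c0 : 0 <= c by exact: sqrtr_ge0.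
set A := two_weight_const _; have Ac0 : 0 <= A * c by rewrite mulr_ge0 ?two_weight_const_ge0.
have [B [lpr lpi]] := local_pair_parts band adj.
have tT Q := testing_truncation T_mem lu u0 hv (tst Q).1.
have tT' Q := testing_truncation T'_mem lv v0 hu (tst Q).2.
have [fr fi] := (L2P f).1 hf; have [gr gi] := (L2P _).1 hg; rewrite re_scale in gr; rewrite im_scale in gi.
have br p := real_two_weight N0 lpr c0 hu iu hv iv (fun Q => (tT Q).1) (fun Q => (tT' Q).1) (f := p).
have bi p := real_two_weight N0 lpi c0 hu iu hv iv (fun Q => (tT Q).2)
  (fun Q => truncation_testing_neg hu (tT' Q).2) (f := p).
pose g1 x := Num.sqrt (u x) * re f x; pose g2 x := Num.sqrt (u x) * im f x.
rewrite -/g1 in gr; rewrite -/g2 in gi.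
have [r1 r1b] := br _ fr gr; have [r2 r2b] := br _ fi gi.
have [i1 i1b] := bi _ fr gr; have [i2 i2b] := bi _ fi gi.
have gE : (fun y => g1 y +i* g2 y) = scale (fun x => Num.sqrt (u x)) f.
  by apply/funext => x; rewrite /g1 /g2 /re /im /scale; case: (f x) => a b /=; simpc.
have := op_split band gr gi; rewrite gE.
have [Tr Ti] := (L2P _).1 (T_mem _ hg).
set F := T _ in Tr Ti * => split_ae.
have eR : {ae mu, forall x, re_op T g1 x - im_op T g2 x = re F x}.
  by apply: filterS split_ae => x [].
have eI : {ae mu, forall x, im_op T g1 x + re_op T g2 x = im F x}.
  by apply: filterS split_ae => x [].
have dR := LwB hv r1 i2; have dI := LwD hv i1 r2.
have LR := Lw_ae hv Tr.1 eR dR; have LI := Lw_ae hv Ti.1 eI dI.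
have bR : nw v (re F) <= A * c * (nr (re f) + nr (im f)).
  rewrite -(@nw_ae _ _ _ mu v hv _ _ dR.1 Tr.1 eR).
  by apply: le_trans (nwB hv r1 i2) _; rewrite mulrDr lerD.
have bI : nw v (im F) <= A * c * (nr (re f) + nr (im f)).
  rewrite -(@nw_ae _ _ _ mu v hv _ _ dI.1 Ti.1 eI).
  by apply: le_trans (nwD hv i1 r2) _; rewrite mulrDr lerD.
have [sR nR] := sqrt_weight hv LR; have [sI nI] := sqrt_weight hv LI.
rewrite -/(scale (fun x => Num.sqrt (v x)) F) (L2norm_cnorm hf) L2norm_parts ?re_scale ?im_scale// lee_fin.
by apply: cnorm_le_parts => //; rewrite ?re_scale ?im_scale ?nR ?nI.
Qed.

(** For h = T* (sqrt v g), test the bound for T with f_n = sqrt u h cut to the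
    set where u <= n: the square of the norm of f_n equals
    <sqrt v T (sqrt u f_n), g> and is at most B |f_n| |g|. Then let n grow. *)
Lemma bounded_adjoint T T' u v B : (forall f, L2 f -> L2 (T f)) -> L2_adjoint T T' ->
  weight u -> weight v -> weighted_bounded_by T u v B -> weighted_bounded_by T' v u `|B|.
Proof.
move=> T_mem adj hu hv bT g hg; rewrite -/(scale _ g) => hvg.
have T'_mem h : L2 h -> L2 (T' h) by case: adj => H _; exact: H.
have hh := T'_mem _ hvg; set h := T' _ in hh *; have [hr hi] := (L2P h).1 hh.
have [gr gi] := (L2P g).1 hg; have [mu' u0] := hu; have [mv v0] := hv.
pose E n : set X := [set x | u x <= n%:R].
have mE n : measurable (E n).
  rewrite (_ : E n = u @^-1` `]-oo, n%:R]); last by apply/seteqP; split => x /=; rewrite in_itv.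
  by rewrite -[X in measurable X]setTI; exact: mu'.
pose F n x := \1_(E n) x * Num.sqrt (u x).
have mF n : measurable_fun setT (F n) by apply: measurable_funM => //; exact: measurable_sqrt_ge0.
have F0 n x : 0 <= F n x by rewrite mulr_ge0 ?sqrtr_ge0// indicE.
have FE n x : Num.sqrt (u x) * F n x = \1_(E n) x * u x.
  by rewrite /F -[in RHS](sqr_sqrtr (u0 x)); ring.
have F2 n x : F n x * F n x = \1_(E n) x * u x.
  rewrite -FE {1}/F; have : \1_(E n) x * F n x = F n x; last by move=> e; rewrite mulrAC e mulrC.
  by rewrite /F mulrA indicE; case: (_ \in _); rewrite /= ?mulr1 ?mulr0.
have Eu n x : \1_(E n) x * u x <= n%:R.
  by rewrite indicE; case: (boolP (x \in E n)) => [/set_mem|_]; rewrite /= ?mul1r ?mul0r.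
have Fb n x : F n x <= n.+1%:R.
  rewrite -(ler_pXn2r (_ : 0 < 2)%N)// ?nnegrE// expr2 F2; apply: le_trans (Eu n x) _.
  by rewrite -natrX ler_nat expnS expn1 (leq_trans (leqnSn n))// leq_pmulr.
have bdd (a : X -> R) K p : measurable_fun setT a -> (forall x, 0 <= a x <= K%:R) -> L2r p ->
    L2r (fun x => a x * p x).
  move=> ma aK hp; apply: (Lw_le w1 _ _ (LwZ K%:R hp)).
    by apply: measurable_funM => //; case: hp.
  move=> x; have /andP[a0 aK'] := aK x; rewrite !normrM; apply: ler_wpM2r => //.
  by rewrite !ger0_norm.
have Lf n : L2 (scale (F n) h).
  by apply/L2P; rewrite re_scale im_scale; split; apply: (bdd _ n.+1) => // x; rewrite F0 Fb.
have Luf n : L2 (scale (fun x => Num.sqrt (u x)) (scale (F n) h)).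
  apply/L2P; rewrite re_scale im_scale re_scale im_scale.
  have e p : (fun x => Num.sqrt (u x) * (F n x * p x)) = (fun x => \1_(E n) x * u x * p x).
    by apply/funext => x; rewrite mulrA FE.
  have mEu : measurable_fun setT (fun x => \1_(E n) x * u x) by exact: measurable_funM.
  have Eu0 x : 0 <= \1_(E n) x * u x <= n%:R by rewrite Eu mulr_ge0// indicE.
  by rewrite !e; split; apply: (bdd _ n).
have nb n : cnorm (scale (F n) h) <= `|B| * cnorm g.
  set f := scale (F n) h; set G := T (scale (fun x => Num.sqrt (u x)) f).
  have rf : re f = fun x => F n x * re h x by exact: re_scale.
  have jf : im f = fun x => F n x * im h x by exact: im_scale.
  have LG : L2 G by apply: T_mem; exact: Luf.
  have [Gr Gi] := (L2P G).1 LG.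
  have := bT f (Lf n) (Luf n); rewrite -/(scale (fun x => Num.sqrt (v x)) G) (L2norm_cnorm (Lf n)) => bG.
  have mG : measurable_fun setT (re (scale (fun x => Num.sqrt (v x)) G)) /\
            measurable_fun setT (im (scale (fun x => Num.sqrt (v x)) G)).
    rewrite re_scale im_scale; split; apply: measurable_funM; do ?exact: measurable_sqrt_ge0.
      by case: Gr.
    by case: Gi.
  have LvG : L2 (scale (fun x => Num.sqrt (v x)) G).
    by split; [case: mG|case: mG|apply: le_lt_trans bG _; rewrite -EFinM ltry].
  move: bG; rewrite (L2norm_cnorm LvG) -EFinM lee_fin => bG.
  have sq : cnorm f ^+ 2 = complex.Re (L2inner (scale (fun x => Num.sqrt (v x)) G) g).
    transitivity (complex.Re (L2inner G (scale (fun x => Num.sqrt (v x)) g))).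
      rewrite (L2_adjoint_inner adj (Luf n) hvg) -/h (L2inner_parts (Luf n) hh) /= sqr_cnorm.
      rewrite !re_scale !im_scale !(sqr_nw mu w1) ?rf ?jf.
      have key p x : 1 * (F n x * p x) * (F n x * p x) = 1 * (Num.sqrt (u x) * (F n x * p x)) * p x.
        transitivity (F n x * F n x * (p x * p x)); first by ring.
        by rewrite F2 -FE; ring.
      by congr (_ + _); apply: eqJ => x; rewrite key.
    rewrite (L2inner_parts LG hvg) (L2inner_parts LvG hg) /= !re_scale !im_scale.
    by congr (_ + _); apply: eqJ => x; ring.
  have le : cnorm f ^+ 2 <= `|B| * cnorm g * cnorm f.
    rewrite sq; apply: le_trans (re_L2inner_le LvG hg) _.
    rewrite mulrAC; apply: ler_wpM2r; first exact: cnorm_ge0.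
    by apply: le_trans bG _; apply: ler_wpM2r; [exact: cnorm_ge0|exact: ler_norm].
  have [e|e] := eqVneq (cnorm f) 0; first by rewrite e mulr_ge0 ?cnorm_ge0.
  by move: le; rewrite expr2 ler_pM2r// lt_def e cnorm_ge0.
pose q x := u x * re h x * re h x + u x * im h x * im h x.
have q0 x : 0 <= q x by rewrite addr_ge0 ?(w_sqr_ge0 hu).
have [Lq Jq] : Li q /\ J q <= (`|B| * cnorm g) ^+ 2.
  apply: (@J_fatou _ _ _ mu (fun n x => \1_(E n) x * q x)).
  - move=> n; have [a1 a2] := (L2P _).1 (Lf n).
    rewrite (_ : (fun x => _) = (fun x => 1 * re (scale (F n) h) x * re (scale (F n) h) x +
      1 * im (scale (F n) h) x * im (scale (F n) h) x)); first by apply: LiD; [exact: a1.2|exact: a2.2].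
    apply/funext => x; rewrite re_scale im_scale /q.
    transitivity (F n x * F n x * (re h x * re h x + im h x * im h x)); last by ring.
    by rewrite F2; ring.
  - by move=> n x; rewrite mulr_ge0// indicE.
  - move=> x; apply: cvg_near_cst; exists (Num.truncn (u x)).+1 => // n /= le.
    rewrite indicE mem_set ?mul1r//; apply: ltW; apply: lt_le_trans (truncnS_gt _) _.
    by rewrite ler_nat.
  - move=> n; apply: (@le_trans _ _ (cnorm (scale (F n) h) ^+ 2)); last first.
      by rewrite ler_pXn2r ?nnegrE ?cnorm_ge0 ?mulr_ge0 ?cnorm_ge0.
    have [a1 a2] := (L2P _).1 (Lf n).
    rewrite sqr_cnorm !(sqr_nw mu w1) /ipw -JD; [|exact: a1.2|exact: a2.2].
    rewrite le_eqVlt; apply/orP; left; apply/eqP; apply: eqJ => x; rewrite re_scale im_scale /q.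
    transitivity (F n x * F n x * (re h x * re h x + im h x * im h x)); last by ring.
    by rewrite F2; ring.
have part p : measurable_fun setT p -> (forall x, u x * p x * p x <= q x) -> Lw u p.
  move=> mp pq; split => //; apply: Li_le Lq; first by do 2?apply: measurable_funM.
  by move=> x; rewrite ger0_norm ?(w_sqr_ge0 hu).
have ur : Lw u (re h) by apply: part; [case: hr|move=> x; rewrite /q lerDl (w_sqr_ge0 hu)].
have ui : Lw u (im h) by apply: part; [case: hi|move=> x; rewrite /q lerDr (w_sqr_ge0 hu)].
have [sR nR] := sqrt_weight hu ur; have [sI nI] := sqrt_weight hu ui.
rewrite -/(scale (fun x => Num.sqrt (u x)) h) (L2norm_cnorm hg) L2norm_parts ?re_scale ?im_scale// lee_fin.
rewrite -(ler_pXn2r (_ : 0 < 2)%N)// ?nnegrE ?cnorm_ge0 ?mulr_ge0 ?cnorm_ge0//.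
rewrite sqr_cnorm re_scale im_scale nR nI !(sqr_nw mu hu) /ipw -JD//; [exact: ur.2|exact: ui.2].
Qed.

(** Insert the real function p = 1_Q w / sqrt u, with w = u or w a truncation of
    u: then sqrt u p = 1_Q w, and the square of p is at most 1_Q u. *)
Lemma testing_of_bounded T u v B Q : (forall x, 0 <= u x) -> L1loc u -> (forall x, 0 <= v x) ->
  weighted_bounded_by T u v B -> testing T u v (B ^+ 2) Q.
Proof.
move=> u0 lu v0 bT; have hu := L1loc_weight lu u0.
have mQ := @measurable_cube R N Q; have iQ := L1loc_cube Q lu.
suff main w : measurable_fun setT w -> (forall x, 0 <= w x <= u x) -> L2 (restr Q w) ->
   (\int[mu]_x (normc (T (restr Q w) x) ^+ 2 * v x)%R%:E
     <= (B ^+ 2)%:E * \int[mu]_(x in cube Q) (u x)%:E)%E.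
  split => [hL|_ n n0].
    by apply: main => //; [case: lu|move=> x; rewrite u0 lexx].
  apply: main.
  - by apply: measurable_minr => //; case: lu.
  - by move=> x; rewrite /trunc le_min u0 ler0n ge_min lexx.
  - by rewrite restr_of_real; apply/L2_of_real; exact: L2_trunc.
move=> mw wu hL; rewrite integral_cube// -EFinM; set m := J _.
have m0 : 0 <= m by apply: J_ge0 => x; rewrite mulr_ge0// indicE.
pose p x := \1_(cube Q) x * (w x / Num.sqrt (u x)).
have mp : measurable_fun setT p.
  apply: measurable_funM => //; apply: measurable_funM => //.
  by apply: measurable_inv_ge0 => [|x]; [apply: measurable_sqrt_ge0 => //; case: lu|exact: sqrtr_ge0].
have w0 x : u x = 0 -> w x = 0.
  by move=> e; have := wu x; rewrite e => h; apply/eqP; rewrite eq_le andbC.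
have su x : u x != 0 -> 0 < Num.sqrt (u x) by move=> e; rewrite sqrtr_gt0 lt_def e u0.
have pu x : Num.sqrt (u x) * p x = \1_(cube Q) x * w x.
  have [e|e] := eqVneq (u x) 0; first by rewrite e sqrtr0 mul0r w0// mulr0.
  by rewrite /p; field; rewrite gt_eqF// su.
have p0 x : 0 <= p x by rewrite mulr_ge0 ?indicE// divr_ge0 ?sqrtr_ge0//; case/andP: (wu x).
have ple x : p x <= \1_(cube Q) x * Num.sqrt (u x).
  rewrite /p; apply: ler_wpM2l; first by rewrite indicE.
  have [e|e] := eqVneq (u x) 0; first by rewrite e sqrtr0 invr0 mulr0.
  by rewrite ler_pdivrMr ?su// -expr2 sqr_sqrtr//; case/andP: (wu x).
have pp x : 1 * p x * p x <= \1_(cube Q) x * u x.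
  rewrite mul1r; apply: le_trans (ler_pM (p0 x) (p0 x) (ple x) (ple x)) _.
  rewrite -expr2 exprMn sqr_sqrtr// indicE; case: (_ \in _); by rewrite /= ?expr1n ?expr0n ?mul0r.
have Lp : L2r p.
  split => //; apply: Li_le iQ; first by apply: measurable_funM => //; apply: measurable_funM => //; exact: mp.
  by move=> x; rewrite ger0_norm ?pp// mul1r mulr_ge0.
have np : nr p ^+ 2 <= m by rewrite (sqr_nw mu w1); apply: J_le => //; exact: Lp.2.
have e : (fun y => (Num.sqrt (u y))%:C * of_real p y) = restr Q w.
  by apply/funext => x; rewrite /of_real /restr -pu; simpc.
have := bT (of_real p) ((L2_of_real p).2 Lp); rewrite e => /(_ hL).
rewrite (L2norm_cnorm ((L2_of_real p).2 Lp)) cnorm_of_real L2normE -EFinM.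
have -> : (\int[mu]_x (normc ((Num.sqrt (v x))%:C * T (restr Q w) x) ^+ 2)%:E =
   \int[mu]_x (normc (T (restr Q w) x) ^+ 2 * v x)%:E)%E.
  apply: eq_integral => x _; congr (_%:E); rewrite !sqr_normcE.
  rewrite -[in RHS](sqr_sqrtr (v0 x)); case: (T _ x) => a b /=; ring.
have : (0 <= \int[mu]_x (normc (T (restr Q w) x) ^+ 2 * v x)%:E)%E.
  by apply: integral_ge0 => x _; rewrite lee_fin mulr_ge0// sqr_ge0.
case: (\int[mu]_x _)%E => [s| |]//; last by rewrite poweRyr// gt_eqF// invr_gt0.
rewrite !lee_fin => s0; rewrite powR12_sqrt// => le.
have : Num.sqrt s ^+ 2 <= (B * nr p) ^+ 2.
  by rewrite ler_pXn2r ?nnegrE ?sqrtr_ge0//; apply: le_trans le; exact: sqrtr_ge0.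
rewrite sqr_sqrtr// exprMn => h; apply: le_trans h _; apply: ler_wpM2l => //; exact: sqr_ge0.
Qed.

End TwoWeight.

Theorem theorem1p2 (R : realType) :
  exists A : nat -> nat -> R -> R,
  forall (N r : nat) (T Tadj : (Rn R N -> R[i]) -> (Rn R N -> R[i]))
    (u v : Rn R N -> R),
    (0 < N)%N ->
    band_operator r T -> L2_adjoint T Tadj ->
    (forall x, 0 <= u x) -> (forall x, 0 <= v x) -> L1loc u -> L1loc v ->
    ((exists B : R, weighted_bounded_by T u v B) <->
     (exists C : R, forall Q : dyadic N,
        testing T u v C Q /\ testing Tadj v u C Q)) /\
    (forall C : R,
       (forall Q : dyadic N, testing T u v C Q /\ testing Tadj v u C Q) ->
       weighted_bounded_by T u v (A N r C)).
Proof.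
exists (fun N r C => 2 * (@two_weight_const R N r * Num.sqrt (Num.max C 0))).
move=> N r T T' u v N0 band adj u0 v0 lu lv.
have suf C : (forall Q : dyadic N, testing T u v C Q /\ testing T' v u C Q) ->
    weighted_bounded_by T u v (2 * (@two_weight_const R N r * Num.sqrt (Num.max C 0))).
  exact: bounded_of_testing.
split => //; split => [[B bT]|[C tst]]; last by eexists; exact: suf tst.
exists (B ^+ 2) => Q; split; first exact: testing_of_bounded.
rewrite -[B ^+ 2]real_normK ?num_real//; apply: testing_of_bounded => //.
have T_mem f : L2 f -> L2 (T f) by case: band => -[H _ _] _; exact: H.
by apply: bounded_adjoint bT => //; exact: L1loc_weight.
Qed.
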